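(* Let $M^5\subset\mathbb{C}^3$ be a local rigid real-analytic graphed hypersurface passing through the origin, of equation $$u=F(z,\zeta,\bar z,\bar\zeta)=\sum_{a+b+c+d\geq 1}F_{a,b,c,d}\,z^a\zeta^b\bar z^c\bar\zeta^d ,$$ whose Levi form is of constant rank $1$ and which is $2$-nondegenerate in the sense that, near the origin, $$F_{z\bar z}\neq 0\equiv\begin{vmatrix}F_{z\bar z}&F_{z\bar\zeta}\\ F_{\zeta\bar z}&F_{\zeta\bar\zeta}\end{vmatrix}\qquad\text{and}\qquad 0\neq\begin{vmatrix}F_{z\bar z}&F_{z\bar\zeta}\\ F_{zz\bar z}&F_{zz\bar\zeta}\end{vmatrix}.$$ Then $M$ is equivalent, through a local rigid biholomorphism $$(z,\zeta,w)\longmapsto\big(f(z,\zeta),\,g(z,\zeta),\,\rho w+h(z,\zeta)\big)=:(z',\zeta',w')\qquad(\rho\in\mathbb{R}\setminus\{0\}),$$ to a rigid real-analytic hypersurface $M'^5\subset\mathbb{C}^3$ which, dropping primes on the target coordinates, has equation $$u=\frac{z\bar z+\frac12 z^2\bar\zeta+\frac12\bar z^2\zeta}{1-\zeta\bar\zeta}+\sum_{\substack{a,b,c,d\in\mathbb{N}\\ a+c\geq 3}}G_{a,b,c,d}\,z^a\zeta^b\bar z^c\bar\zeta^d ,$$ where the remainder $G=\sum G_{a,b,c,d}z^a\zeta^b\bar z^c\bar\zeta^d$ satisfies: (1) $G=O_{z,\bar z}(3)$, i.e. every monomial of $G$ has $a+c\geq 3$; (2) for all $a,b,c,d\in\mathbb{N}$: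 $G_{a,b,0,0}=0=G_{0,0,c,d}$, $G_{a,b,1,0}=0=G_{1,0,c,d}$, $G_{a,b,2,0}=0=G_{2,0,c,d}$ (equivalently $G=O_{\bar z}(3)+O_{\bar\zeta}(1)=O_z(3)+O_\zeta(1)$); (3) $G_{3,0,0,1}=0=G_{0,1,3,0}$ and $\operatorname{Im}G_{3,0,1,1}=0=\operatorname{Im}G_{1,1,3,0}$.
   Context: Coordinates on $\mathbb{C}^3$ are $(z,\zeta,w)$ with $w=u+iv$. A hypersurface is rigid if it is graphed as $u=F(z,\zeta,\bar z,\bar\zeta)$ with $F$ real-valued and independent of $v$. A rigid biholomorphism is a local biholomorphism of the form $(z,\zeta,w)\mapsto(f(z,\zeta),g(z,\zeta),\rho w+h(z,\zeta))$ with $f,g,h$ holomorphic, $\rho\in\mathbb{R}\setminus\{0\}$ and $f_zg_\zeta-f_\zeta g_z\neq0$. Subscripts on $F$ denote partial derivatives. The notation $O_{x}(k)$ means a convergent power series of the form $x^k\cdot(\text{power series})$, $O_{x,y}(k)$ a series all of whose monomials have total degree $\geq k$ in $(x,y)$, and sums such as $O_{\bar z}(3)+O_{\bar\zeta}(1)$ mean $\bar z^3A+\bar\zeta B$ for convergent power series $A,B$. *)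

(* Defs.v *)
From Stdlib Require Import Reals.
From Coquelicot Require Import Coquelicot.
Open Scope R_scope.

(* Convergent power series are given by their coefficient arrays.
   A series in (z, zeta, zbar, zetabar) is  nat -> nat -> nat -> nat -> C,
   a holomorphic series in (z, zeta) is     nat -> nat -> C. *)
Definition coef4 := nat -> nat -> nat -> nat -> C.
Definition coef2 := nat -> nat -> C.

Fixpoint csum (f : nat -> C) (n : nat) : C :=
  match n with O => RtoC 0 | S m => Cplus (csum f m) (f m) end.
Fixpoint rsum (f : nat -> R) (n : nat) : R :=
  match n with O => 0 | S m => rsum f m + f m end.

Definition psum4 (F : coef4) (x1 x2 x3 x4 : C) (N : nat) : C :=
  csum (fun a => csum (fun b => csum (fun c => csum (fun d =>
    Cmult (F a b c d) (Cmult (Cmult (Cpow x1 a) (Cpow x2 b))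
                             (Cmult (Cpow x3 c) (Cpow x4 d)))) N) N) N) N.
Definition psum2 (f : coef2) (x1 x2 : C) (N : nat) : C :=
  csum (fun a => csum (fun b =>
    Cmult (f a b) (Cmult (Cpow x1 a) (Cpow x2 b))) N) N.

Definition eval4 (F : coef4) (x1 x2 x3 x4 : C) : C :=
  (real (Lim_seq (fun N => Re (psum4 F x1 x2 x3 x4 N))),
   real (Lim_seq (fun N => Im (psum4 F x1 x2 x3 x4 N)))).
Definition eval2 (f : coef2) (x1 x2 : C) : C :=
  (real (Lim_seq (fun N => Re (psum2 f x1 x2 N))),
   real (Lim_seq (fun N => Im (psum2 f x1 x2 N)))).

Definition convergent4 (F : coef4) : Prop :=
  exists r B : R, 0 < r /\ forall N : nat,
    rsum (fun a => rsum (fun b => rsum (fun c => rsum (fun d =>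
      Cmod (F a b c d) * r ^ (a + b + c + d)) N) N) N) N <= B.
Definition convergent2 (f : coef2) : Prop :=
  exists r B : R, 0 < r /\ forall N : nat,
    rsum (fun a => rsum (fun b => Cmod (f a b) * r ^ (a + b)) N) N <= B.

Definition evalF (F : coef4) (z zeta : C) : C :=
  eval4 F z zeta (Cconj z) (Cconj zeta).

Definition real_valued (F : coef4) : Prop :=
  exists r : R, 0 < r /\ forall z zeta : C,
    Cmod z < r -> Cmod zeta < r -> Im (evalF F z zeta) = 0.

Definition d_z (F : coef4) : coef4 :=
  fun a b c d => Cmult (RtoC (INR (S a))) (F (S a) b c d).
Definition d_zeta (F : coef4) : coef4 :=
  fun a b c d => Cmult (RtoC (INR (S b))) (F a (S b) c d).
Definition d_zb (F : coef4) : coef4 :=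
  fun a b c d => Cmult (RtoC (INR (S c))) (F a b (S c) d).
Definition d_zetab (F : coef4) : coef4 :=
  fun a b c d => Cmult (RtoC (INR (S d))) (F a b c (S d)).

Definition levi_rank1_2nondeg (F : coef4) : Prop :=
  exists r : R, 0 < r /\ forall z zeta : C,
    Cmod z < r -> Cmod zeta < r ->
    let Fzzb := evalF (d_z (d_zb F)) z zeta in
    let Fzzetab := evalF (d_z (d_zetab F)) z zeta in
    let Fzetazb := evalF (d_zeta (d_zb F)) z zeta in
    let Fzetazetab := evalF (d_zeta (d_zetab F)) z zeta in
    let Fzzzb := evalF (d_z (d_z (d_zb F))) z zeta in
    let Fzzzetab := evalF (d_z (d_z (d_zetab F))) z zeta in
    Fzzb <> RtoC 0 /\
    Cminus (Cmult Fzzb Fzetazetab) (Cmult Fzzetab Fzetazb) = RtoC 0 /\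
    Cminus (Cmult Fzzb Fzzzetab) (Cmult Fzzetab Fzzzb) <> RtoC 0.

Definition model (z zeta : C) : C :=
  Cdiv (Cplus (Cmult z (Cconj z))
          (Cplus (Cmult (RtoC (1/2)) (Cmult (Cmult z z) (Cconj zeta)))
                 (Cmult (RtoC (1/2)) (Cmult (Cmult (Cconj z) (Cconj z)) zeta))))
       (Cminus (RtoC 1) (Cmult zeta (Cconj zeta))).

(* Main.v *)
Require Import Defs.
From Stdlib Require Import Reals Lra Lia Arith FunctionalExtensionality.
From Coquelicot Require Import Coquelicot.
Open Scope R_scope.

(** A real-valued [F] is Hermitian symmetric (identity theorem), so subtracting twice the real
    part of the pluriharmonic series [F(z, zeta, 0, 0)], which [h] absorbs, removes all monomials [a b 0 0]
    and [0 0 c d], and [rho] scales [F 1 0 1 0] to 1.  Given a curve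
    [t -> (zbar, zetabar) = (t + al2 t^2, be t + be2 t^2)], take for the new coordinates [f] and [g] the
    first and second [t]-derivatives at 0 of [F] along it; in the target equation [H] the coefficients of
    [zbar] and [zbar^2] become [z] and [zeta / 2] provided that the curve is the conjugate of the image of
    the [z]-axis to second order; this determines [al2] and leaves [be] and one real parameter of [be2] free.
    In such coordinates the vanishing of the Levi determinant, read off at order [z^a zbar^c], gives
    equations of the form [(unit) * d_zeta d_zetab(fiber) = (terms of lower order)] for the coefficients of
    [z^a zbar^c] with [a + c <= 2], whose solution with prescribed boundary terms is unique: they are those
    of the model, which satisfies the same equations.  The free parameters of the curve then kill
    [G 0 1 3 0] and the imaginary part of [G 1 1 3 0].
    Convergence is controlled by truncated weighted l^1 norms, which are submultiplicative. *)

(** * Sums and power series over a commutative ring *)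

Arguments Cmult : simpl never.
Arguments Cplus : simpl never.
Arguments Cminus : simpl never.
Arguments Copp : simpl never.
Arguments RtoC : simpl never.
Arguments Cconj : simpl never.
Arguments Cmod : simpl never.

(** The coordinates and the curve depend on each other: [f] and [g] are built from the curve, while
    the curve must be the conjugate of what the inverse of (f, g) makes of the z-axis. Only the
    first two zbar-derivatives are normalised, so 2-jets suffice, and [curve_condition] states the
    consistency on known coefficients of [F], before any inverse exists. At second order it leaves a
    single real equation on [be2]; the two real parameters of [be] and the imaginary part of [be2]
    match the complex condition on [G 0 1 3 0] and the real one on [G 1 1 3 0]. They are spent in
    two successive changes, so that the effect of the first one on [G 1 1 3 0] need not be computed.
    Only finitely many changes occur, each made of derivatives of a convergent series; the
    infinitely many conditions with a + c < 3 come from Levi degeneracy. Convergence therefore needs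
    an argument of its own only for composites and inverses. Conjugate variables are treated as
    independent throughout, which the identity theorem justifies. *)

Record cring : Type := CRing {
  car :> Type; c0 : car; c1 : car;
  cadd : car -> car -> car; cmul : car -> car -> car;
  csub : car -> car -> car; copp : car -> car;
  cth : ring_theory c0 c1 cadd cmul csub copp eq }.

Definition Cr : cring := CRing C (RtoC 0) (RtoC 1) Cplus Cmult Cminus Copp C_ring_theory.
Definition Rr : cring := CRing R 0 1 Rplus Rmult Rminus Ropp RTheory.

Declare Scope cr_scope.
Delimit Scope cr_scope with cr.
Notation "x + y" := (cadd _ x y) : cr_scope.
Notation "x * y" := (cmul _ x y) : cr_scope.
Notation "x - y" := (csub _ x y) : cr_scope.
Notation "- x" := (copp _ x) : cr_scope.
Notation "0" := (c0 _) : cr_scope.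
Notation "1" := (c1 _) : cr_scope.

Section Sums.
Variable B : cring.
Add Ring Bring : (cth B).
Local Open Scope cr_scope.

Fixpoint gsum (f : nat -> B) (n : nat) : B :=
  match n with O => 0 | S m => gsum f m + f m end.

Lemma gsum_ext f g n : (forall i, (i < n)%nat -> f i = g i) -> gsum f n = gsum g n.
Proof.
  induction n as [|n IH]; intros H; [reflexivity|]; cbn.
  rewrite IH by (intros; apply H; lia). now rewrite H by lia.
Qed.

Lemma gsum_zero f n : (forall i, (i < n)%nat -> f i = 0) -> gsum f n = 0.
Proof.
  induction n as [|n IH]; intros H; [reflexivity|]; cbn.
  rewrite IH by (intros; apply H; lia). rewrite H by lia. ring.
Qed.

Lemma gsum_add f g n : gsum (fun i => f i + g i) n = gsum f n + gsum g n.
Proof. induction n as [|n IH]; cbn; [|rewrite IH]; ring. Qed.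

Lemma gsum_sub f g n : gsum (fun i => f i - g i) n = gsum f n - gsum g n.
Proof. induction n as [|n IH]; cbn; [|rewrite IH]; ring. Qed.

Lemma gsum_mull c f n : gsum (fun i => c * f i) n = c * gsum f n.
Proof. induction n as [|n IH]; cbn; [|rewrite IH]; ring. Qed.

Lemma gsum_mulr c f n : gsum (fun i => f i * c) n = gsum f n * c.
Proof. induction n as [|n IH]; cbn; [|rewrite IH]; ring. Qed.

Lemma gsum_swap (f : nat -> nat -> B) n m :
  gsum (fun i => gsum (fun j => f i j) m) n = gsum (fun j => gsum (fun i => f i j) n) m.
Proof.
  induction n as [|n IH]; cbn.
  - symmetry; apply gsum_zero; reflexivity.
  - rewrite IH, <- gsum_add; reflexivity.
Qed.

Lemma gsum_head f n : gsum f (S n) = f O + gsum (fun i => f (S i)) n.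
Proof. induction n as [|n IH]; [cbn; ring|]. cbn in *. rewrite IH; ring. Qed.

Lemma gsum_1 f : gsum f 1 = f O.
Proof. cbn; ring. Qed.

Lemma gsum_rev f n : gsum f n = gsum (fun i => f (n - 1 - i)%nat) n.
Proof.
  induction n as [|n IH]; [reflexivity|].
  rewrite (gsum_head (fun i => f (S n - 1 - i)%nat)); cbn [gsum]. rewrite IH.
  replace (S n - 1 - 0)%nat with n by lia.
  rewrite (gsum_ext (fun i => f (S n - 1 - S i)%nat) (fun i => f (n - 1 - i)%nat)).
  - ring.
  - intros; f_equal; lia.
Qed.

Lemma gsum_trunc f n m : (n <= m)%nat -> (forall i, (n <= i)%nat -> f i = 0) ->
  gsum f m = gsum f n.
Proof.
  intros H H0; induction H as [|m H IH]; [reflexivity|].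
  cbn; rewrite IH, H0 by lia; ring.
Qed.

(** Both sides run over the pairs with i + j < N, by antidiagonals and by rows. This regrouping
    underlies associativity of the series product, submultiplicativity of the norms and the Cauchy
    product of evaluations. *)
Lemma gsum_triangle (t : nat -> nat -> B) N :
  gsum (fun n => gsum (fun i => t i (n - i)%nat) (S n)) N
  = gsum (fun i => gsum (fun j => t i j) (N - i)) N.
Proof.
  induction N as [|N IH]; [reflexivity|].
  cbn [gsum] in IH |- *. rewrite IH.
  replace (S N - N)%nat with 1%nat by lia; cbn [gsum].
  replace (N - N)%nat with 0%nat by lia.
  rewrite (gsum_ext (fun i => gsum (fun j => t i j) (S N - i))
    (fun i => gsum (fun j => t i j) (N - i) + t i (N - i)%nat)).
  - rewrite gsum_add; ring.
  - intros i Hi. replace (S N - i)%nat with (S (N - i)) by lia. reflexivity.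
Qed.

Lemma gsum_mul f g n m :
  gsum f n * gsum g m = gsum (fun i => gsum (fun j => f i * g j) m) n.
Proof.
  rewrite <- gsum_mulr. apply gsum_ext; intros. now rewrite gsum_mull.
Qed.

(** Natural multiples by repeated addition, because a general [cring] carries no embedding of the
    naturals; formal derivatives need them. *)
Definition nsc (n : nat) (b : B) : B := gsum (fun _ => b) n.

Lemma nsc_add n a b : nsc n (a + b) = nsc n a + nsc n b.
Proof. apply gsum_add. Qed.
Lemma nsc_mull n a b : nsc n (a * b) = nsc n a * b.
Proof. unfold nsc; now rewrite gsum_mulr. Qed.
Lemma nsc_mulr n a b : nsc n (a * b) = a * nsc n b.
Proof. unfold nsc; now rewrite gsum_mull. Qed.
Lemma nsc_plus n m b : nsc (n + m) b = nsc n b + nsc m b.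
Proof.
  unfold nsc; induction n as [|n IH]; cbn; [ring|]. rewrite IH; ring.
Qed.

Fixpoint cpow (b : B) (n : nat) : B := match n with O => 1 | S m => b * cpow b m end.

Lemma cpow_add b n m : cpow b (n + m) = cpow b n * cpow b m.
Proof. induction n as [|n IH]; cbn; [ring|]. rewrite IH; ring. Qed.

Definition pconv (f g : nat -> B) (n : nat) : B := gsum (fun i => f i * g (n - i)%nat) (S n).
Definition pone (n : nat) : B := match n with O => 1 | _ => 0 end.

(** With functional extensionality the laws hold for Leibniz equality, so [psr B] is again a
    [cring]: one-variable arguments can be iterated four times and [ring] works on series. *)
Lemma ps_theory : ring_theory (fun _ : nat => 0) pone (fun f g n => f n + g n) pconv
  (fun f g n => f n - g n) (fun f n => - f n) eq.
Proof.
  constructor; intros; try (extensionality n; ring).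
  - extensionality n. unfold pconv. rewrite gsum_head.
    rewrite gsum_zero by (intros; cbn; ring). cbn. rewrite Nat.sub_0_r. ring.
  - extensionality n. unfold pconv. rewrite gsum_rev. apply gsum_ext; intros i Hi.
    replace (S n - 1 - i)%nat with (n - i)%nat by lia.
    replace (n - (n - i))%nat with i by lia. ring.
  - extensionality n. unfold pconv. symmetry.
    transitivity (gsum (fun k => gsum (fun i => x i * y (k - i)%nat * z (n - (i
      + (k - i)))%nat) (S k)) (S n)).
    + apply gsum_ext; intros k Hk. rewrite <- gsum_mulr. apply gsum_ext; intros i Hi.
      replace (i + (k - i))%nat with k by lia; reflexivity.
    + rewrite (gsum_triangle (fun i j => x i * y j * z (n - (i + j))%nat)).
      apply gsum_ext; intros i Hi. rewrite <- gsum_mull.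
      replace (S n - i)%nat with (S (n - i)) by lia.
      apply gsum_ext; intros j Hj.
      replace (n - (i + j))%nat with (n - i - j)%nat by lia. ring.
  - extensionality n. unfold pconv. rewrite <- gsum_add. apply gsum_ext; intros; ring.
Qed.

Definition psr : cring := CRing (nat -> B) _ _ _ _ _ _ ps_theory.

Definition pder (f : nat -> B) (n : nat) : B := nsc (S n) (f (S n)).

Definition derivation (A : cring) (d : A -> A) : Prop :=
  (forall x y, d (x + y) = d x + d y) /\ (forall x y, d (x * y) = d x * y + x * d y).

Lemma pder_derivation : derivation psr pder.
Proof.
  split; intros x y; extensionality n.
  - apply (nsc_add (S n)).
  - change (pder (pconv x y) n = pconv (pder x) y n + pconv x (pder y) n).
    unfold pder, pconv.
    (* The factor n + 1 in front of x_i y_(n+1-i) is split as i plus n + 1 - i, one share for each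
       side of the Leibniz rule. *)
    transitivity (gsum (fun i => nsc i (x i) * y (S n - i)%nat) (S (S n)) +
                  gsum (fun i => x i * nsc (S n - i) (y (S n - i)%nat)) (S (S n))).
    + rewrite <- gsum_add. unfold nsc at 1. rewrite gsum_swap.
      apply gsum_ext; intros i Hi.
      change (nsc (S n) (x i * y (S n - i)%nat) =
        nsc i (x i) * y (S n - i)%nat + x i * nsc (S n - i) (y (S n - i)%nat)).
      rewrite <- nsc_mull, <- nsc_mulr, <- nsc_plus. f_equal; lia.
    + f_equal.
      * rewrite gsum_head. cbn [nsc gsum]. replace (nsc 0 (x O)) with (c0 B) by reflexivity.
        rewrite Nat.sub_0_r.
        rewrite (gsum_ext _ (fun i => nsc (S i) (x (S i)) * y (n - i)%nat)).
        -- change (0 * y (S n) + gsum (fun i => nsc (S i) (x (S i)) * y (n - i)%nat) (S n)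
             = gsum (fun i => nsc (S i) (x (S i)) * y (n - i)%nat) (S n)). ring.
        -- intros; reflexivity.
      * change (gsum (fun i => x i * nsc (S n - i) (y (S n - i)%nat)) (S n) +
          x (S n) * nsc (S n - S n) (y (S n - S n)%nat) =
          gsum (fun i => x i * nsc (S (n - i)) (y (S (n - i)))) (S n)).
        replace (S n - S n)%nat with 0%nat by lia. replace (nsc 0 (y O)) with (c0 B) by reflexivity.
        rewrite (gsum_ext _ (fun i => x i * nsc (S (n - i)) (y (S (n - i))))).
        -- ring.
        -- intros i Hi. replace (S n - i)%nat with (S (n - i)) by lia. reflexivity.
Qed.

Lemma derivation_0 (d : B -> B) : derivation B d -> d 0 = 0.
Proof.
  intros [H _]. assert (E : d (0 + 0) = d 0 + d 0) by apply H.
  replace (0 + 0) with (c0 B) in E by ring.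
  replace (d 0) with (d 0 + d 0 - d 0) at 1 by ring. rewrite <- E. ring.
Qed.

Lemma derivation_1 (d : B -> B) : derivation B d -> d 1 = 0.
Proof.
  intros [_ H]. assert (E : d (1 * 1) = d 1 * 1 + 1 * d 1) by apply H.
  replace (1 * 1) with (c1 B) in E by ring.
  replace (d 1) with (d 1 * 1 + 1 * d 1 - d 1) at 1 by ring. rewrite <- E. ring.
Qed.

Lemma derivation_sub (d : B -> B) x y : derivation B d -> d (x - y) = d x - d y.
Proof.
  intros [H _]. replace (d x) with (d ((x - y) + y)) by (f_equal; ring). rewrite H. ring.
Qed.

Lemma derivation_sum (d : B -> B) f n : derivation B d -> d (gsum f n) = gsum (fun i => d (f i)) n.
Proof.
  intros H; induction n as [|n IH]; cbn; [now apply derivation_0|].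
  now rewrite (proj1 H), IH.
Qed.

Lemma derivation_pow (d : B -> B) y n : derivation B d ->
  d (cpow y (S n)) = nsc (S n) (cpow y n * d y).
Proof.
  intros H; induction n as [|n IH].
  - cbn. rewrite (proj2 H), (derivation_1 _ H). unfold nsc; cbn; ring.
  - change (cpow y (S (S n))) with (y * cpow y (S n)). rewrite (proj2 H), IH.
    change (nsc (S (S n)) (cpow y (S n) * d y)) with
      (nsc (S n) (cpow y (S n) * d y) + cpow y (S n) * d y).
    rewrite <- nsc_mulr. replace (y * (cpow y n * d y)) with (cpow y (S n) * d y) by (cbn; ring).
    ring.
Qed.

Lemma map_derivation (d : B -> B) : derivation B d -> derivation psr (fun f n => d (f n)).
Proof.
  intros H; split; intros x y; extensionality n.
  - apply H.
  - change (d (pconv x y n) = pconv (fun n => d (x n)) y n + pconv x (fun n => d (y n)) n).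
    unfold pconv. rewrite derivation_sum by exact H.
    rewrite <- gsum_add. apply gsum_ext; intros; apply H.
Qed.

Lemma pconv_0 f g : pconv f g O = f O * g O.
Proof. unfold pconv; cbn; ring. Qed.

End Sums.

Lemma hom_sum (A B : cring) (h : A -> B) f n :
  h (c0 A) = c0 B -> (forall x y, h (x + y)%cr = (h x + h y)%cr) ->
  h (gsum A f n) = gsum B (fun i => h (f i)) n.
Proof. intros H0 H; induction n as [|n IH]; cbn; [exact H0|]. now rewrite H, IH. Qed.

Lemma gsum_pointwise (B : cring) (f : nat -> psr B) n k :
  gsum (psr B) f n k = gsum B (fun i => f i k) n.
Proof. induction n as [|n IH]; cbn; [reflexivity|]. now rewrite IH. Qed.

Lemma nsc_pointwise (B : cring) n (f : psr B) k : nsc (psr B) n f k = nsc B n (f k).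
Proof. apply gsum_pointwise. Qed.

Record rhom (A B : cring) (h : A -> B) : Prop := {
  hom0 : h (c0 A) = c0 B; hom1 : h (c1 A) = c1 B;
  homadd : forall x y, h (x + y)%cr = (h x + h y)%cr;
  hommul : forall x y, h (x * y)%cr = (h x * h y)%cr }.

Lemma map_rhom (A B : cring) h : rhom A B h -> rhom (psr A) (psr B) (fun f n => h (f n)).
Proof.
  intros [H0 H1 Ha Hm]; split; intros; extensionality n.
  - exact H0.
  - destruct n; [exact H1|exact H0].
  - apply Ha.
  - change (h (pconv A x y n) = pconv B (fun n => h (x n)) (fun n => h (y n)) n). unfold pconv.
    rewrite (hom_sum A B) by assumption. apply gsum_ext; intros; apply Hm.
Qed.

Lemma ev0_rhom (B : cring) : rhom (psr B) B (fun f => f O).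
Proof. split; intros; cbn; try reflexivity. apply pconv_0. Qed.

Lemma csum_gsum f n : csum f n = gsum Cr f n.
Proof. reflexivity. Qed.
Lemma rsum_gsum f n : rsum f n = gsum Rr f n.
Proof. reflexivity. Qed.

Section Inj.
Variable B : cring.
Add Ring Bring2 : (cth B).
Local Open Scope cr_scope.

Definition pinj (b : B) : psr B := fun n => match n with O => b | _ => 0 end.

Lemma pinj_mul (b : B) (f : psr B) n : cmul (psr B) (pinj b) f n = b * f n.
Proof.
  change (cmul (psr B) (pinj b) f n) with (gsum B (fun i => pinj b i * f (n - i)%nat) (S n)).
  rewrite gsum_head, gsum_zero.
  - cbn. rewrite Nat.sub_0_r. ring.
  - intros; cbn; ring.
Qed.

Lemma pinj_rhom : rhom B (psr B) pinj.
Proof.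
  split; intros; extensionality n.
  - destruct n; reflexivity.
  - destruct n; reflexivity.
  - destruct n; cbn; ring.
  - rewrite pinj_mul. destruct n; cbn; ring.
Qed.

Definition pX : psr B := fun n => match n with S O => 1 | _ => 0 end.

Lemma pX_mul_S (f : psr B) n : cmul (psr B) pX f (S n) = f n.
Proof.
  change (cmul (psr B) pX f (S n)) with (gsum B (fun i => pX i * f (S n - i)%nat) (S (S n))).
  rewrite gsum_head, gsum_head, gsum_zero.
  - cbn. rewrite Nat.sub_0_r. ring.
  - intros; cbn; ring.
Qed.

Lemma pX_mul_0 (f : psr B) : cmul (psr B) pX f O = 0.
Proof.
  change (cmul (psr B) pX f O) with (0 + 0 * f O). ring.
Qed.
End Inj.

Lemma rhom_comp (A B D : cring) (h : A -> B) (k : B -> D) :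
  rhom A B h -> rhom B D k -> rhom A D (fun x => k (h x)).
Proof.
  intros [H0 H1 Ha Hm] [K0 K1 Ka Km]; split; intros.
  - now rewrite H0.
  - now rewrite H1.
  - now rewrite Ha.
  - now rewrite Hm.
Qed.

(** * Weighted norms and truncated evaluations *)

Lemma rsum_le f g n : (forall i, (i < n)%nat -> f i <= g i) -> rsum f n <= rsum g n.
Proof.
  induction n as [|n IH]; intros H; cbn; [lra|].
  apply Rplus_le_compat; [apply IH; intros; apply H|apply H]; lia.
Qed.

Lemma rsum_ge0 f n : (forall i, 0 <= f i) -> 0 <= rsum f n.
Proof. intros H; induction n as [|n IH]; cbn; [lra|]. specialize (H n); lra. Qed.

Lemma rsum_mono f n m : (forall i, 0 <= f i) -> (n <= m)%nat -> rsum f n <= rsum f m.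
Proof. intros H L; induction L; [lra|]. cbn. specialize (H m); lra. Qed.

Lemma rsum_ext f g n : (forall i, (i < n)%nat -> f i = g i) -> rsum f n = rsum g n.
Proof. apply (gsum_ext Rr). Qed.

Lemma rsum_scal c f n : rsum (fun i => c * f i) n = c * rsum f n.
Proof. apply (gsum_mull Rr). Qed.

Lemma rsum_scalr c f n : rsum (fun i => f i * c) n = rsum f n * c.
Proof. apply (gsum_mulr Rr). Qed.

Lemma rsum_minus f g n : rsum (fun i => f i - g i) n = rsum f n - rsum g n.
Proof. apply (gsum_sub Rr). Qed.

Lemma csum_Cmod f n : Cmod (csum f n) <= rsum (fun i => Cmod (f i)) n.
Proof.
  induction n as [|n IH]; cbn [csum rsum]; [rewrite Cmod_0; lra|].
  eapply Rle_trans; [apply Cmod_triangle|]. lra.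
Qed.

(* [N] is a truncation level: only the first [N] coefficients in each variable count. *)
Record tnorm (B : cring) (p : nat -> B -> R) : Prop := {
  tn_ge0 : forall N x, 0 <= p N x;
  tn_0 : forall N, p N (c0 B) = 0;
  tn_1 : forall N, p N (c1 B) <= 1;
  tn_add : forall N x y, p N (x + y)%cr <= p N x + p N y;
  tn_mul : forall N x y, p N (x * y)%cr <= p N x * p N y;
  tn_mono : forall N M x, (N <= M)%nat -> p N x <= p M x }.

Lemma tn_sum B p : tnorm B p -> forall N f n, p N (gsum B f n) <= rsum (fun i => p N (f i)) n.
Proof.
  intros H N f n; induction n as [|n IH]; cbn.
  - rewrite (tn_0 _ _ H); lra.
  - eapply Rle_trans; [apply (tn_add _ _ H)|]. lra.
Qed.

Lemma tn_pow B p : tnorm B p -> forall N y r n, p N y <= r -> p N (cpow B y n) <= r ^ n.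
Proof.
  intros H N y r n Hy; induction n as [|n IH]; cbn.
  - apply (tn_1 _ _ H).
  - eapply Rle_trans; [apply (tn_mul _ _ H)|].
    apply Rmult_le_compat; auto; apply (tn_ge0 _ _ H).
Qed.

(** The same [N] cuts the index and is passed on to the coefficients, so that iteration sums over a
    cube of exponents, as [convergent4] does. *)
Definition pnorm (B : cring) (p : nat -> B -> R) (s : R) (N : nat) (f : nat -> B) : R :=
  rsum (fun n => p N (f n) * s ^ n) N.

(** Submultiplicativity survives truncation since the triangle i + j < N lies in the square i, j <
    N. The norm of 1 is only bounded by 1, because at level 0 the sum is empty. *)
Lemma pnorm_tnorm B p s : 0 <= s -> tnorm B p -> tnorm (psr B) (pnorm B p s).
Proof.
  intros Hs H.
  assert (Hp : forall n, 0 <= s ^ n) by (intros; now apply pow_le).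
  assert (H0 := tn_ge0 _ _ H).
  split; unfold pnorm.
  - intros N x. apply rsum_ge0; intros. now apply Rmult_le_pos.
  - intros N. rewrite (rsum_ext _ (fun _ => 0 * 0)).
    + rewrite rsum_scal; ring.
    + intros; cbn. rewrite (tn_0 _ _ H); ring.
  - intros [|N]; [cbn; lra|]. rewrite rsum_gsum, gsum_head, <- rsum_gsum.
    rewrite (rsum_ext _ (fun _ => 0 * 0)).
    + rewrite rsum_scal. cbn. generalize (tn_1 _ _ H (S N)); lra.
    + intros; cbn. rewrite (tn_0 _ _ H); ring.
  - intros N x y. etransitivity.
    2: { apply Req_le. apply (gsum_add Rr). }
    apply rsum_le; intros. cbn. rewrite <- Rmult_plus_distr_r.
    apply Rmult_le_compat_r; auto. apply (tn_add _ _ H).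
  - intros N x y.
    apply Rle_trans with (rsum (fun n => rsum (fun i => (p N (x i) * s ^ i) *
        (p N (y (n - i)%nat) * s ^ (n - i))) (S n)) N).
    + apply rsum_le; intros n Hn.
      rewrite (rsum_ext _ (fun i => (p N (x i) * p N (y (n - i)%nat)) * s ^ n)).
      * rewrite rsum_scalr. apply Rmult_le_compat_r; auto.
        change (p N (pconv B x y n) <= rsum (fun i => p N (x i) * p N (y (n - i)%nat)) (S n)).
        eapply Rle_trans; [apply (tn_sum _ _ H)|].
        apply rsum_le; intros; apply (tn_mul _ _ H).
      * intros i Hi. replace (s ^ n) with (s ^ i * s ^ (n - i)) by (rewrite <- pow_add; f_equal; lia).
        ring.
    + rewrite (gsum_triangle Rr (fun i j => (p N (x i) * s ^ i) * (p N (y j) * s ^ j))).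
      rewrite (gsum_mul Rr). apply rsum_le; intros.
      apply rsum_mono; [|lia].
      intros; cbn; repeat apply Rmult_le_pos; auto.
  - intros N M x L. eapply Rle_trans; [|apply rsum_mono; [|exact L]].
    + apply rsum_le; intros. apply Rmult_le_compat_r; auto. now apply (tn_mono _ _ H).
    + intros. now apply Rmult_le_pos.
Qed.

(* Truncated evaluations: multiplicative only up to the part of the norm lost when the
   truncation level is halved. *)
Record teval (B : cring) (p : nat -> B -> R) (e : nat -> B -> C) : Prop := {
  te_0 : forall N, e N (c0 B) = RtoC 0;
  te_add : forall N x y, e N (x + y)%cr = (e N x + e N y)%C;
  te_le : forall N x, Cmod (e N x) <= p N x;
  te_diff : forall N M x, (M <= N)%nat -> Cmod (e N x - e M x)%C <= p N x - p M x;
  te_mul : forall N M x y, (2 * M <= N + 1)%nat ->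
    Cmod (e N x * e N y - e N (x * y)%cr)%C <= p N x * p N y - p M x * p M y }.

Definition peval (B : cring) (e : nat -> B -> C) (x : C) (N : nat) (f : nat -> B) : C :=
  csum (fun n => (e N (f n) * Cpow x n)%C) N.

Lemma Cmod_pow x n : Cmod (Cpow x n) = Cmod x ^ n.
Proof. induction n as [|n IH]; cbn; [apply Cmod_1|]. now rewrite Cmod_mult, IH. Qed.

Lemma Cpow_plus x n m : Cpow x (n + m) = (Cpow x n * Cpow x m)%C.
Proof. induction n as [|n IH]; [symmetry; apply Cmult_1_l|]. cbn [Nat.add Cpow]; rewrite IH.
  apply Cmult_assoc. Qed.

Lemma Cmod_pow_le x s n : Cmod x <= s -> Cmod (Cpow x n) <= s ^ n.
Proof. intros; rewrite Cmod_pow. apply pow_incr. split; auto; apply Cmod_ge_0. Qed.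

Lemma csum_ext f g n : (forall i, (i < n)%nat -> f i = g i) -> csum f n = csum g n.
Proof. apply (gsum_ext Cr). Qed.

Lemma rsum_restrict f M N : (M <= N)%nat ->
  rsum f M = rsum (fun i => if (i <? M)%nat then f i else 0) N.
Proof.
  intros L. rewrite (rsum_gsum (fun i => if (i <? M)%nat then f i else 0)).
  rewrite (gsum_trunc Rr _ M N L).
  - apply rsum_ext; intros i Hi. apply Nat.ltb_lt in Hi. now rewrite Hi.
  - intros i Hi. apply Nat.ltb_ge in Hi. now rewrite Hi.
Qed.

Lemma csum_restrict f M N : (M <= N)%nat ->
  csum f M = csum (fun i => if (i <? M)%nat then f i else RtoC 0) N.
Proof.
  intros L. rewrite (csum_gsum (fun i => if (i <? M)%nat then f i else RtoC 0)).
  rewrite (gsum_trunc Cr _ M N L).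
  - apply csum_ext; intros i Hi. apply Nat.ltb_lt in Hi. now rewrite Hi.
  - intros i Hi. apply Nat.ltb_ge in Hi. now rewrite Hi.
Qed.

(** For [te_mul]: if i, j < M and 2 M <= N + 1 then i + j < N, so the square of side M is kept
    entirely by the truncated product and the estimate for coefficients applies there. Outside it
    each pair costs at most the product of its norms. *)
Lemma peval_teval B p e x s : Cmod x <= s -> tnorm B p -> teval B p e ->
  teval (psr B) (pnorm B p s) (peval B e x).
Proof.
  intros Hx H E.
  assert (Hs : 0 <= s) by (eapply Rle_trans; [apply Cmod_ge_0|exact Hx]).
  assert (Hp : forall n, 0 <= s ^ n) by (intros; now apply pow_le).
  assert (H0 := tn_ge0 _ _ H).
  assert (Hxn : forall n, Cmod (Cpow x n) <= s ^ n) by (intros; now apply Cmod_pow_le).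
  split; unfold pnorm, peval.
  - intros N. apply (gsum_zero Cr); intros; cbn. rewrite (te_0 _ _ _ E); apply Cmult_0_l.
  - intros N f g. rewrite <- (gsum_add Cr). apply csum_ext; intros; cbn.
    rewrite (te_add _ _ _ E); apply Cmult_plus_distr_r.
  - intros N f. eapply Rle_trans; [apply csum_Cmod|]. apply rsum_le; intros.
    rewrite Cmod_mult. apply Rmult_le_compat; auto using Cmod_ge_0. apply (te_le _ _ _ E).
  - intros N M f L. rewrite (csum_restrict _ M N L), (rsum_restrict _ M N L).
    rewrite <- (gsum_sub Cr), <- rsum_minus.
    eapply Rle_trans; [apply csum_Cmod|]. apply rsum_le; intros i Hi. cbn [csub Cr].
    destruct (i <? M)%nat.
    + replace (e N (f i) * Cpow x i - e M (f i) * Cpow x i)%C with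
        ((e N (f i) - e M (f i)) * Cpow x i)%C by ring.
      rewrite Cmod_mult, <- Rmult_minus_distr_r.
      apply Rmult_le_compat; auto using Cmod_ge_0. now apply (te_diff _ _ _ E).
    + replace (e N (f i) * Cpow x i - RtoC 0)%C with
        (e N (f i) * Cpow x i)%C by ring.
      rewrite Cmod_mult, Rminus_0_r.
      apply Rmult_le_compat; auto using Cmod_ge_0. apply (te_le _ _ _ E).
  - intros N M f g L.
    destruct (Nat.le_gt_cases N 0) as [HN|HN].
    { replace N with 0%nat by lia. replace M with 0%nat by lia. cbn.
      replace (_ - _)%C with (RtoC 0) by ring. rewrite Cmod_0; lra. }
    assert (LM : (M <= N)%nat) by lia.
    assert (EQ : csum (fun n => (e N (cmul (psr B) f g n) * Cpow x n)%C) N =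
      csum (fun i => csum (fun j => if (i + j <? N)%nat then
        Cmult (e N (f i * g j)%cr) (Cpow x (i + j)) else RtoC 0) N) N).
    { transitivity (csum (fun i => csum (fun j => Cmult (e N (f i * g j)%cr) (Cpow x (i + j))) (N - i)) N).
      - etransitivity; [|apply (gsum_triangle Cr (fun i j => Cmult (e N (f i * g j)%cr) (Cpow x (i + j))))].
        apply csum_ext; intros n Hn.
        change ((e N (pconv B f g n) * Cpow x n)%C =
          gsum Cr (fun i => Cmult (e N (f i * g (n - i)%nat)%cr) (Cpow x (i + (n - i)))) (S n)).
        unfold pconv.
        rewrite (hom_sum B Cr (e N)) by (try apply (te_0 _ _ _ E); apply (te_add _ _ _ E)).
        change Cmult with (cmul Cr). rewrite <- (gsum_mulr Cr).
        apply csum_ext; intros i Hi. do 2 f_equal. lia.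
      - apply csum_ext; intros i Hi. rewrite (csum_restrict _ (N - i) N) by lia.
        apply csum_ext; intros j Hj.
        destruct (Nat.ltb_spec j (N - i)), (Nat.ltb_spec (i + j) N); try lia; reflexivity. }
    (* Valid whether the truncation keeps the pair or drops it; in the first case [te_mul] is used
       with M = 0. *)
    assert (Big : forall i j, Cmod (Cminus (e N (f i) * Cpow x i * (e N (g j) * Cpow x j))%C
      (if (i + j <? N)%nat then Cmult (e N (f i * g j)%cr) (Cpow x (i + j)) else RtoC 0))
      <= p N (f i) * s ^ i * (p N (g j) * s ^ j)).
    { intros i j.
      replace (p N (f i) * s ^ i * (p N (g j) * s ^ j)) with (p N (f i) * p N (g j) * s ^ (i + j))
        by (rewrite pow_add; ring).
      assert (G := te_mul _ _ _ E N 0%nat (f i) (g j) ltac:(lia)).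
      assert (G1 := Rmult_le_pos _ _ (H0 0%nat (f i)) (H0 0%nat (g j))).
      destruct (i + j <? N)%nat.
      - replace (_ - _)%C with (Cmult (e N (f i) * e N (g j) - e N (f i * g j)%cr)%C
          (Cpow x (i + j))) by (rewrite Cpow_plus; ring).
        rewrite Cmod_mult. apply Rmult_le_compat; auto using Cmod_ge_0. lra.
      - replace (_ - _)%C with (Cmult (e N (f i) * e N (g j))%C
          (Cpow x (i + j))) by (rewrite Cpow_plus; ring).
        rewrite !Cmod_mult.
        repeat apply Rmult_le_compat; auto using Rmult_le_pos, Cmod_ge_0; apply (te_le _ _ _ E). }
    match goal with |- Cmod (_ - ?X)%C <= _ => change X with
      (csum (fun n => (e N (cmul (psr B) f g n) * Cpow x n)%C) N) end.
    rewrite EQ. rewrite (gsum_mul Rr), (gsum_mul Rr).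
    change Cmult with (cmul Cr) at 1. rewrite (gsum_mul Cr).
    rewrite <- (gsum_sub Cr).
    eapply Rle_trans; [apply csum_Cmod|].
    change (gsum Rr) with rsum. rewrite (rsum_restrict _ M N LM), <- rsum_minus.
    apply rsum_le; intros i Hi.
    rewrite <- (gsum_sub Cr). eapply Rle_trans; [apply csum_Cmod|].
    destruct (Nat.ltb_spec i M) as [Li|Li].
    + rewrite (rsum_restrict _ M N LM), <- rsum_minus. apply rsum_le; intros j Hj.
      cbn [cmul csub Rr Cr].
      destruct (Nat.ltb_spec j M) as [Lj|Lj].
      * destruct (Nat.ltb_spec (i + j) N); [|lia].
        replace (_ - _)%C with (Cmult (e N (f i) * e N (g j) - e N (f i * g j)%cr)%C
          (Cpow x (i + j))) by (rewrite Cpow_plus; ring).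
        rewrite Cmod_mult.
        replace (_ - _) with ((p N (f i) * p N (g j) - p M (f i) * p M (g j)) * s ^ (i + j))
          by (rewrite pow_add; ring).
        apply Rmult_le_compat; auto using Cmod_ge_0. now apply (te_mul _ _ _ E).
      * rewrite Rminus_0_r. apply Big.
    + rewrite Rminus_0_r. apply rsum_le; intros j Hj. apply Big.
Qed.

(** * Power series in [z, zeta, zbar, zetabar] *)

(** The innermost variable is zetabar and the outermost z, so that [R4] unfolds to [coef4] with its
    arguments in the order a, b, c, d. *)
Definition R1 := psr Cr.
Definition R2 := psr R1.
Definition R3 := psr R2.
Definition R4 := psr R3.

Definition zero4 : coef4 := c0 R4.
Definition one4 : coef4 := c1 R4.
Definition add4 : coef4 -> coef4 -> coef4 := cadd R4.
Definition mul4 : coef4 -> coef4 -> coef4 := cmul R4.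
Definition sub4 : coef4 -> coef4 -> coef4 := csub R4.
Definition opp4 : coef4 -> coef4 := copp R4.

Declare Scope s4_scope.
Delimit Scope s4_scope with s4.
Bind Scope s4_scope with coef4.
Notation "x + y" := (add4 x y) : s4_scope.
Notation "x * y" := (mul4 x y) : s4_scope.
Notation "x - y" := (sub4 x y) : s4_scope.
Notation "- x" := (opp4 x) : s4_scope.
Notation "0" := zero4 : s4_scope.
Notation "1" := one4 : s4_scope.

Lemma th4 : ring_theory zero4 one4 add4 mul4 sub4 opp4 (@eq coef4).
Proof. exact (cth R4). Qed.
Add Ring Ring4 : th4.

Definition pow4 (y : coef4) (n : nat) : coef4 := cpow R4 y n.
Definition sum4 (f : nat -> coef4) (n : nat) : coef4 := gsum R4 f n.

Lemma coef4_ext (F G : coef4) : (forall a b c d, F a b c d = G a b c d) -> F = G.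
Proof. intros H. extensionality a; extensionality b; extensionality c; extensionality d. apply H. Qed.

Lemma mul4E F G a b c d : mul4 F G a b c d =
  gsum Cr (fun i => gsum Cr (fun j => gsum Cr (fun k => gsum Cr (fun l =>
    (F i j k l * G (a - i)%nat (b - j)%nat (c - k)%nat (d - l)%nat)%C) (S d)) (S c)) (S b)) (S a).
Proof.
  change (mul4 F G a b c d) with (gsum R3 (fun i => cmul R3 (F i) (G (a - i)%nat)) (S a) b c d).
  unfold R3 at 1. rewrite gsum_pointwise. unfold R2 at 1. rewrite gsum_pointwise.
  unfold R1 at 1. rewrite gsum_pointwise. apply (gsum_ext Cr); intros i _.
  change (cmul R3 (F i) (G (a - i)%nat) b c d) with
    (gsum R2 (fun j => cmul R2 (F i j) (G (a - i)%nat (b - j)%nat)) (S b) c d).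
  unfold R2 at 1. rewrite gsum_pointwise.
  unfold R1 at 1. rewrite gsum_pointwise. apply (gsum_ext Cr); intros j _.
  change (cmul R2 (F i j) (G (a - i)%nat (b - j)%nat) c d) with
    (gsum R1 (fun k => cmul R1 (F i j k) (G (a - i)%nat (b - j)%nat (c - k)%nat)) (S c) d).
  unfold R1 at 1. rewrite gsum_pointwise. reflexivity.
Qed.

Definition nrm (s : R) : nat -> coef4 -> R :=
  pnorm R3 (pnorm R2 (pnorm R1 (pnorm Cr (fun _ c => Cmod c) s) s) s) s.
Definition ev (x1 x2 x3 x4 : C) : nat -> coef4 -> C :=
  peval R3 (peval R2 (peval R1 (peval Cr (fun _ c => c) x4) x3) x2) x1.

Lemma base_tnorm : tnorm Cr (fun _ c => Cmod c).
Proof.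
  split; intros; cbn.
  - apply Cmod_ge_0.
  - apply Cmod_0.
  - rewrite Cmod_1; lra.
  - apply Cmod_triangle.
  - rewrite Cmod_mult; lra.
  - lra.
Qed.

Lemma base_teval : teval Cr (fun _ c => Cmod c) (fun _ c => c).
Proof.
  split; intros; cbn; try reflexivity.
  - replace (x - x)%C with (RtoC 0) by ring. rewrite Cmod_0; lra.
  - replace (_ - _)%C with (RtoC 0) by ring. rewrite Cmod_0; lra.
Qed.

Lemma nrm_tnorm s : 0 <= s -> tnorm R4 (nrm s).
Proof. intros H. repeat (apply pnorm_tnorm; [exact H|]). apply base_tnorm. Qed.

Lemma ev_teval x1 x2 x3 x4 s :
  Cmod x1 <= s -> Cmod x2 <= s -> Cmod x3 <= s -> Cmod x4 <= s ->
  teval R4 (nrm s) (ev x1 x2 x3 x4).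
Proof.
  intros H1 H2 H3 H4.
  assert (Hs : 0 <= s) by (eapply Rle_trans; [apply Cmod_ge_0|exact H1]).
  assert (T := base_tnorm).
  repeat (apply peval_teval; [assumption|repeat (apply pnorm_tnorm; [exact Hs|]); exact T|]).
  apply base_teval.
Qed.

Lemma nrmE s N F : nrm s N F = rsum (fun a => rsum (fun b => rsum (fun c => rsum (fun d =>
      Cmod (F a b c d) * s ^ (a + b + c + d)) N) N) N) N.
Proof.
  unfold nrm, pnorm. apply rsum_ext; intros a _. rewrite <- rsum_scalr.
  apply rsum_ext; intros b _. rewrite <- !rsum_scalr.
  apply rsum_ext; intros c _. rewrite <- !rsum_scalr.
  apply rsum_ext; intros d _. rewrite !pow_add. ring.
Qed.

Lemma evE x1 x2 x3 x4 N F : ev x1 x2 x3 x4 N F = psum4 F x1 x2 x3 x4 N.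
Proof.
  unfold ev, peval, psum4. apply csum_ext; intros a _.
  etransitivity; [symmetry; apply (gsum_mulr Cr)|].
  apply csum_ext; intros b _.
  change (cmul Cr) with Cmult. rewrite <- Cmult_assoc.
  etransitivity; [symmetry; apply (gsum_mulr Cr)|].
  apply csum_ext; intros c _.
  change (cmul Cr) with Cmult. rewrite <- Cmult_assoc.
  etransitivity; [symmetry; apply (gsum_mulr Cr)|].
  apply csum_ext; intros d _. change (cmul Cr) with Cmult. ring.
Qed.

(** Absolute convergence at radius [s] is expressed by a bound uniform in the truncation level,
    without any infinite sum. *)
Definition bnd (s B : R) (F : coef4) : Prop := forall N, nrm s N F <= B.

Lemma convergent4E F : convergent4 F <-> exists s B, 0 < s /\ bnd s B F.
Proof.
  split; intros (s & B & H & HB); exists s, B; (split; [exact H|]); intros N;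
    specialize (HB N); rewrite nrmE in *; exact HB.
Qed.

Definition eqm (K : nat) (F G : coef4) : Prop :=
  forall a b c d, (a + b + c + d < K)%nat -> F a b c d = G a b c d.
Definition ord (K : nat) (F : coef4) : Prop :=
  forall a b c d, (a + b + c + d < K)%nat -> F a b c d = RtoC 0.

Lemma eqm_refl K F : eqm K F F.
Proof. now intros a b c d H. Qed.
Lemma eqm_sym K F G : eqm K F G -> eqm K G F.
Proof. intros H a b c d L; symmetry; now apply H. Qed.
Lemma eqm_trans K F G H : eqm K F G -> eqm K G H -> eqm K F H.
Proof. intros H1 H2 a b c d L; rewrite H1 by exact L; now apply H2. Qed.
Lemma eqm_le K L F G : (L <= K)%nat -> eqm K F G -> eqm L F G.
Proof. intros H1 H2 a b c d H; apply H2; lia. Qed.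
Lemma ord_le K L F : (L <= K)%nat -> ord K F -> ord L F.
Proof. intros H1 H2 a b c d H; apply H2; lia. Qed.
Lemma eqm_eq F G : (forall K, eqm K F G) -> F = G.
Proof. intros H; apply coef4_ext; intros a b c d. apply (H (S (a + b + c + d))); lia. Qed.

Local Open Scope s4_scope.

Lemma add4E F G a b c d : (F + G) a b c d = (F a b c d + G a b c d)%C.
Proof. reflexivity. Qed.
Lemma sub4E F G a b c d : (F - G) a b c d = (F a b c d - G a b c d)%C.
Proof. reflexivity. Qed.
Lemma eqm_ord K F G : eqm K F G <-> ord K (F - G).
Proof.
  split; intros H a b c d L; specialize (H a b c d L); rewrite ?sub4E in *.
  - rewrite H; ring.
  - replace (F a b c d) with (F a b c d - G a b c d + G a b c d)%C by ring.
    rewrite H; ring.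
Qed.

Lemma ord_add K F G : ord K F -> ord K G -> ord K (F + G).
Proof. intros H1 H2 a b c d L. rewrite add4E, H1, H2 by exact L. ring. Qed.
Lemma ord_sub K F G : ord K F -> ord K G -> ord K (F - G).
Proof. intros H1 H2 a b c d L. rewrite sub4E, H1, H2 by exact L. ring. Qed.
Lemma ord_zero K : ord K 0.
Proof. now intros a b c d L. Qed.
Lemma ord_any F : ord 0 F.
Proof. intros a b c d L; lia. Qed.

Lemma ord_mul m n F G : ord m F -> ord n G -> ord (m + n) (F * G).
Proof.
  intros H1 H2 a b c d L. rewrite mul4E.
  apply (gsum_zero Cr); intros i Hi. apply (gsum_zero Cr); intros j Hj.
  apply (gsum_zero Cr); intros k Hk. apply (gsum_zero Cr); intros l Hl.
  destruct (Nat.lt_ge_cases (i + j + k + l) m) as [Q|Q].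
  - rewrite H1 by exact Q. apply Cmult_0_l.
  - rewrite H2 by lia. apply Cmult_0_r.
Qed.

Lemma ord_pow y n : ord 1 y -> ord n (pow4 y n).
Proof.
  intros H; induction n as [|n IH]; [apply ord_any|].
  change (S n) with (1 + n)%nat at 1. now apply ord_mul.
Qed.

Lemma ord_sum K f n : (forall i, (i < n)%nat -> ord K (f i)) -> ord K (sum4 f n).
Proof.
  intros H; induction n as [|n IH]; [apply ord_zero|].
  apply (ord_add K (sum4 f n)); [apply IH; intros; apply H|apply H]; lia.
Qed.

Lemma eqm_add K F F' G G' : eqm K F F' -> eqm K G G' -> eqm K (F + G) (F' + G').
Proof. intros H1 H2 a b c d L. now rewrite !add4E, H1, H2. Qed.
Lemma eqm_mul K F F' G G' : eqm K F F' -> eqm K G G' -> eqm K (F * G) (F' * G').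
Proof.
  rewrite !eqm_ord; intros H1 H2.
  replace (F * G - F' * G') with (F * (G - G') + (F - F') * G') by ring.
  apply ord_add.
  - apply (ord_mul 0 K); [apply ord_any|assumption].
  - rewrite <- (Nat.add_0_r K). apply (ord_mul K 0); [assumption|apply ord_any].
Qed.

(** At level [N] all four exponents are below [N], hence the total degree is below 4 N. *)
Lemma nrm_eqm s N F G : eqm (4 * N) F G -> nrm s N F = nrm s N G.
Proof.
  intros H; rewrite !nrmE. do 4 (apply rsum_ext; intros ? ?).
  rewrite H by lia; reflexivity.
Qed.

Definition cst (c : C) : coef4 := pinj R3 (pinj R2 (pinj R1 (pinj Cr c))).
Definition X1 : coef4 := pX R3.
Definition X2 : coef4 := pinj R3 (pX R2).
Definition X3 : coef4 := pinj R3 (pinj R2 (pX R1)).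
Definition X4 : coef4 := pinj R3 (pinj R2 (pinj R1 (pX Cr))).

Lemma cst_rhom : rhom Cr R4 cst.
Proof.
  unfold cst. apply (rhom_comp Cr R3 R4); [|apply pinj_rhom].
  apply (rhom_comp Cr R2 R3); [|apply pinj_rhom].
  apply (rhom_comp Cr R1 R2); apply pinj_rhom.
Qed.

Lemma cst_add x y : cst (x + y)%C = cst x + cst y.
Proof. apply (homadd _ _ _ cst_rhom). Qed.
Lemma cst_mul x y : cst (x * y)%C = cst x * cst y.
Proof. apply (hommul _ _ _ cst_rhom). Qed.
Lemma cst_0 : cst (RtoC 0) = 0.
Proof. apply (hom0 _ _ _ cst_rhom). Qed.
Lemma cst_1 : cst (RtoC 1) = 1.
Proof. apply (hom1 _ _ _ cst_rhom). Qed.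
Lemma cst_opp x : cst (- x)%C = - cst x.
Proof.
  assert (H : cst x + cst (- x)%C = 0).
  { rewrite <- cst_add, <- cst_0. f_equal. ring. }
  replace (cst (- x)%C) with (cst x + cst (- x)%C - cst x) by ring. rewrite H. ring.
Qed.

Lemma cst_mulE k F a b c d : (cst k * F) a b c d = (k * F a b c d)%C.
Proof.
  change (cmul (psr R3) (pinj R3 (pinj R2 (pinj R1 (pinj Cr k)))) F a b c d = (k * F a b c d)%C).
  rewrite pinj_mul. unfold R3 at 1. rewrite pinj_mul. unfold R2 at 1. rewrite pinj_mul.
  unfold R1 at 1. rewrite pinj_mul. reflexivity.
Qed.

Lemma eqm_sub_ord K F G : eqm K F G -> ord K (F - G).
Proof. apply eqm_ord. Qed.
Lemma ord_sub_eqm K F G : ord K (F - G) -> eqm K F G.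
Proof. apply eqm_ord. Qed.

(** * Derivations and substitution *)

Local Open Scope s4_scope.

Ltac ring4 := match goal with |- @eq _ ?a ?b => change (@eq coef4 a b); ring end.

Lemma nsc_C n c : nsc Cr n c = (RtoC (INR n) * c)%C :> C.
Proof.
  induction n as [|n IH].
  - cbn. symmetry; apply Cmult_0_l.
  - change (nsc Cr (S n) c) with (nsc Cr n c + c)%C. rewrite IH, S_INR, RtoC_plus. ring.
Qed.

Lemma d_zE F : d_z F = pder R3 F.
Proof.
  apply coef4_ext; intros a b c d. unfold d_z, pder.
  unfold R3. rewrite nsc_pointwise. unfold R2. rewrite nsc_pointwise.
  unfold R1. rewrite nsc_pointwise. symmetry; apply nsc_C.
Qed.
Lemma d_zetaE F : d_zeta F = fun a => pder R2 (F a).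
Proof.
  apply coef4_ext; intros a b c d. unfold d_zeta, pder.
  unfold R2. rewrite nsc_pointwise. unfold R1. rewrite nsc_pointwise. symmetry; apply nsc_C.
Qed.
Lemma d_zbE F : d_zb F = fun a b => pder R1 (F a b).
Proof.
  apply coef4_ext; intros a b c d. unfold d_zb, pder.
  unfold R1. rewrite nsc_pointwise. symmetry; apply nsc_C.
Qed.
Lemma d_zetabE F : d_zetab F = fun a b c => pder Cr (F a b c).
Proof.
  apply coef4_ext; intros a b c d. unfold d_zetab, pder. symmetry; apply nsc_C.
Qed.

(** [der_eqm] is continuity for the degree filtration, at the cost of one order; it is what carries
    the Leibniz rule over to infinite sums such as [fsum]. *)
Record der4 (D : coef4 -> coef4) : Prop := {
  der_add : forall F G, D (F + G) = D F + D G;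
  der_mul : forall F G, D (F * G) = D F * G + F * D G;
  der_cst : forall c, D (cst c) = 0;
  der_eqm : forall K F G, eqm (S K) F G -> eqm K (D F) (D G) }.

Lemma d_z_der : der4 d_z.
Proof.
  split; intros.
  - rewrite !d_zE. exact (proj1 (pder_derivation R3) F G).
  - rewrite !d_zE. exact (proj2 (pder_derivation R3) F G).
  - apply coef4_ext; intros i j k l; apply Cmult_0_r.
  - intros a b c d L; unfold d_z. rewrite H by lia; reflexivity.
Qed.
Lemma d_zeta_der : der4 d_zeta.
Proof.
  split; intros.
  - rewrite !d_zetaE. exact (proj1 (map_derivation R3 _ (pder_derivation R2)) F G).
  - rewrite !d_zetaE. exact (proj2 (map_derivation R3 _ (pder_derivation R2)) F G).
  - apply coef4_ext; intros [|i] j k l; apply Cmult_0_r.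
  - intros a b c d L; unfold d_zeta. rewrite H by lia; reflexivity.
Qed.
Lemma d_zb_der : der4 d_zb.
Proof.
  split; intros.
  - rewrite !d_zbE. exact (proj1 (map_derivation R3 _ (map_derivation R2 _ (pder_derivation R1))) F G).
  - rewrite !d_zbE. exact (proj2 (map_derivation R3 _ (map_derivation R2 _ (pder_derivation R1))) F G).
  - apply coef4_ext; intros [|i] [|j] k l; apply Cmult_0_r.
  - intros a b c d L; unfold d_zb. rewrite H by lia; reflexivity.
Qed.
Lemma d_zetab_der : der4 d_zetab.
Proof.
  split; intros.
  - rewrite !d_zetabE. exact (proj1 (map_derivation R3 _ (map_derivation R2 _ (map_derivation R1 _
    (pder_derivation Cr)))) F G).
  - rewrite !d_zetabE. exact (proj2 (map_derivation R3 _ (map_derivation R2 _ (map_derivation R1 _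
    (pder_derivation Cr)))) F G).
  - apply coef4_ext; intros [|i] [|j] [|k] l; apply Cmult_0_r.
  - intros a b c d L; unfold d_zetab. rewrite H by lia; reflexivity.
Qed.

Lemma der4_derivation D : der4 D -> derivation R4 D.
Proof. intros H; split; apply H. Qed.

(* [sum_n u_n y^n]; a finite sum in each degree only when [y] has no constant term. *)
Definition fsum (u : nat -> coef4) (y : coef4) : coef4 :=
  fun a b c d => sum4 (fun n => u n * pow4 y n) (S (a + b + c + d)) a b c d.

Lemma eqm_sum_trunc K N N' f : (forall i, ord i (f i)) -> (K <= N)%nat -> (N <= N')%nat ->
  eqm K (sum4 f N') (sum4 f N).
Proof.
  intros H L1 L2; induction L2 as [|N' L2 IH]; [apply eqm_refl|].
  apply eqm_trans with (sum4 f N'); [|exact IH].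
  intros a b c d L. change (sum4 f (S N')) with (sum4 f N' + f N'). rewrite add4E.
  rewrite (H N') by lia. ring.
Qed.

Lemma term_ord u y n : ord 1 y -> ord n (u n * pow4 y n).
Proof. intros H. apply (ord_mul 0 n); [apply ord_any|now apply ord_pow]. Qed.

Lemma fsum_eqm u y K N : ord 1 y -> (K <= N)%nat ->
  eqm K (fsum u y) (sum4 (fun n => u n * pow4 y n) N).
Proof.
  intros H L0 a b c d L. unfold fsum. symmetry.
  apply (eqm_sum_trunc (S (a + b + c + d))); try lia. intros; now apply term_ord.
Qed.

Lemma sum4_ext f g n : (forall i, (i < n)%nat -> f i = g i) -> sum4 f n = sum4 g n.
Proof. apply (gsum_ext R4). Qed.

Lemma fsum_ext u v y : (forall n, u n = v n) -> fsum u y = fsum v y.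
Proof. intros H. f_equal. now extensionality n. Qed.

Lemma fsum_add u v y : ord 1 y -> fsum (fun n => u n + v n) y = fsum u y + fsum v y.
Proof.
  intros H; apply eqm_eq; intros K. eapply eqm_trans; [now apply (fsum_eqm _ _ K K)|].
  eapply eqm_trans; [|apply eqm_sym; apply eqm_add; now apply (fsum_eqm _ _ K K)].
  unfold sum4. replace (gsum R4 _ K + gsum R4 _ K) with
    (gsum R4 (fun n => u n * pow4 y n + v n * pow4 y n) K) by apply (gsum_add R4).
  rewrite (gsum_ext R4 _ (fun n => u n * pow4 y n + v n * pow4 y n)); [apply eqm_refl|].
  intros; ring4.
Qed.

Lemma fsum_scal w u y : ord 1 y -> fsum (fun n => u n * w) y = fsum u y * w.
Proof.
  intros H; apply eqm_eq; intros K. eapply eqm_trans; [now apply (fsum_eqm _ _ K K)|].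
  eapply eqm_trans; [|apply eqm_sym; apply eqm_mul; [now apply (fsum_eqm _ _ K K)|apply eqm_refl]].
  unfold sum4. replace (gsum R4 (fun n => u n * pow4 y n) K * w) with
    (gsum R4 (fun n => u n * pow4 y n * w) K) by apply (gsum_mulr R4).
  rewrite (gsum_ext R4 _ (fun n => u n * pow4 y n * w)); [apply eqm_refl|].
  intros; ring4.
Qed.

Lemma fsum_fin u y K : ord 1 y -> (forall n, (K <= n)%nat -> u n = 0) ->
  fsum u y = sum4 (fun n => u n * pow4 y n) K.
Proof.
  intros H H0; apply eqm_eq; intros L.
  eapply eqm_trans; [apply (fsum_eqm _ _ L (K + L)); [exact H|lia]|].
  replace (sum4 (fun n => u n * pow4 y n) (K + L)) with (sum4 (fun n => u n * pow4 y n) K);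
    [apply eqm_refl|].
  symmetry. apply (gsum_trunc R4); [lia|]. intros i Hi; cbn. rewrite H0 by exact Hi.
  change (0 * pow4 y i = 0). ring.
Qed.

Lemma fsum_mul (u v : nat -> coef4) y : ord 1 y ->
  fsum (fun n => sum4 (fun i => u i * v (n - i)%nat) (S n)) y = fsum u y * fsum v y.
Proof.
  intros H; apply eqm_eq; intros K. eapply eqm_trans; [now apply (fsum_eqm _ _ K K)|].
  eapply eqm_trans; [|apply eqm_sym; apply eqm_mul; now apply (fsum_eqm _ _ K K)].
  replace (sum4 (fun n => u n * pow4 y n) K * sum4 (fun n => v n * pow4 y n) K) with
    (sum4 (fun i => sum4 (fun j => (u i * pow4 y i) * (v j * pow4 y j)) K) K)
    by (symmetry; apply (gsum_mul R4)).
  replace (sum4 (fun n => sum4 (fun i => u i * v (n - i)%nat) (S n) * pow4 y n) K) with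
    (sum4 (fun i => sum4 (fun j => (u i * pow4 y i) * (v j * pow4 y j)) (K - i)) K).
  (* The product of truncations contains a square of terms, the truncated Cauchy product only a
     triangle. Row [i] of the difference has order i + (K - i). *)
  - apply ord_sub_eqm. unfold sum4.
    replace (gsum R4 _ K - gsum R4 _ K) with
     (sum4 (fun i => sum4 (fun j => (u i * pow4 y i) * (v j * pow4 y j)) (K - i) -
        sum4 (fun j => (u i * pow4 y i) * (v j * pow4 y j)) K) K) by apply (gsum_sub R4).
    apply ord_sum; intros i Hi.
    replace (sum4 (fun j => u i * pow4 y i * (v j * pow4 y j)) (K - i)) with
      (u i * pow4 y i * sum4 (fun j => v j * pow4 y j) (K - i)) by (symmetry; apply (gsum_mull R4)).
    replace (sum4 (fun j => u i * pow4 y i * (v j * pow4 y j)) K) with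
      (u i * pow4 y i * sum4 (fun j => v j * pow4 y j) K) by (symmetry; apply (gsum_mull R4)).

    replace (_ - _) with (u i * pow4 y i * (sum4 (fun j => v j * pow4 y j) (K - i)
      - sum4 (fun j => v j * pow4 y j) K)) by ring.
    replace K with (i + (K - i))%nat at 1 by lia. apply ord_mul; [now apply term_ord|].
    apply eqm_sub_ord, eqm_sym, (eqm_sum_trunc (K - i)); try lia. intros; now apply term_ord.
  - unfold sum4 at 1 2. symmetry.
    etransitivity; [|apply (gsum_triangle R4 (fun i j => (u i * pow4 y i) * (v j * pow4 y j)))].
    apply (gsum_ext R4); intros n Hn.
    etransitivity; [symmetry; apply (gsum_mulr R4)|].
    apply (gsum_ext R4); intros i Hi. change (cmul R4) with mul4.
    replace (pow4 y n) with (pow4 y i * pow4 y (n - i)).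
    + ring4.
    + unfold pow4, mul4. rewrite <- cpow_add. f_equal; lia.
Qed.

Lemma fsum_der D u y : der4 D -> ord 1 y ->
  D (fsum u y) = fsum (fun n => D (u n)) y + fsum (fun n => nsc R4 (S n) (u (S n))) y * D y.
Proof.
  intros HD H; apply eqm_eq; intros K.
  (* One term more than [K] is kept, because [D] lowers the degree of agreement by one. *)
  eapply eqm_trans; [apply (der_eqm _ HD); apply (fsum_eqm _ _ (S K) (S K)); auto|].
  eapply eqm_trans; [|apply eqm_sym; apply eqm_add;
    [apply (fsum_eqm _ _ K (S K)); auto|
     apply eqm_mul; [apply (fsum_eqm _ _ K K); auto|apply eqm_refl]]].
  assert (Hd := der4_derivation _ HD).
  replace (D (sum4 (fun n => u n * pow4 y n) (S K))) with
    (sum4 (fun n => D (u n) * pow4 y n + u n * D (pow4 y n)) (S K)).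
  - unfold sum4 at 1.
    replace (gsum R4 (fun n => D (u n) * pow4 y n + u n * D (pow4 y n)) (S K)) with
     (sum4 (fun n => D (u n) * pow4 y n) (S K) + sum4 (fun n => u n * D (pow4 y n)) (S K))
     by (symmetry; apply (gsum_add R4)).
    apply eqm_add; [apply eqm_refl|].
    unfold sum4. rewrite gsum_head.
    replace (u O * D (pow4 y 0)) with 0.
    2: { unfold pow4; cbn [cpow]. replace (D (c1 R4)) with 0; [ring|].
         symmetry; apply (derivation_1 R4 _ Hd). }
    replace (cadd R4 0 _) with (gsum R4 (fun i => u (S i) * D (pow4 y (S i))) K) by
      (symmetry; apply (Radd_0_l th4)).
    replace (gsum R4 (fun n => nsc R4 (S n) (u (S n)) * pow4 y n) K * D y) with
     (gsum R4 (fun n => nsc R4 (S n) (u (S n)) * pow4 y n * D y) K) by apply (gsum_mulr R4).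
    rewrite (gsum_ext R4 _ (fun n => nsc R4 (S n) (u (S n)) * pow4 y n * D y));
      [apply eqm_refl|].
    intros n Hn. unfold pow4 at 1. rewrite (derivation_pow R4 D y n Hd).
    change (u (S n) * nsc R4 (S n) (pow4 y n * D y) = nsc R4 (S n) (u (S n)) * pow4 y n * D y).
    unfold mul4. rewrite <- nsc_mulr, <- !nsc_mull.
    f_equal. apply (Rmul_assoc th4).
  - symmetry. etransitivity; [apply (derivation_sum R4 D _ _ Hd)|].
    apply sum4_ext; intros; apply (der_mul _ HD).
Qed.

(** A Lipschitz estimate for the degree filtration: if [y] and [y'] agree below degree k + 1, then
    y^n - y'^n has order k + n. The coefficient of index n needs only order m - n, as the power
    supplies the missing n. *)
Lemma fsum_contr m k u u' y y' : ord 1 y -> ord 1 y' -> ord (S k) (y - y') ->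
  (forall n, ord (m - n) (u' n)) -> (forall n, ord (k + (m - n)) (u n - u' n)) ->
  ord (k + m) (fsum u y - fsum u' y').
Proof.
  intros H1 H1' Hy Hu Hd.
  assert (Hp : forall n, ord (k + n) (pow4 y n - pow4 y' n)).
  { induction n as [|n IH].
    - change (pow4 y 0 - pow4 y' 0) with (1 - 1). replace (1 - 1) with 0 by ring.
      apply ord_zero.
    - change (pow4 y (S n)) with (y * pow4 y n). change (pow4 y' (S n)) with (y' * pow4 y' n).
      replace (_ - _) with (y * (pow4 y n - pow4 y' n) + (y - y') * pow4 y' n) by ring.
      apply ord_add.
      + replace (k + S n)%nat with (1 + (k + n))%nat by lia. now apply ord_mul.
      + replace (k + S n)%nat with (S k + n)%nat by lia. apply ord_mul; [exact Hy|now apply ord_pow]. }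
  apply eqm_sub_ord.
  eapply eqm_trans; [now apply (fsum_eqm _ _ (k + m) (k + m))|].
  eapply eqm_trans; [|apply eqm_sym; now apply (fsum_eqm _ _ (k + m) (k + m))].
  apply eqm_ord.
  unfold sum4. replace (gsum R4 _ _ - gsum R4 _ _) with
    (sum4 (fun n => u n * pow4 y n - u' n * pow4 y' n) (k + m)) by apply (gsum_sub R4).
  apply ord_sum; intros n Hn.
  replace (_ - _) with ((u n - u' n) * pow4 y n + u' n * (pow4 y n - pow4 y' n)) by ring.
  apply ord_add.
  - apply ord_le with (k + (m - n) + n)%nat; [lia|]. apply ord_mul; [apply Hd|now apply ord_pow].
  - apply ord_le with ((m - n) + (k + n))%nat; [lia|]. apply ord_mul; [apply Hu|apply Hp].
Qed.

Lemma fsum_ord m u y : ord 1 y -> (forall n, ord (m - n) (u n)) -> ord m (fsum u y).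
Proof.
  intros H Hu. intros a b c d L. rewrite (fsum_eqm u y m m H (le_n m)) by exact L.
  assert (G : ord m (sum4 (fun n => u n * pow4 y n) m)); [|now apply G].
  apply ord_sum; intros n Hn. replace m with ((m - n) + n)%nat by lia.
  apply ord_mul; [apply Hu|now apply ord_pow].
Qed.

Lemma fsum_nrm s r N u y : (0 <= s)%R -> ord 1 y -> nrm s N y <= r ->
  nrm s N (fsum u y) <= rsum (fun n => nrm s N (u n) * r ^ n)%R (4 * N).
Proof.
  intros Hs H Hy. assert (T := nrm_tnorm s Hs).
  rewrite (nrm_eqm s N _ (sum4 (fun n => u n * pow4 y n) (4 * N))) by now apply fsum_eqm.
  eapply Rle_trans; [apply (tn_sum R4 _ T)|]. apply rsum_le; intros n Hn.
  eapply Rle_trans; [apply (tn_mul _ _ T)|].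
  apply Rmult_le_compat_l; [apply (tn_ge0 _ _ T)|]. now apply (tn_pow R4 _ T).
Qed.

(** Extends a homomorphism to one more variable, which is sent to [y]. Four nested copies give
    substitution into a four-variable series, and each property of substitution is proved one layer
    at a time. *)
Definition lift (B : cring) (phi : B -> coef4) (y : coef4) (f : psr B) : coef4 :=
  fsum (fun n => phi (f n)) y.

Lemma lift_rhom B phi y : ord 1 y -> rhom B R4 phi -> rhom (psr B) R4 (lift B phi y).
Proof.
  intros H [H0 H1 Ha Hm]; split; unfold lift.
  - rewrite (fsum_fin _ _ 0 H); [reflexivity|]. intros n _; apply H0.
  - rewrite (fsum_fin _ _ 1 H).
    + change (0 + phi (c1 B) * 1 = 1). rewrite H1. change (c1 R4) with 1. ring.
    + intros [|n] L; [lia|]. apply H0.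
  - intros f g. etransitivity; [|apply (fsum_add _ _ _ H)]. apply fsum_ext; intros; apply Ha.
  - intros f g. etransitivity; [|apply (fsum_mul _ _ _ H)]. apply fsum_ext; intros n.
    change (phi (pconv B f g n) = sum4 (fun i => phi (f i) * phi (g (n - i)%nat)) (S n)).
    unfold pconv. rewrite (hom_sum B R4 phi _ _ H0 Ha). apply sum4_ext; intros; apply Hm.
Qed.

Lemma lift_pinj B phi y b : ord 1 y -> rhom B R4 phi -> lift B phi y (pinj B b) = phi b.
Proof.
  intros H R. unfold lift. rewrite (fsum_fin _ _ 1 H).
  - change (0 + phi b * 1 = phi b). ring.
  - intros [|n] L; [lia|]. apply (hom0 _ _ _ R).
Qed.

Lemma lift_pX B phi y : ord 1 y -> rhom B R4 phi -> lift B phi y (pX B) = y.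
Proof.
  intros H R. unfold lift. rewrite (fsum_fin _ _ 2 H).
  - change (0 + phi (c0 B) * 1 + phi (c1 B) * (y * 1) = y).
    rewrite (hom0 _ _ _ R), (hom1 _ _ _ R). change (c0 R4) with 0; change (c1 R4) with 1. ring.
  - intros [|[|n]] L; try lia. apply (hom0 _ _ _ R).
Qed.

Lemma lift_der B phi y D f : ord 1 y -> rhom B R4 phi -> der4 D ->
  D (lift B phi y f) = fsum (fun n => D (phi (f n))) y + lift B phi y (pder B f) * D y.
Proof.
  intros H R HD. unfold lift. rewrite fsum_der by assumption. do 2 f_equal.
  apply fsum_ext; intros n. unfold pder, nsc.
  symmetry. apply (hom_sum B R4 phi); apply R.
Qed.

Definition comp1 (y4 : coef4) : R1 -> coef4 := lift Cr cst y4.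
Definition comp2 (y3 y4 : coef4) : R2 -> coef4 := lift R1 (comp1 y4) y3.
Definition comp3 (y2 y3 y4 : coef4) : R3 -> coef4 := lift R2 (comp2 y3 y4) y2.
Definition comp (F y1 y2 y3 y4 : coef4) : coef4 := lift R3 (comp3 y2 y3 y4) y1 F.

Section Comp.
Variables y1 y2 y3 y4 : coef4.
Hypotheses (H1 : ord 1 y1) (H2 : ord 1 y2) (H3 : ord 1 y3) (H4 : ord 1 y4).

Lemma comp1_rhom : rhom R1 R4 (comp1 y4).
Proof. apply lift_rhom; [assumption|apply cst_rhom]. Qed.
Lemma comp2_rhom : rhom R2 R4 (comp2 y3 y4).
Proof. apply lift_rhom; [assumption|apply comp1_rhom]. Qed.
Lemma comp3_rhom : rhom R3 R4 (comp3 y2 y3 y4).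
Proof. apply lift_rhom; [assumption|apply comp2_rhom]. Qed.
Lemma comp_rhom : rhom R4 R4 (fun F => comp F y1 y2 y3 y4).
Proof. apply (lift_rhom R3); [assumption|apply comp3_rhom]. Qed.

Lemma comp_add F G : comp (F + G) y1 y2 y3 y4 = comp F y1 y2 y3 y4 + comp G y1 y2 y3 y4.
Proof. apply (homadd _ _ _ comp_rhom). Qed.
Lemma comp_mul F G : comp (F * G) y1 y2 y3 y4 = comp F y1 y2 y3 y4 * comp G y1 y2 y3 y4.
Proof. apply (hommul _ _ _ comp_rhom). Qed.
Lemma comp_zero : comp 0 y1 y2 y3 y4 = 0.
Proof. apply (hom0 _ _ _ comp_rhom). Qed.
Lemma comp_cst c : comp (cst c) y1 y2 y3 y4 = cst c.
Proof.
  unfold comp, cst. rewrite (lift_pinj R3) by (try assumption; apply comp3_rhom).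
  unfold comp3. rewrite (lift_pinj R2) by (try assumption; apply comp2_rhom).
  unfold comp2. rewrite (lift_pinj R1) by (try assumption; apply comp1_rhom).
  unfold comp1. rewrite (lift_pinj Cr) by (try assumption; apply cst_rhom). reflexivity.
Qed.
Lemma comp_sub F G : comp (F - G) y1 y2 y3 y4 = comp F y1 y2 y3 y4 - comp G y1 y2 y3 y4.
Proof.
  replace F with ((F - G) + G) at 2 by ring. rewrite comp_add. ring.
Qed.
Lemma comp_X1 : comp X1 y1 y2 y3 y4 = y1.
Proof. apply (lift_pX R3); [assumption|apply comp3_rhom]. Qed.
Lemma comp_X2 : comp X2 y1 y2 y3 y4 = y2.
Proof.
  unfold comp, X2. rewrite (lift_pinj R3) by (try assumption; apply comp3_rhom).
  apply (lift_pX R2); [assumption|apply comp2_rhom].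
Qed.
(** Each layer of [lift] contributes one partial derivative; the innermost layer starts from the
    vanishing of [D] on constants. *)
Lemma comp_chain D F : der4 D ->
  D (comp F y1 y2 y3 y4) =
    comp (d_z F) y1 y2 y3 y4 * D y1 + comp (d_zeta F) y1 y2 y3 y4 * D y2
    + comp (d_zb F) y1 y2 y3 y4 * D y3 + comp (d_zetab F) y1 y2 y3 y4 * D y4.
Proof.
  intros HD. rewrite d_zE, d_zetaE, d_zbE, d_zetabE.
  assert (L1 : forall f, D (comp1 y4 f) = comp1 y4 (pder Cr f) * D y4).
  { intros f. unfold comp1. rewrite lift_der by (try assumption; apply cst_rhom).
    rewrite (fsum_fin _ _ 0 H4) by (intros; apply (der_cst _ HD)). change (sum4 _ 0) with 0. ring. }
  assert (L2 : forall f, D (comp2 y3 y4 f) = comp2 y3 y4 (pder R1 f) * D y3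
     + comp2 y3 y4 (fun c => pder Cr (f c)) * D y4).
  { intros f. unfold comp2 at 1. rewrite lift_der by (try assumption; apply comp1_rhom).
    rewrite (fsum_ext _ (fun n => comp1 y4 (pder Cr (f n)) * D y4)) by (intros; apply L1).
    rewrite fsum_scal by assumption. unfold comp2, lift. ring. }
  assert (L3 : forall f, D (comp3 y2 y3 y4 f) = comp3 y2 y3 y4 (pder R2 f) * D y2
     + comp3 y2 y3 y4 (fun b => pder R1 (f b)) * D y3
     + comp3 y2 y3 y4 (fun b c => pder Cr (f b c)) * D y4).
  { intros f. unfold comp3 at 1. rewrite lift_der by (try assumption; apply comp2_rhom).
    rewrite (fsum_ext _ (fun n => comp2 y3 y4 (pder R1 (f n)) * D y3 +
      comp2 y3 y4 (fun c => pder Cr (f n c)) * D y4)) by (intros; apply L2).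
    rewrite fsum_add, !fsum_scal by assumption. unfold comp3, lift. ring. }
  unfold comp at 1. rewrite lift_der by (try assumption; apply comp3_rhom).
  rewrite (fsum_ext _ (fun n => comp3 y2 y3 y4 (pder R2 (F n)) * D y2 +
      comp3 y2 y3 y4 (fun b => pder R1 (F n b)) * D y3 +
      comp3 y2 y3 y4 (fun b c => pder Cr (F n b c)) * D y4)) by (intros; apply L3).
  rewrite !fsum_add, !fsum_scal by assumption. unfold comp, lift. ring.
Qed.

Lemma lift_nrm B phi p y s r N :
  (0 <= s)%R -> ord 1 y -> nrm s N y <= r ->
  (forall b, nrm s N (phi b) <= p (4 * N)%nat b) ->
  forall f, nrm s N (lift B phi y f) <= pnorm B p r (4 * N) f.
Proof.
  intros Hs Hy Hn Hp f. unfold lift. eapply Rle_trans; [now apply (fsum_nrm s r)|].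
  assert (Hr : (0 <= r)%R).
  { eapply Rle_trans; [|exact Hn]. apply (tn_ge0 R4 _ (nrm_tnorm s Hs)). }
  apply rsum_le; intros n _. apply Rmult_le_compat_r; [now apply pow_le|apply Hp].
Qed.

Lemma pinj_nrm (B : cring) p (b : B) s N : (0 <= s)%R -> tnorm B p -> pnorm B p s N (pinj B b) <= p N b.
Proof.
  intros Hs T. unfold pnorm. destruct N as [|N].
  - cbn. apply (tn_ge0 _ _ T).
  - rewrite rsum_gsum, gsum_head, (gsum_zero Rr).
    + cbn. lra.
    + intros i Hi; cbn. rewrite (tn_0 _ _ T). apply Rmult_0_l.
Qed.

Lemma cst_nrm s N c : (0 <= s)%R -> nrm s N (cst c) <= Cmod c.
Proof.
  intros Hs. assert (T0 := base_tnorm). assert (T1 := pnorm_tnorm _ _ s Hs T0).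
  assert (T2 := pnorm_tnorm _ _ s Hs T1). assert (T3 := pnorm_tnorm _ _ s Hs T2).
  unfold nrm, cst. do 3 (eapply Rle_trans; [apply pinj_nrm; assumption|]). now apply (pinj_nrm Cr).
Qed.

Lemma pX_nrm (B : cring) p s N : (0 <= s)%R -> tnorm B p -> pnorm B p s N (pX B) <= s.
Proof.
  intros Hs T. unfold pnorm. destruct N as [|[|N]].
  - cbn; lra.
  - cbn. rewrite (tn_0 _ _ T). lra.
  - rewrite rsum_gsum, gsum_head, gsum_head, (gsum_zero Rr).
    + cbn. rewrite (tn_0 _ _ T). generalize (tn_1 _ _ T (S (S N))) (tn_ge0 _ _ T (S (S N)) (c1 B)). nra.
    + intros i Hi; cbn. rewrite (tn_0 _ _ T). apply Rmult_0_l.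
Qed.

Lemma nrm_X s N : (0 <= s)%R -> nrm s N X1 <= s /\ nrm s N X2 <= s /\ nrm s N X3 <= s /\ nrm s N X4 <= s.
Proof.
  intros Hs. assert (T0 := base_tnorm). assert (T1 := pnorm_tnorm _ _ s Hs T0).
  assert (T2 := pnorm_tnorm _ _ s Hs T1). assert (T3 := pnorm_tnorm _ _ s Hs T2).
  unfold nrm, X1, X2, X3, X4.
  repeat split; repeat (first [now apply pX_nrm | eapply Rle_trans; [apply pinj_nrm; assumption|]]).
Qed.

(** The bound [r] on the substituted series becomes the radius for [F]. The level grows to 4 N
    because powers up to that exponent are visible at level [N]. *)
Lemma comp_nrm s r N F : (0 <= s)%R ->
  nrm s N y1 <= r -> nrm s N y2 <= r -> nrm s N y3 <= r -> nrm s N y4 <= r ->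
  nrm s N (comp F y1 y2 y3 y4) <= nrm r (4 * N) F.
Proof.
  intros Hs N1 N2 N3 N4. unfold comp, nrm at 2.
  apply (lift_nrm R3); [assumption..|]. intros f3. apply (lift_nrm R2); [assumption..|].
  intros f2. apply (lift_nrm R1); [assumption..|]. intros f1.
  apply (lift_nrm Cr); [assumption..|]. intros; now apply cst_nrm.
Qed.

Lemma comp_0000 F : comp F y1 y2 y3 y4 0%nat 0%nat 0%nat 0%nat = (F 0 0 0 0)%nat.
Proof.
  assert (HS : forall u y, fsum u y 0%nat 0%nat 0%nat 0%nat = u 0%nat 0%nat 0%nat 0%nat 0%nat).
  { intros u y. unfold fsum. change (sum4 _ _) with (0 + u 0%nat * 1).
    replace (0 + u 0%nat * 1) with (u 0%nat) by ring. reflexivity. }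
  unfold comp, comp3, comp2, comp1, lift. now rewrite !HS.
Qed.
End Comp.

(** [O m b] plays the role of order at least m in [B]. The order of [psi' b] belongs to the claim
    because the next layer multiplies differences of powers by such images. *)
Definition contraction (B : cring) (O : nat -> B -> Prop) (k : nat) (psi psi' : B -> coef4) :=
  forall m b, O m b -> ord m (psi' b) /\ ord (k + m) (psi b - psi' b).

Lemma lift_contraction B O k psi psi' y y' : ord 1 y -> ord 1 y' -> ord (S k) (y - y') ->
  contraction B O k psi psi' ->
  contraction (psr B) (fun m f => forall n, O (m - n)%nat (f n)) k (lift B psi y) (lift B psi' y').
Proof.
  intros H H' Hy Hc m f Hf. split.
  - apply fsum_ord; [assumption|]. intros n. apply (Hc _ _ (Hf n)).
  - apply fsum_contr; try assumption; intros n; apply (Hc _ _ (Hf n)).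
Qed.

Lemma comp_contr k m F y1 y2 y3 y4 y1' y2' y3' y4' :
  ord 1 y1 -> ord 1 y2 -> ord 1 y3 -> ord 1 y4 ->
  ord 1 y1' -> ord 1 y2' -> ord 1 y3' -> ord 1 y4' ->
  eqm (S k) y1 y1' -> eqm (S k) y2 y2' -> eqm (S k) y3 y3' -> eqm (S k) y4 y4' -> ord m F ->
  ord m (comp F y1' y2' y3' y4') /\ ord (k + m) (comp F y1 y2 y3 y4 - comp F y1' y2' y3' y4').
Proof.
  intros H1 H2 H3 H4 H1' H2' H3' H4' E1 E2 E3 E4 HF.
  assert (C0 : contraction Cr (fun m c => m = 0%nat \/ c = RtoC 0) k cst cst).
  { intros n c Hc. split.
    - destruct Hc as [->| ->]; [apply ord_any|rewrite cst_0; apply ord_zero].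
    - replace (cst c - cst c) with 0 by ring. apply ord_zero. }
  unfold comp, comp3, comp2, comp1.
  refine (lift_contraction R3 _ k _ _ _ _ H1 H1' (eqm_sub_ord _ _ _ E1)
    (lift_contraction R2 _ k _ _ _ _ H2 H2' (eqm_sub_ord _ _ _ E2)
    (lift_contraction R1 _ k _ _ _ _ H3 H3' (eqm_sub_ord _ _ _ E3)
    (lift_contraction Cr _ k _ _ _ _ H4 H4' (eqm_sub_ord _ _ _ E4) C0))) m F _).
  intros a b c d. cbn.
  destruct (Nat.eq_dec (m - a - b - c - d) 0) as [E|E]; [now left|right].
  apply HF; lia.
Qed.

Lemma comp_ord m F y1 y2 y3 y4 : ord 1 y1 -> ord 1 y2 -> ord 1 y3 -> ord 1 y4 ->
  ord m F -> ord m (comp F y1 y2 y3 y4).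
Proof.
  intros H1 H2 H3 H4 HF.
  exact (proj1 (comp_contr 0 m F _ _ _ _ _ _ _ _ H1 H2 H3 H4 H1 H2 H3 H4
    (eqm_refl _ _) (eqm_refl _ _) (eqm_refl _ _) (eqm_refl _ _) HF)).
Qed.

(** * Restriction of series to zbar = zetabar = 0 *)

Definition slice (F : coef4) : R2 := fun a b => F a b 0%nat 0%nat.

Lemma slice_rhom : rhom R4 R2 slice.
Proof.
  apply (map_rhom R3 R1 (fun f b => f b 0%nat 0%nat)).
  apply (map_rhom R2 Cr (fun f => f 0%nat 0%nat)).
  apply (rhom_comp R2 R1 Cr (fun f => f 0%nat) (fun f => f 0%nat)); apply ev0_rhom.
Qed.

Lemma slice_fsum u y a b : slice (fsum u y) a b =
  gsum R2 (fun n => cmul R2 (slice (u n)) (cpow R2 (slice y) n)) (S (a + b)) a b.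
Proof.
  assert (P : forall n, slice (pow4 y n) = cpow R2 (slice y) n).
  { induction n as [|n IH]; [apply (hom1 _ _ _ slice_rhom)|].
    change (slice (y * pow4 y n) = cmul R2 (slice y) (cpow R2 (slice y) n)).
    rewrite <- IH. apply (hommul _ _ _ slice_rhom). }
  unfold slice at 1, fsum. replace (a + b + 0 + 0)%nat with (a + b)%nat by lia.
  change (slice (sum4 (fun n => u n * pow4 y n) (S (a + b))) a b =
    gsum R2 (fun n => cmul R2 (slice (u n)) (cpow R2 (slice y) n)) (S (a + b)) a b).
  unfold sum4. rewrite (hom_sum R4 R2 slice); try apply slice_rhom.
  refine (equal_f (equal_f _ a) b). apply (gsum_ext R2); intros n _. rewrite <- P.
    apply (hommul _ _ _ slice_rhom).
Qed.

Lemma slice_fsum_ext u v y : (forall n, slice (u n) = slice (v n)) ->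
  slice (fsum u y) = slice (fsum v y).
Proof.
  intros H. extensionality a; extensionality b. rewrite !slice_fsum.
  refine (equal_f (equal_f _ a) b). apply (gsum_ext R2); intros n _. now rewrite H.
Qed.

Lemma slice_fsum_0 u v y y' : slice y = c0 R2 -> slice y' = c0 R2 ->
  slice (u 0%nat) = slice (v 0%nat) -> slice (fsum u y) = slice (fsum v y').
Proof.
  intros Hy Hy' H. extensionality a; extensionality b. rewrite !slice_fsum.
  refine (equal_f (equal_f _ a) b). apply (gsum_ext R2); intros [|n] _; [now rewrite H|].
  rewrite Hy, Hy'. cbn [cpow].
  assert (Z : forall w x : R2, cmul R2 w (cmul R2 (c0 R2) x) = c0 R2).
  { pose proof (cth R2) as T. intros w x.
    rewrite (Rmul_assoc T), (Rmul_comm T w), <- (Rmul_assoc T).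
    generalize (cmul R2 w x). intros v'.
    apply (ARmul_0_l (Rth_ARth (Eqsth _) (Eq_ext _ _ _) T)). }
  now rewrite !Z.
Qed.

(** When the series put in for zbar and zetabar vanish on the slice, only the terms of [F] free of
    both variables survive. *)
Lemma slice_comp F G y1 y2 y3 y4 y3' y4' :
  slice y3 = c0 R2 -> slice y4 = c0 R2 -> slice y3' = c0 R2 -> slice y4' = c0 R2 ->
  slice F = slice G -> slice (comp F y1 y2 y3 y4) = slice (comp G y1 y2 y3' y4').
Proof.
  intros H3 H4 H3' H4' H. unfold comp, comp3, comp2, comp1, lift.
  apply slice_fsum_ext; intros a. apply slice_fsum_ext; intros b.
  apply slice_fsum_0; [assumption..|]. apply slice_fsum_0; [assumption..|].
  do 2 f_equal. exact (equal_f (equal_f H a) b).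
Qed.
Local Close Scope s4_scope.

(** * Convergence and evaluation *)

(** Componentwise, to match [eval4], which takes limits of real and imaginary parts separately. *)
Definition Clim (a : nat -> C) (v : C) : Prop :=
  is_lim_seq (fun n => Re (a n)) (Re v) /\ is_lim_seq (fun n => Im (a n)) (Im v).

Lemma Clim_ext a b v : (forall n, a n = b n) -> Clim a v -> Clim b v.
Proof.
  intros H [H1 H2]; split; eapply is_lim_seq_ext; try eassumption; intros; cbn; now rewrite H.
Qed.

Lemma Clim_const v : Clim (fun _ => v) v.
Proof. split; apply is_lim_seq_const. Qed.

Lemma Clim_plus a b u v : Clim a u -> Clim b v -> Clim (fun n => (a n + b n)%C) (u + v)%C.
Proof. intros [H1 H2] [H3 H4]; split; cbn; now apply is_lim_seq_plus'. Qed.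

Lemma Clim_mult a b u v : Clim a u -> Clim b v -> Clim (fun n => (a n * b n)%C) (u * v)%C.
Proof.
  intros [H1 H2] [H3 H4]; split; cbn.
  - apply is_lim_seq_minus'; now apply is_lim_seq_mult'.
  - apply is_lim_seq_plus'; now apply is_lim_seq_mult'.
Qed.

Lemma Clim_minus a b u v : Clim a u -> Clim b v -> Clim (fun n => (a n - b n)%C) (u - v)%C.
Proof. intros [H1 H2] [H3 H4]; split; cbn; now apply is_lim_seq_minus'. Qed.

Lemma Clim_conj a u : Clim a u -> Clim (fun n => Cconj (a n)) (Cconj u).
Proof.
  intros [H1 H2]; split; cbn; [assumption|]. apply (proj1 (is_lim_seq_opp _ _) H2).
Qed.

Lemma Clim_unique a u v : Clim a u -> Clim a v -> u = v.
Proof.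
  intros [H1 H2] [H3 H4]. destruct u, v; cbn in *.
  apply is_lim_seq_unique in H1; apply is_lim_seq_unique in H2.
  apply is_lim_seq_unique in H3; apply is_lim_seq_unique in H4.
  rewrite H1 in H3; rewrite H2 in H4. congruence.
Qed.

Lemma Cmod_Re_Im_le z : Cmod z <= Rabs (Re z) + Rabs (Im z).
Proof.
  unfold Cmod. destruct z as [x y]; cbn [fst snd Re Im].
  assert (0 <= Rabs x) by apply Rabs_pos. assert (0 <= Rabs y) by apply Rabs_pos.
  rewrite <- (sqrt_Rsqr (Rabs x + Rabs y)) by lra.
  apply sqrt_le_1_alt. unfold Rsqr.
  rewrite <- (pow2_abs x), <- (pow2_abs y). nra.
Qed.

Lemma Re_le_Cmod' z : Rabs (Re z) <= Cmod z.
Proof. eapply Rle_trans; [|apply Rmax_Cmod]. apply Rmax_l. Qed.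
Lemma Im_le_Cmod' z : Rabs (Im z) <= Cmod z.
Proof. eapply Rle_trans; [|apply Rmax_Cmod]. apply Rmax_r. Qed.

Lemma Clim_Cmod a v : Clim a v -> is_lim_seq (fun n => Cmod (a n)) (Cmod v).
Proof.
  intros H.
  assert (H0 : Clim (fun n => (a n - v)%C) (RtoC 0)).
  { replace (RtoC 0) with (v - v)%C by ring. apply Clim_minus; [assumption|apply Clim_const]. }
  destruct H0 as [H1 H2].
  assert (L := is_lim_seq_plus' _ _ _ _ (proj1 (is_lim_seq_abs_0 _) H1)
    (proj1 (is_lim_seq_abs_0 _) H2)). rewrite Rplus_0_r in L.
  apply (is_lim_seq_ext (fun n => (Cmod (a n) - Cmod v) + Cmod v)); [intros; ring|].
  cut (is_lim_seq (fun n => Cmod (a n) - Cmod v + Cmod v) (0 + Cmod v));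
    [now rewrite Rplus_0_l|].
  apply is_lim_seq_plus'; [|apply is_lim_seq_const].
  apply is_lim_seq_abs_0.
  apply (is_lim_seq_le_le (fun _ => 0) _ _ 0) with (3 := L); [|apply is_lim_seq_const].
  intros n; split; [apply Rabs_pos|].
  eapply Rle_trans; [|apply (Cmod_Re_Im_le (a n - v)%C)].
  assert (T1 := Cmod_triangle (a n - v)%C v). assert (T2 := Cmod_triangle (- (a n - v))%C (a n)).
  rewrite Cmod_opp in T2.
  replace (a n - v + v)%C with (a n) in T1 by ring.
  replace (- (a n - v) + a n)%C with v in T2 by ring.
  apply Rabs_le; lra.
Qed.

Lemma Clim_Cmod_le a v B : Clim a v -> (forall n, Cmod (a n) <= B) -> Cmod v <= B.
Proof.
  intros H HB. apply Clim_Cmod in H.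
  apply (is_lim_seq_le _ (fun _ => B) _ _ HB H (is_lim_seq_const B)).
Qed.

Lemma Clim_0_le a e : is_lim_seq e 0 -> (forall n, Cmod (a n) <= e n) -> Clim a (RtoC 0).
Proof.
  intros He H. split; cbn; apply is_lim_seq_abs_0;
  (apply (is_lim_seq_le_le (fun _ => 0) _ e 0); [|apply is_lim_seq_const|assumption]);
  intros n; (split; [apply Rabs_pos|]); (eapply Rle_trans; [|apply H]);
  [apply Re_le_Cmod'|apply Im_le_Cmod'].
Qed.

Lemma bnd_ge0 s B F : 0 <= s -> bnd s B F -> 0 <= B.
Proof. intros Hs H. eapply Rle_trans; [|apply (H 0%nat)]. apply (tn_ge0 R4 _ (nrm_tnorm s Hs)). Qed.

Definition tot (s : R) (F : coef4) : R := real (Lim_seq (fun N => nrm s N F)).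

Lemma tot_lim s B F : 0 <= s -> bnd s B F -> is_lim_seq (fun N => nrm s N F) (tot s F).
Proof.
  intros Hs H. unfold tot. apply Lim_seq_correct'.
  apply ex_finite_lim_seq_incr with B; [|exact H].
  intros n. apply (tn_mono R4 _ (nrm_tnorm s Hs)); lia.
Qed.

Lemma tot_ge s B F N : 0 <= s -> bnd s B F -> nrm s N F <= tot s F.
Proof.
  intros Hs H. apply (is_lim_seq_incr_compare _ _ (tot_lim s B F Hs H)).
  intros n. apply (tn_mono R4 _ (nrm_tnorm s Hs)); lia.
Qed.

Lemma tail_lim s B F : 0 <= s -> bnd s B F -> is_lim_seq (fun N => tot s F - nrm s N F) 0.
Proof.
  intros Hs H. replace 0 with (tot s F - tot s F) by ring.
  apply is_lim_seq_minus'; [apply is_lim_seq_const|now apply tot_lim with B].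
Qed.

Lemma X1E a b c d : X1 a b c d = match a, b, c, d with 1, 0, 0, 0 => RtoC 1 | _, _, _, _ => RtoC 0 end%nat.
Proof. destruct a as [|[|a]], b, c, d; reflexivity. Qed.
Lemma X2E a b c d : X2 a b c d = match a, b, c, d with 0, 1, 0, 0 => RtoC 1 | _, _, _, _ => RtoC 0 end%nat.
Proof. destruct a, b as [|[|b]], c, d; reflexivity. Qed.
Lemma cstE k a b c d : cst k a b c d = match a, b, c, d with 0, 0, 0, 0 => k | _, _, _, _ => RtoC 0 end%nat.
Proof. destruct a, b, c, d; reflexivity. Qed.
Lemma X3E a b c d : X3 a b c d = match a, b, c, d with 0, 0, 1, 0 => RtoC 1 | _, _, _, _ => RtoC 0 end%nat.
Proof. destruct a, b, c as [|[|c]], d; reflexivity. Qed.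
Lemma X4E a b c d : X4 a b c d = match a, b, c, d with 0, 0, 0, 1 => RtoC 1 | _, _, _, _ => RtoC 0 end%nat.
Proof. destruct a, b, c, d as [|[|d]]; reflexivity. Qed.

Lemma psum4_stable F K N x1 x2 x3 x4 : (K <= N)%nat ->
  (forall a b c d, (K <= a \/ K <= b \/ K <= c \/ K <= d)%nat -> F a b c d = RtoC 0) ->
  psum4 F x1 x2 x3 x4 N = psum4 F x1 x2 x3 x4 K.
Proof.
  intros L H. unfold psum4.
  rewrite (csum_gsum _ N), (gsum_trunc Cr _ K N L).
  2: { intros a Ha. repeat (apply (gsum_zero Cr); intros). rewrite H by lia. apply Cmult_0_l. }
  apply csum_ext; intros a _. rewrite (csum_gsum _ N), (gsum_trunc Cr _ K N L).
  2: { intros b Hb. repeat (apply (gsum_zero Cr); intros). rewrite H by lia. apply Cmult_0_l. }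
  apply csum_ext; intros b _. rewrite (csum_gsum _ N), (gsum_trunc Cr _ K N L).
  2: { intros c Hc. repeat (apply (gsum_zero Cr); intros). rewrite H by lia. apply Cmult_0_l. }
  apply csum_ext; intros c _. rewrite (csum_gsum _ N), (gsum_trunc Cr _ K N L).
  2: { intros d Hd. rewrite H by lia. apply Cmult_0_l. }
  reflexivity.
Qed.

Section Eval.
Variables (x1 x2 x3 x4 : C) (s : R).
Hypotheses (L1 : Cmod x1 <= s) (L2 : Cmod x2 <= s) (L3 : Cmod x3 <= s) (L4 : Cmod x4 <= s).

Let s_ge0 : 0 <= s.
Proof. eapply Rle_trans; [apply Cmod_ge_0|exact L1]. Qed.
Let TN := nrm_tnorm s s_ge0.
Let TE := ev_teval x1 x2 x3 x4 s L1 L2 L3 L4.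
Local Notation E := (ev x1 x2 x3 x4).

Lemma eval4_unique F v : Clim (fun N => E N F) v -> eval4 F x1 x2 x3 x4 = v.
Proof.
  intros [H1 H2]. unfold eval4.
  rewrite (Lim_seq_ext _ (fun N => Re (E N F))) by (intros; now rewrite evE).
  rewrite (Lim_seq_ext (fun N => Im _) (fun N => Im (E N F))) by (intros; now rewrite evE).
  rewrite (is_lim_seq_unique _ _ H1), (is_lim_seq_unique _ _ H2). now destruct v.
Qed.

(** By [te_diff], increments of the partial sums are dominated by those of the norms, a bounded
    increasing sequence; hence both components are Cauchy. *)
Lemma eval4_lim B F : bnd s B F -> Clim (fun N => E N F) (eval4 F x1 x2 x3 x4).
Proof.
  intros H.
  assert (Cau : forall g, (forall z w, Rabs (g z - g w) <= Cmod (z - w)%C) ->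
    ex_finite_lim_seq (fun N => g (E N F))).
  { intros g Hg. apply ex_lim_seq_cauchy_corr. intros eps.
    destruct (proj2 (is_lim_seq_spec _ _) (tail_lim s B F s_ge0 H) eps) as [N0 HN0].
    assert (K : forall n m, (N0 <= m)%nat -> (m <= n)%nat -> Rabs (g (E n F) - g (E m F)) < eps).
    { intros n m Lm Ln. eapply Rle_lt_trans; [apply Hg|].
      eapply Rle_lt_trans; [apply (te_diff _ _ _ TE _ _ F Ln)|].
      specialize (HN0 m Lm). rewrite Rminus_0_r in HN0.
      apply Rabs_lt_between in HN0. assert (G := tot_ge s B F n s_ge0 H). lra. }
    exists N0. intros n m Ln Lm. destruct (Nat.le_ge_cases m n).
    - now apply K.
    - rewrite Rabs_minus_sym. now apply K. }
  unfold eval4.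
  split; cbn.
  - rewrite (Lim_seq_ext _ (fun N => Re (E N F))) by (intros; now rewrite evE).
    apply Lim_seq_correct', Cau. intros z w. apply (Re_le_Cmod' (z - w)%C).
  - rewrite (Lim_seq_ext _ (fun N => Im (E N F))) by (intros; now rewrite evE).
    apply Lim_seq_correct', Cau. intros z w. apply (Im_le_Cmod' (z - w)%C).
Qed.

(** The bound travels with the limit because the Cauchy product argument relies on absolute
    convergence. *)
Definition sums_to (F : coef4) (v : C) : Prop :=
  (exists B, bnd s B F) /\ Clim (fun N => E N F) v.

Lemma sums_to_eval F v : sums_to F v -> eval4 F x1 x2 x3 x4 = v.
Proof. intros [_ H]; now apply eval4_unique. Qed.
Lemma sums_to_intro B F : bnd s B F -> sums_to F (eval4 F x1 x2 x3 x4).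
Proof. intros H; split; [now exists B|now apply eval4_lim with B]. Qed.

Lemma sums_to_add F G u v : sums_to F u -> sums_to G v -> sums_to (F + G)%s4 (u + v)%C.
Proof.
  intros [[B H] Hu] [[B' H'] Hv]; split.
  - exists (B + B'). intros N. eapply Rle_trans; [apply (tn_add _ _ TN)|].
    specialize (H N); specialize (H' N); lra.
  - apply (Clim_ext (fun N => (E N F + E N G)%C)).
    + intros; symmetry; apply (te_add _ _ _ TE).
    + now apply Clim_plus.
Qed.

Lemma bnd_mul B B' F G : bnd s B F -> bnd s B' G -> bnd s (B * B') (F * G)%s4.
Proof.
  intros H H' N. eapply Rle_trans; [apply (tn_mul _ _ TN)|].
  apply Rmult_le_compat; auto; apply (tn_ge0 _ _ TN).
Qed.

Lemma div2_lim (a : nat -> R) (l : R) : is_lim_seq a l -> is_lim_seq (fun N => a (N / 2)%nat) l.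
Proof.
  intros H. apply (is_lim_seq_subseq a l (fun N => (N / 2)%nat)); [|exact H].
  intros P [N0 HP]. exists (2 * N0)%nat. intros n Hn. apply HP.
  apply Nat.div_le_lower_bound; lia.
Qed.

(** With M = N / 2 in [te_mul], the error is a difference of two sequences that both tend to the
    product of the total norms. *)
Lemma sums_to_mul F G u v : sums_to F u -> sums_to G v -> sums_to (F * G)%s4 (u * v)%C.
Proof.
  intros [[B H] Hu] [[B' H'] Hv]; split; [exists (B * B'); now apply bnd_mul|].
  assert (D : Clim (fun N => (E N F * E N G - E N (F * G)%s4)%C) (RtoC 0)).
  { apply (Clim_0_le _ (fun N => nrm s N F * nrm s N G - nrm s (N / 2) F * nrm s (N / 2) G)).
    - replace 0 with (tot s F * tot s G - tot s F * tot s G) by ring.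
      apply is_lim_seq_minus'.
      + apply is_lim_seq_mult'; [apply (tot_lim s B)|apply (tot_lim s B')]; assumption.
      + apply (div2_lim (fun N => nrm s N F * nrm s N G)).
        apply is_lim_seq_mult'; [apply (tot_lim s B)|apply (tot_lim s B')]; assumption.
    - intros N. apply (te_mul _ _ _ TE). generalize (Nat.mul_div_le N 2); lia. }
  replace (u * v)%C with (u * v - RtoC 0)%C by ring.
  eapply Clim_ext; [|apply Clim_minus; [apply (Clim_mult _ _ _ _ Hu Hv)|exact D]].
  intros; cbn. ring.
Qed.

Lemma sums_to_stable B F K : bnd s B F ->
  (forall a b c d, (K <= a \/ K <= b \/ K <= c \/ K <= d)%nat -> F a b c d = RtoC 0) ->
  sums_to F (psum4 F x1 x2 x3 x4 K).
Proof.
  intros HB H. split; [now exists B|].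
  split; apply (is_lim_seq_incr_n _ K); eapply is_lim_seq_ext; try apply is_lim_seq_const;
  intros n; cbn -[ev psum4]; rewrite evE, (psum4_stable F K (n + K)); try reflexivity; auto; lia.
Qed.

Lemma sums_to_cst c : sums_to (cst c) c.
Proof.
  replace c with (psum4 (cst c) x1 x2 x3 x4 1) at 2.
  - apply sums_to_stable with (Cmod c); [intros N; now apply cst_nrm|].
    intros i j k l H. rewrite cstE. destruct i, j, k, l; try reflexivity; lia.
  - unfold psum4; cbn [csum]. rewrite !cstE. cbn [Cpow]. ring.
Qed.

Lemma sums_to_X : sums_to X1 x1 /\ sums_to X2 x2 /\ sums_to X3 x3 /\ sums_to X4 x4.
Proof.
  assert (N := fun N => nrm_X s N s_ge0).
  assert (L : forall F v, (forall N, nrm s N F <= s) ->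
    (forall a b c d, (2 <= a \/ 2 <= b \/ 2 <= c \/ 2 <= d)%nat -> F a b c d = RtoC 0) ->
    psum4 F x1 x2 x3 x4 2 = v -> sums_to F v)
    by (intros F v H H' <-; now apply sums_to_stable with s).
  split; [|split; [|split]]; (apply L; [intros M; apply N| |]);
  try (unfold psum4; cbn [csum]; rewrite ?X1E, ?X2E, ?X3E, ?X4E; cbn [Cpow]; ring);
  intros i j k l H; rewrite ?X1E, ?X2E, ?X3E, ?X4E;
  destruct i as [|[|i]], j as [|[|j]], k as [|[|k]], l as [|[|l]]; try reflexivity; lia.
Qed.

Lemma sums_to_sub F G u v : sums_to F u -> sums_to G v -> sums_to (F - G)%s4 (u - v)%C.
Proof.
  intros H H'. replace (F - G)%s4 with (F + cst (- RtoC 1)%C * G)%s4.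
  - replace (u - v)%C with (u + - RtoC 1 * v)%C by ring.
    apply sums_to_add; [assumption|]. apply sums_to_mul; [apply sums_to_cst|assumption].
  - rewrite cst_opp, cst_1. ring.
Qed.

Lemma sums_to_pow y v n : sums_to y v -> sums_to (pow4 y n) (Cpow v n).
Proof.
  intros H; induction n as [|n IH].
  - change (pow4 y 0) with 1%s4. rewrite <- cst_1. apply sums_to_cst.
  - change (pow4 y (S n)) with (y * pow4 y n)%s4. now apply sums_to_mul.
Qed.

Lemma sums_to_sum f w n : (forall i, sums_to (f i) (w i)) -> sums_to (sum4 f n) (csum w n).
Proof.
  intros H; induction n as [|n IH].
  - change (sum4 f 0) with 0%s4. rewrite <- cst_0. apply sums_to_cst.
  - change (sum4 f (S n)) with (sum4 f n + f n)%s4. now apply sums_to_add.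
Qed.

Lemma sums_to_bound F v B : sums_to F v -> bnd s B F -> Cmod v <= B.
Proof.
  intros [_ H] HB. apply (Clim_Cmod_le _ _ _ H). intros n.
  eapply Rle_trans; [apply (te_le _ _ _ TE)|apply HB].
Qed.

Definition ptr (B : cring) (t : B -> B) (K : nat) (f : psr B) : psr B :=
  fun n => if (n <? K)%nat then t (f n) else c0 B.

Lemma lift_ptr B phi t e K y eta f : ord 1 y -> sums_to y eta -> phi (c0 B) = 0%s4 ->
  (forall b, sums_to (phi (t b)) (e K b)) ->
  sums_to (lift B phi y (ptr B t K f)) (peval B e eta K f).
Proof.
  intros H Hy H0 Hb. unfold lift. rewrite (fsum_fin _ _ K H).
  - rewrite (sum4_ext _ (fun n => phi (t (f n)) * pow4 y n)%s4).
    + unfold peval. apply (sums_to_sum _ (fun n => (e K (f n) * Cpow eta n)%C)).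
      intros i. apply sums_to_mul; [apply Hb|now apply sums_to_pow].
    + intros n Hn. unfold ptr. apply Nat.ltb_lt in Hn; now rewrite Hn.
  - intros n Hn. unfold ptr. apply Nat.ltb_ge in Hn; now rewrite Hn.
Qed.

Definition trunc4 (K : nat) (F : coef4) : coef4 :=
  ptr R3 (ptr R2 (ptr R1 (ptr Cr (fun c => c) K) K) K) K F.

Lemma trunc_tail B p t K M r : tnorm B p -> 0 <= r -> (K <= M)%nat ->
  (forall b, p M (csub B b (t b)) <= p M b - p K b) ->
  forall f, pnorm B p r M (csub (psr B) f (ptr B t K f)) <= pnorm B p r M f - pnorm B p r K f.
Proof.
  intros T Hr L Hb f. unfold pnorm. rewrite (rsum_restrict _ K M L), <- rsum_minus.
  assert (Hp : forall n, 0 <= r ^ n) by (intros; now apply pow_le).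
  apply rsum_le; intros n Hn. cbn [csub psr]; unfold ptr. destruct (n <? K)%nat.
  - rewrite <- Rmult_minus_distr_r. now apply Rmult_le_compat_r.
  - assert (Q : csub B (f n) (c0 B) = f n).
    { rewrite (Rsub_def (cth B)), (Radd_comm (cth B)), <- (Radd_0_l (cth B) (copp B (c0 B))).
      rewrite (Ropp_def (cth B)). apply (Radd_0_l (cth B)). }
    rewrite Q. lra.
Qed.

Lemma trunc4_tail K M r F : 0 <= r -> (K <= M)%nat ->
  nrm r M (F - trunc4 K F)%s4 <= nrm r M F - nrm r K F.
Proof.
  intros Hr L. assert (T0 := base_tnorm). assert (T1 := pnorm_tnorm _ _ r Hr T0).
  assert (T2 := pnorm_tnorm _ _ r Hr T1). assert (T3 := pnorm_tnorm _ _ r Hr T2).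
  unfold nrm, trunc4.
  apply (trunc_tail R3); try assumption. apply (trunc_tail R2); try assumption.
  apply (trunc_tail R1); try assumption. apply (trunc_tail Cr); try assumption.
  intros b; cbn. replace (b - b)%C with (RtoC 0) by ring. rewrite Cmod_0; lra.
Qed.

(** For the polynomial [trunc4 K F], substitution and evaluation commute by algebra. The rest of [F]
    has norm at most [tot r F - nrm r K F] at radius [r]; substitution does not increase this tail,
    so it bounds the error in the value and tends to 0 with K. *)
Lemma eval4_comp r B F y1 y2 y3 y4 :
  ord 1 y1 -> ord 1 y2 -> ord 1 y3 -> ord 1 y4 ->
  bnd r B F -> bnd s r y1 -> bnd s r y2 -> bnd s r y3 -> bnd s r y4 ->
  sums_to (comp F y1 y2 y3 y4)
   (eval4 F (eval4 y1 x1 x2 x3 x4) (eval4 y2 x1 x2 x3 x4) (eval4 y3 x1 x2 x3 x4) (eval4 y4 x1 x2 x3 x4)).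
Proof.
  intros O1 O2 O3 O4 HF B1 B2 B3 B4.
  assert (Hr : 0 <= r) by (eapply bnd_ge0; eassumption).
  assert (HB : bnd s B (comp F y1 y2 y3 y4)).
  { intros N. eapply Rle_trans; [apply (comp_nrm y1 y2 y3 y4) with (r := r); auto|apply HF]. }
  assert (S0 := sums_to_intro _ _ HB).
  set (V := eval4 (comp F y1 y2 y3 y4) x1 x2 x3 x4) in *.
  set (e1 := eval4 y1 x1 x2 x3 x4). set (e2 := eval4 y2 x1 x2 x3 x4).
  set (e3 := eval4 y3 x1 x2 x3 x4). set (e4 := eval4 y4 x1 x2 x3 x4).
  replace (eval4 F e1 e2 e3 e4) with V; [exact S0|].
  assert (K : Clim (fun K => ev e1 e2 e3 e4 K F) V).
  { assert (D : Clim (fun K => (ev e1 e2 e3 e4 K F - V)%C) (RtoC 0)).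
    - apply (Clim_0_le _ (fun K => tot r F - nrm r K F)); [now apply tail_lim with B|].
      intros K.
      assert (SK : sums_to (comp (trunc4 K F) y1 y2 y3 y4) (ev e1 e2 e3 e4 K F)).
      { unfold comp, trunc4, ev.
        apply (lift_ptr R3); [assumption|now apply sums_to_intro with r|apply (comp3_rhom _ _ _ O2 O3 O4)|].
        intros f3. unfold comp3.
        apply (lift_ptr R2); [assumption|now apply sums_to_intro with r|apply (comp2_rhom _ _ O3 O4)|].
        intros f2. unfold comp2.
        apply (lift_ptr R1); [assumption|now apply sums_to_intro with r|apply (comp1_rhom _ O4)|].
        intros f1. unfold comp1.
        apply (lift_ptr Cr); [assumption|now apply sums_to_intro with r|apply cst_rhom|].
        intros c. apply sums_to_cst. }
      assert (SD := sums_to_sub _ _ _ _ S0 SK).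
      rewrite <- comp_sub in SD by assumption.
      replace (_ - _)%C with (- (V - ev e1 e2 e3 e4 K F))%C by ring.
      rewrite Cmod_opp. apply (sums_to_bound _ _ _ SD).
      (* Raising the level by [K] puts it above the cut, as [trunc4_tail] requires. *)
      intros N. eapply Rle_trans; [apply (tn_mono _ _ TN N (N + K)); lia|].
      eapply Rle_trans; [apply (comp_nrm y1 y2 y3 y4) with (r := r); auto|].
      eapply Rle_trans; [apply trunc4_tail; [assumption|lia]|].
      assert (G := tot_ge r B F (4 * (N + K)) Hr HF). lra.
    - replace V with (RtoC 0 + V)%C by ring.
      eapply Clim_ext; [|apply Clim_plus; [exact D|apply Clim_const]]. intros; cbn; ring. }
  symmetry. destruct K as [K1 K2]. unfold eval4 at 1.
  rewrite (Lim_seq_ext _ (fun N => Re (ev e1 e2 e3 e4 N F))) by (intros; now rewrite evE).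
  rewrite (Lim_seq_ext (fun N => Im _) (fun N => Im (ev e1 e2 e3 e4 N F))) by (intros; now rewrite evE).
  rewrite (is_lim_seq_unique _ _ K1), (is_lim_seq_unique _ _ K2). now destruct V.
Qed.
End Eval.

(** * Convergence under change of radius, algebra and differentiation *)

Lemma nrm_le s N F G k : 0 <= s -> (forall a b c d, Cmod (F a b c d) <= k * Cmod (G a b c d)) ->
  nrm s N F <= k * nrm s N G.
Proof.
  intros Hs H. rewrite !nrmE. rewrite <- rsum_scal.
  apply rsum_le; intros; rewrite <- rsum_scal. apply rsum_le; intros; rewrite <- rsum_scal.
  apply rsum_le; intros; rewrite <- rsum_scal. apply rsum_le; intros.
  rewrite <- Rmult_assoc. apply Rmult_le_compat_r; [now apply pow_le|apply H].
Qed.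

Lemma nrm_sub s N F G : 0 <= s -> nrm s N (F - G)%s4 <= nrm s N F + nrm s N G.
Proof.
  intros Hs. assert (T := nrm_tnorm s Hs).
  replace (F - G)%s4 with (F + cst (- RtoC 1)%C * G)%s4 by (rewrite cst_opp, cst_1; ring).
  eapply Rle_trans; [apply (tn_add R4 _ T)|]. apply Rplus_le_compat_l.
  eapply Rle_trans; [apply (tn_mul R4 _ T)|].
  assert (K := cst_nrm s N (- RtoC 1)%C Hs). rewrite Cmod_opp, Cmod_1 in K.
  generalize (tn_ge0 R4 _ T N G). nra.
Qed.

(** Every degree gains a factor s / r when the radius shrinks. This is the source of smallness in
    both the identity theorem and the inverse function theorem. *)
Lemma nrm_ord s r k N F : 0 < r -> 0 <= s <= r -> ord k F ->
  nrm s N F <= (s / r) ^ k * nrm r N F.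
Proof.
  intros Hr [Hs Hsr] H. rewrite !nrmE.
  do 4 (rewrite <- rsum_scal; apply rsum_le; intros).
  assert (Q : 0 <= s / r <= 1).
  { split; [apply Rmult_le_pos; [lra|left; now apply Rinv_0_lt_compat]|].
    apply Rmult_le_reg_r with r; [lra|]. unfold Rdiv. rewrite Rmult_assoc, Rinv_l; lra. }
  set (m := (i + i0 + i1 + i2)%nat).
  destruct (Nat.lt_ge_cases m k) as [L|L].
  - rewrite H by exact L. rewrite Cmod_0. lra.
  - assert (G : s ^ m <= (s / r) ^ k * r ^ m).
    + replace s with ((s / r) * r) at 1 by (field; lra). rewrite Rpow_mult_distr.
      apply Rmult_le_compat_r; [apply pow_le; lra|].
      replace m with (k + (m - k))%nat by lia. rewrite pow_add.
      assert ((s / r) ^ (m - k) <= 1).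
      { rewrite <- (pow1 (m - k)). now apply pow_incr. }
      assert (0 <= (s / r) ^ k) by (apply pow_le; lra). nra.
    + generalize (Cmod_ge_0 (F i i0 i1 i2)). intros. nra.
Qed.

Lemma bnd_ord s r k B F : 0 < r -> 0 <= s <= r -> ord k F -> bnd r B F ->
  bnd s ((s / r) ^ k * B) F.
Proof.
  intros Hr Hs H HB N. eapply Rle_trans; [now apply (nrm_ord s r k)|].
  apply Rmult_le_compat_l; [|apply HB]. apply pow_le.
  apply Rmult_le_pos; [lra|left; now apply Rinv_0_lt_compat].
Qed.

Lemma bnd_radius s r B F : 0 < r -> 0 <= s <= r -> bnd r B F -> bnd s B F.
Proof.
  intros Hr Hs H. replace B with ((s / r) ^ 0 * B) by (cbn; ring).
  apply bnd_ord; auto using ord_any.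
Qed.

Lemma convergent4_common F G : convergent4 F -> convergent4 G ->
  exists s B, 0 < s /\ bnd s B F /\ bnd s B G.
Proof.
  rewrite !convergent4E. intros (s & B & Hs & HB) (s' & B' & Hs' & HB').
  exists (Rmin s s'), (Rmax B B').
  assert (M := Rmin_l s s'). assert (M' := Rmin_r s s').
  assert (P : 0 < Rmin s s') by now apply Rmin_pos.
  split; [exact P|]. split; intros N.
  - eapply Rle_trans; [|apply Rmax_l]. apply (bnd_radius _ s); auto; lra.
  - eapply Rle_trans; [|apply Rmax_r]. apply (bnd_radius _ s'); auto; lra.
Qed.

Lemma cv_add F G : convergent4 F -> convergent4 G -> convergent4 (F + G)%s4.
Proof.
  intros HF HG. destruct (convergent4_common F G HF HG) as (s & B & Hs & H1 & H2).
  apply convergent4E. exists s, (B + B); split; [exact Hs|]. intros N.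
  eapply Rle_trans; [apply (tn_add R4 _ (nrm_tnorm s ltac:(lra)))|].
  specialize (H1 N); specialize (H2 N); lra.
Qed.

Lemma cv_mul F G : convergent4 F -> convergent4 G -> convergent4 (F * G)%s4.
Proof.
  intros HF HG. destruct (convergent4_common F G HF HG) as (s & B & Hs & H1 & H2).
  apply convergent4E. exists s, (B * B); split; [exact Hs|]. intros N.
  assert (T := nrm_tnorm s ltac:(lra)).
  eapply Rle_trans; [apply (tn_mul R4 _ T)|].
  apply Rmult_le_compat; auto; apply (tn_ge0 R4 _ T).
Qed.

Lemma cv_cst c : convergent4 (cst c).
Proof.
  apply convergent4E. exists 1, (Cmod c); split; [lra|]. intros N. apply cst_nrm; lra.
Qed.

Lemma cv_sub F G : convergent4 F -> convergent4 G -> convergent4 (F - G)%s4.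
Proof.
  intros HF HG. replace (F - G)%s4 with (F + cst (- RtoC 1)%C * G)%s4.
  - apply cv_add, cv_mul, HG; [exact HF|apply cv_cst].
  - rewrite cst_opp, cst_1. ring.
Qed.

Lemma cv_dom F G k : (forall a b c d, Cmod (F a b c d) <= k * Cmod (G a b c d)) ->
  0 <= k -> convergent4 G -> convergent4 F.
Proof.
  intros H Hk. rewrite !convergent4E. intros (s & B & Hs & HB).
  exists s, (k * B). split; [exact Hs|]. intros N.
  eapply Rle_trans; [apply nrm_le; [lra|exact H]|]. now apply Rmult_le_compat_l.
Qed.

Lemma rsum_up g h N : (forall i, g i <= h i) -> (forall i, 0 <= h i) -> rsum g N <= rsum h (S N).
Proof.
  intros H H0. eapply Rle_trans; [apply rsum_le; intros; apply H|]. apply rsum_mono; auto.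
Qed.

Lemma rsum_up_shift g h N : (forall i, g i <= h (S i)) -> (forall i, 0 <= h i) ->
  rsum g N <= rsum h (S N).
Proof.
  intros H H0. rewrite (rsum_gsum h), gsum_head.
  apply Rle_trans with (rsum (fun i => h (S i)) N); [apply rsum_le; intros; apply H|].
  change (rsum (fun i => h (S i)) N <= h 0%nat + rsum (fun i => h (S i)) N).
  specialize (H0 0%nat); lra.
Qed.

(** Halving the radius pays for the factor produced by a derivative, since n + 1 <= 2^n <= 2^m. *)
Lemma der_term r n m x : 0 < r -> (n <= m)%nat -> 0 <= x ->
  INR (S n) * x * (r / 2) ^ m <= / r * (x * r ^ S m).
Proof.
  intros Hr L Hx.
  assert (H2 : INR (S n) <= 2 ^ m).
  { apply Rle_trans with (2 ^ n); [|apply Rle_pow; [lra|exact L]].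
    induction n as [|n IH]; [cbn; lra|]. rewrite S_INR. cbn [pow].
    assert (1 <= 2 ^ n) by (apply pow_R1_Rle; lra). specialize (IH ltac:(lia)). lra. }
  unfold Rdiv. rewrite Rpow_mult_distr, pow_inv.
  assert (P2 : 0 < 2 ^ m) by (apply pow_lt; lra).
  assert (Pr : 0 < r ^ m) by (now apply pow_lt).
  cbn [pow]. replace (/ r * (x * (r * r ^ m))) with (x * r ^ m) by (field; lra).
  replace (INR (S n) * x * (r ^ m * / 2 ^ m)) with ((x * r ^ m) * (INR (S n) * / 2 ^ m)) by ring.
  rewrite <- (Rmult_1_r (x * r ^ m)) at 2.
  apply Rmult_le_compat_l; [apply Rmult_le_pos; lra|].
  apply Rmult_le_reg_r with (2 ^ m); [exact P2|]. rewrite Rmult_assoc, Rinv_l; lra.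
Qed.

Lemma Cmod_INR_mult n x : Cmod (RtoC (INR n) * x)%C = INR n * Cmod x.
Proof. rewrite Cmod_mult, Cmod_R, Rabs_pos_eq; [reflexivity|apply pos_INR]. Qed.

Section Der_bounds.
Variables (r : R) (N : nat) (F : coef4).
Hypothesis Hr : 0 < r.
Let t a b c d := Cmod (F a b c d) * r ^ (a + b + c + d).
Let t0 : forall a b c d, 0 <= t a b c d.
Proof. intros; apply Rmult_le_pos; [apply Cmod_ge_0|apply pow_le; lra]. Qed.

Lemma nrm_scal_form : / r * nrm r (S N) F = rsum (fun a => rsum (fun b => rsum (fun c =>
  rsum (fun d => / r * t a b c d) (S N)) (S N)) (S N)) (S N).
Proof.
  rewrite nrmE. do 4 (rewrite <- rsum_scal; apply rsum_ext; intros). reflexivity.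
Qed.

Ltac nonneg := repeat (apply rsum_ge0; intros ?); apply Rmult_le_pos;
  [left; now apply Rinv_0_lt_compat|apply t0].
Ltac up := apply rsum_up; intros ?; [|nonneg].
Ltac shift := apply rsum_up_shift; intros ?; [|nonneg].
Ltac der_leaf := unfold t; eapply Rle_trans;
  [apply der_term; [exact Hr| |apply Cmod_ge_0]; lia|];
  apply Req_le; do 3 f_equal; lia.

Lemma nrm_d_z : nrm (r / 2) N (d_z F) <= / r * nrm r (S N) F.
Proof.
  rewrite nrm_scal_form, nrmE. shift. up. up. up.
  unfold d_z. rewrite Cmod_INR_mult. der_leaf.
Qed.

Lemma nrm_d_zeta : nrm (r / 2) N (d_zeta F) <= / r * nrm r (S N) F.
Proof.
  rewrite nrm_scal_form, nrmE. up. shift. up. up.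
  unfold d_zeta. rewrite Cmod_INR_mult. der_leaf.
Qed.

Lemma nrm_d_zb : nrm (r / 2) N (d_zb F) <= / r * nrm r (S N) F.
Proof.
  rewrite nrm_scal_form, nrmE. up. up. shift. up.
  unfold d_zb. rewrite Cmod_INR_mult. der_leaf.
Qed.

Lemma nrm_d_zetab : nrm (r / 2) N (d_zetab F) <= / r * nrm r (S N) F.
Proof.
  rewrite nrm_scal_form, nrmE. up. up. up. shift.
  unfold d_zetab. rewrite Cmod_INR_mult. der_leaf.
Qed.
End Der_bounds.

Lemma cv_der D F : (forall r N G, 0 < r -> nrm (r / 2) N (D G) <= / r * nrm r (S N) G) ->
  convergent4 F -> convergent4 (D F).
Proof.
  intros H. rewrite !convergent4E. intros (s & B & Hs & HB).
  exists (s / 2), (/ s * B). split; [lra|]. intros N. eapply Rle_trans; [now apply H|].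
  apply Rmult_le_compat_l; [left; now apply Rinv_0_lt_compat|apply HB].
Qed.

Lemma cv_d_z F : convergent4 F -> convergent4 (d_z F).
Proof. apply cv_der; intros; now apply nrm_d_z. Qed.
Lemma cv_d_zeta F : convergent4 F -> convergent4 (d_zeta F).
Proof. apply cv_der; intros; now apply nrm_d_zeta. Qed.
Lemma cv_d_zb F : convergent4 F -> convergent4 (d_zb F).
Proof. apply cv_der; intros; now apply nrm_d_zb. Qed.
Lemma cv_d_zetab F : convergent4 F -> convergent4 (d_zetab F).
Proof. apply cv_der; intros; now apply nrm_d_zetab. Qed.

Lemma Cmod_small e k P : 0 < e -> (forall t, 0 < t < e -> Cmod P <= t * k) -> P = 0.
Proof.
  intros He G. apply Cmod_eq_0. apply Rle_antisym; [|apply Cmod_ge_0].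
  apply le_epsilon; intros eps Heps. rewrite Rplus_0_l.
  assert (Hk : 0 <= k).
  { specialize (G (e / 2) ltac:(lra)). generalize (Cmod_ge_0 P). nra. }
  set (x := Rmin (e / 2) (eps / (k + 1))).
  assert (E1 : 0 < eps / (k + 1)) by (apply Rdiv_lt_0_compat; lra).
  assert (P1 := Rmin_l (e / 2) (eps / (k + 1))). assert (P2 := Rmin_r (e / 2) (eps / (k + 1))).
  assert (P3 : 0 < x) by (apply Rmin_pos; lra). fold x in P1, P2.
  eapply Rle_trans; [apply (G x); lra|].
  apply Rle_trans with (eps / (k + 1) * (k + 1)); [|right; field; lra].
  apply Rmult_le_compat; lra.
Qed.

(** Letting x tend to 0 kills the constant coefficient; what remains is divided by x, whence the
    restriction to x > 0. *)
Lemma poly_coef_zero rho K : 0 < rho -> forall c,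
  (forall x : R, 0 < x < rho -> csum (fun n => (c n * Cpow (RtoC x) n)%C) K = 0) ->
  forall n, (n < K)%nat -> c n = 0.
Proof.
  intros Hr. induction K as [|K IH]; intros c H n Hn; [lia|].
  assert (E : forall x, csum (fun n => (c n * Cpow x n)%C) (S K) =
    Cplus (c 0%nat) (Cmult x (csum (fun n => (c (S n) * Cpow x n)%C) K))).
  { intros x. rewrite (csum_gsum _ (S K)), gsum_head.
    change (Cplus (c 0%nat * 1)%C (csum (fun i => (c (S i) * (x * Cpow x i))%C) K)
      = Cplus (c 0%nat) (Cmult x (csum (fun n => (c (S n) * Cpow x n)%C) K))).
    rewrite Cmult_1_r. f_equal. rewrite (csum_gsum _ K).
    etransitivity; [|apply (gsum_mull Cr)]. apply csum_ext; intros; cbn; ring. }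
  assert (H0 : c 0%nat = 0).
  { set (M := rsum (fun n => Cmod (c (S n)) * rho ^ n) K).
    assert (HM : 0 <= M) by (apply rsum_ge0; intros; apply Rmult_le_pos; [apply Cmod_ge_0|apply pow_le; lra]).
    apply (Cmod_small rho M); [exact Hr|]. intros x Hx. specialize (H x Hx). rewrite E in H.
      replace (c 0%nat) with (Copp (Cmult (RtoC x) (csum (fun n => (c (S n) * Cpow (RtoC x) n)%C) K))).
      - rewrite Cmod_opp, Cmod_mult, Cmod_R, Rabs_pos_eq by lra.
        apply Rmult_le_compat_l; [lra|]. eapply Rle_trans; [apply csum_Cmod|].
        apply rsum_le; intros i _. rewrite Cmod_mult.
        apply Rmult_le_compat_l; [apply Cmod_ge_0|]. apply Cmod_pow_le.
        rewrite Cmod_R, Rabs_pos_eq; lra.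
      - rewrite <- (Cplus_0_l (- _)%C), <- H. ring. }
  destruct n as [|n]; [exact H0|].
  apply (IH (fun n => c (S n))); [|lia].
  intros x Hx. specialize (H x Hx). rewrite E, H0, Cplus_0_l in H.
  assert (Hx0 : RtoC x <> 0) by (intros Q; apply RtoC_inj in Q; lra).
  destruct (Ceq_dec (csum (fun n => (c (S n) * Cpow (RtoC x) n)%C) K) (RtoC 0)) as [Q|Q]; [exact Q|].
  exfalso. now apply (Cmult_neq_0 _ _ Hx0 Q).
Qed.

(** * The identity theorem *)

Lemma csum_swap f n m : csum (fun i => csum (fun j => f i j) m) n = csum (fun j => csum (fun i => f i j) n) m.
Proof. apply (gsum_swap Cr). Qed.

Lemma csum_mulr f x n : csum (fun i => (f i * x)%C) n = (csum f n * x)%C.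
Proof. apply (gsum_mulr Cr). Qed.

Definition homog (n : nat) (F : coef4) : coef4 :=
  fun a b c d => if (a + b + c + d =? n)%nat then F a b c d else RtoC 0.

Lemma Cpow_mult_l x y n : Cpow (x * y)%C n = (Cpow x n * Cpow y n)%C.
Proof. induction n as [|n IH]; cbn; [|rewrite IH]; ring. Qed.

Lemma evalF_sums s B F z zeta : Cmod z <= s -> Cmod zeta <= s -> bnd s B F ->
  sums_to z zeta (Cconj z) (Cconj zeta) s F (evalF F z zeta).
Proof.
  intros Hz Hze HB. apply sums_to_intro with B; rewrite ?Cmod_conj; assumption.
Qed.

Lemma psum4_coef_zero rho K F : 0 < rho ->
  (forall x1 x2 x3 x4 : R, 0 < x1 < rho -> 0 < x2 < rho -> 0 < x3 < rho -> 0 < x4 < rho ->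
     psum4 F (RtoC x1) (RtoC x2) (RtoC x3) (RtoC x4) K = 0) ->
  forall a b c d, (a < K)%nat -> (b < K)%nat -> (c < K)%nat -> (d < K)%nat -> F a b c d = 0.
Proof.
  intros Hr H a b c d Ha Hb Hc Hd. set (Z := poly_coef_zero rho K Hr).
  refine (Z (fun d => F a b c d) _ d Hd). intros x4 H4.
  refine (Z (fun c => csum (fun d => (F a b c d * Cpow (RtoC x4) d)%C) K) _ c Hc). intros x3 H3.
  refine (Z (fun b => csum (fun c => Cmult (csum (fun d => (F a b c d * Cpow (RtoC x4) d)%C) K)
    (Cpow (RtoC x3) c)) K) _ b Hb). intros x2 H2.
  refine (Z (fun a => csum (fun b => Cmult (csum (fun c => Cmult (csum (fun d => (F a b c d * Cpow (RtoC x4)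
    d)%C) K) (Cpow (RtoC x3) c)) K) (Cpow (RtoC x2) b)) K) _ a Ha). intros x1 H1.
  rewrite <- (H x1 x2 x3 x4 H1 H2 H3 H4). unfold psum4.
  apply csum_ext; intros i _. rewrite <- csum_mulr.
  apply csum_ext; intros j _. rewrite <- !csum_mulr.
  apply csum_ext; intros k _. rewrite <- !csum_mulr.
  apply csum_ext; intros l _. ring.
Qed.

(** Induction on the order: if [F] has order n, scaling the point by t multiplies the degree-n part
    by t^n while the rest is O(t^(n+1)). That part thus vanishes at all small positive points, and
    being a polynomial it is zero. *)
Lemma real_identity F s B : 0 < s -> bnd s B F ->
  (exists r, 0 < r /\ forall x1 x2 x3 x4 : R, 0 < x1 < r -> 0 < x2 < r -> 0 < x3 < r -> 0 < x4 < r ->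
    eval4 F (RtoC x1) (RtoC x2) (RtoC x3) (RtoC x4) = 0) -> F = zero4.
Proof.
  intros Hs HB (r & Hr & HE). apply eqm_eq.
  assert (HO : forall n, ord n F); [|intros n; exact (HO n)].
  induction n as [|n IH]; [apply ord_any|].
  set (rho := Rmin s r).
  assert (Q1 := Rmin_l s r). assert (Q2 := Rmin_r s r).
  assert (Hrho : 0 < rho) by now apply Rmin_pos. fold rho in Q1, Q2.
  assert (OD : ord (S n) (F - homog n F)%s4).
  { intros a b c d L. rewrite sub4E. unfold homog. destruct (Nat.eqb_spec (a + b + c + d) n).
    - ring.
    - rewrite IH by lia. ring. }
  assert (BD : bnd s (1 * B) (F - homog n F)%s4).
  { intros N. eapply Rle_trans; [apply nrm_le with (k := 1) (G := F); [lra|]|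
      apply Rmult_le_compat_l; [lra|apply HB]].
    intros a b c d. rewrite sub4E. unfold homog. destruct (a + b + c + d =? n)%nat.
    - replace (_ - _)%C with (RtoC 0) by ring. rewrite Cmod_0.
      generalize (Cmod_ge_0 (F a b c d)); lra.
    - replace (_ - _)%C with (F a b c d) by ring. lra. }
  assert (HP : forall x1 x2 x3 x4 : R, 0 < x1 < rho -> 0 < x2 < rho -> 0 < x3 < rho -> 0 < x4 < rho ->
     psum4 (homog n F) (RtoC x1) (RtoC x2) (RtoC x3) (RtoC x4) (S n) = 0).
  { intros x1 x2 x3 x4 H1 H2 H3 H4. set (P := psum4 _ _ _ _ _ _).
    set (k := (rho / s) ^ S n * (1 * B)).
    assert (G : forall t, 0 < t < 1 -> Cmod P <= t * k).
    { intros t Ht.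
      assert (Lt : 0 <= t * rho <= s) by nra. assert (Lr : t * rho < rho) by nra.
      assert (BF : bnd (t * rho) B F) by (apply (bnd_radius _ s); auto).
      assert (BD' : bnd (t * rho) ((t * rho / s) ^ S n * (1 * B)) (F - homog n F)%s4)
        by (apply bnd_ord; auto).
      assert (M : forall x, 0 < x < rho -> Cmod (RtoC (t * x)) <= t * rho)
        by (intros x Hx; rewrite Cmod_R, Rabs_pos_eq; nra).
      assert (SF := sums_to_intro _ _ _ _ _ (M _ H1) (M _ H2) (M _ H3) (M _ H4) _ _ BF).
      rewrite HE in SF by nra.
      assert (SD := sums_to_intro _ _ _ _ _ (M _ H1) (M _ H2) (M _ H3) (M _ H4) _ _ BD').
      assert (SH := sums_to_sub _ _ _ _ _ (M _ H1) (M _ H2) (M _ H3) (M _ H4) _ _ _ _ SF SD).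
      replace (F - (F - homog n F))%s4 with (homog n F) in SH by ring.
      assert (SK : sums_to (RtoC (t * x1)) (RtoC (t * x2)) (RtoC (t * x3)) (RtoC (t * x4)) (t * rho) (homog n
        F)
        (RtoC (t ^ n) * P)%C).
      { replace (RtoC (t ^ n) * P)%C with
          (psum4 (homog n F) (RtoC (t * x1)) (RtoC (t * x2)) (RtoC (t * x3)) (RtoC (t * x4)) (S n)).
        - destruct (proj1 SH) as [B' HB']. apply sums_to_stable with B'; auto.
          intros a b c d L. unfold homog. destruct (Nat.eqb_spec (a + b + c + d) n); [lia|reflexivity].
        - unfold P, psum4. rewrite Cmult_comm.
          rewrite <- csum_mulr. apply csum_ext; intros a _. rewrite <- csum_mulr. apply csum_ext; intros b _.
          rewrite <- csum_mulr. apply csum_ext; intros c _. rewrite <- csum_mulr. apply csum_ext; intros d _.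
          unfold homog. destruct (Nat.eqb_spec (a + b + c + d) n) as [<-|_]; [|ring].
          rewrite !RtoC_mult, !Cpow_mult_l, RtoC_pow, !Cpow_plus. ring. }
      assert (V := Clim_unique _ _ _ (proj2 SK) (proj2 SH)).
      assert (BB := sums_to_bound _ _ _ _ _ (M _ H1) (M _ H2) (M _ H3) (M _ H4) _ _ _ SD BD').
      assert (E : Cmod (RtoC (t ^ n) * P)%C <= (t * rho / s) ^ S n * (1 * B)).
      { rewrite V. match goal with |- Cmod (_ - ?v)%C <= _ => replace (0 - v)%C with (- v)%C by ring end.
        now rewrite Cmod_opp. }
      assert (Pt : 0 < t ^ n) by (apply pow_lt; lra).
      rewrite Cmod_mult, Cmod_R, Rabs_pos_eq in E by lra.
      replace ((t * rho / s) ^ S n * (1 * B)) with (t ^ n * (t * k)) in E.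
      + now apply Rmult_le_reg_l in E.
      + unfold k. replace (t * rho / s) with (t * (rho / s)) by (field; lra).
        rewrite Rpow_mult_distr. cbn [pow]. ring. }
    apply (Cmod_small 1 k P); [lra|exact G]. }
  intros a b c d L. destruct (Nat.eq_dec (a + b + c + d) n) as [E|E]; [|apply IH; lia].
  assert (Z := psum4_coef_zero rho (S n) (homog n F) Hrho HP a b c d ltac:(lia) ltac:(lia) ltac:(lia)
    ltac:(lia)).
  unfold homog in Z. apply Nat.eqb_eq in E. now rewrite E in Z.
Qed.

(* In the coordinates [z = x1 + i x2], [zeta = x3 + i x4] the points where the last two arguments
   are the conjugates of the first two are the real points. *)
Theorem identity_theorem F : convergent4 F ->
  (exists r, 0 < r /\ forall z zeta, Cmod z < r -> Cmod zeta < r -> evalF F z zeta = 0) ->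
  F = zero4.
Proof.
  intros HF (r & Hr & HE). apply convergent4E in HF. destruct HF as (s & B & Hs & HB).
  set (y := fun (e : C) (x x' : coef4) => (x + cst e * x')%s4).
  set (K := comp F (y Ci X1 X2) (y Ci X3 X4) (y (- Ci)%C X1 X2) (y (- Ci)%C X3 X4)).
  assert (TN := nrm_tnorm (s / 2) ltac:(lra)).
  assert (O : forall e x x', ord 1 x -> ord 1 x' -> ord 1 (y e x x'))
    by (intros; apply ord_add; [assumption|apply (ord_mul 0 1); auto using ord_any]).
  assert (OX : ord 1 X1 /\ ord 1 X2 /\ ord 1 X3 /\ ord 1 X4).
  { repeat split; intros [|i] [|j] [|k] [|l] L; try reflexivity; lia. }
  destruct OX as (O1 & O2 & O3 & O4).
  assert (NX := fun N => nrm_X (s / 2) N ltac:(lra)).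
  assert (BY : forall e x x', Cmod e = 1 -> bnd (s / 2) (s / 2) x -> bnd (s / 2) (s / 2) x' -> bnd (s / 2) s
    (y e x x')).
  { intros e x x' He H H' N. eapply Rle_trans; [apply (tn_add R4 _ TN)|].
    assert (Q := tn_mul R4 _ TN N (cst e) x'). assert (Q' := cst_nrm (s / 2) N e ltac:(lra)).
      rewrite He in Q'.
    assert (Q3 := tn_ge0 R4 _ TN N x'). specialize (H N). specialize (H' N).
    change (cmul R4) with mul4 in Q. nra. }
  assert (MI : Cmod (- Ci)%C = 1) by (rewrite Cmod_opp; apply Cmod_Ci).
  assert (EV : forall x1 x2 x3 x4, Cmod x1 <= s / 2 -> Cmod x2 <= s / 2 -> Cmod x3 <= s / 2 -> Cmod x4 <= s /
    2 ->
    sums_to x1 x2 x3 x4 (s / 2) K (eval4 F (x1 + Ci * x2)%C (x3 + Ci * x4)%C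
      (x1 + - Ci * x2)%C (x3 + - Ci * x4)%C)).
  { intros x1 x2 x3 x4 L1 L2 L3 L4.
    destruct (sums_to_X x1 x2 x3 x4 _ L1) as (S1 & S2 & S3 & S4).
    assert (SY : forall e x x' v v', sums_to x1 x2 x3 x4 (s / 2) x v -> sums_to x1 x2 x3 x4 (s / 2) x' v' ->
      eval4 (y e x x') x1 x2 x3 x4 = (v + e * v')%C).
    { intros. apply sums_to_eval with (s := s / 2). apply sums_to_add; auto.
      apply sums_to_mul; auto. now apply sums_to_cst. }
    rewrite <- (SY Ci _ _ _ _ S1 S2), <- (SY Ci _ _ _ _ S3 S4), <- (SY (- Ci)%C _ _ _ _ S1 S2), <- (SY (-
      Ci)%C _ _ _ _ S3 S4).
    apply eval4_comp with (r := s) (B := B); auto; apply BY; auto using Cmod_Ci; intros N; apply NX. }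
  assert (KZ : K = zero4).
  { destruct (EV (RtoC 0) (RtoC 0) (RtoC 0) (RtoC 0)) as [[B' HB'] _]; try (rewrite Cmod_0; lra).
    apply (real_identity K (s / 2) B'); [lra|exact HB'|].
    exists (Rmin (r / 2) (s / 2)). split; [apply Rmin_pos; lra|].
    generalize (Rmin_l (r / 2) (s / 2)) (Rmin_r (r / 2) (s / 2)). intros Q1 Q2 x1 x2 x3 x4 H1 H2 H3 H4.
    assert (M : forall x, 0 < x < Rmin (r / 2) (s / 2) -> Cmod (RtoC x) <= s / 2)
      by (intros x Hx; rewrite Cmod_R, Rabs_pos_eq; lra).
    rewrite (sums_to_eval _ _ _ _ _ _ _ (EV _ _ _ _ (M _ H1) (M _ H2) (M _ H3) (M _ H4))).
    assert (CJ : forall a b : R, (RtoC a + - Ci * RtoC b)%C = Cconj (RtoC a + Ci * RtoC b)%C)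
      by (intros; apply injective_projections; unfold Cconj, Cplus, Cmult, Copp, Ci, RtoC; cbn; ring).
    assert (CL : forall a b, 0 < a < Rmin (r / 2) (s / 2) -> 0 < b < Rmin (r / 2) (s / 2) ->
      Cmod (RtoC a + Ci * RtoC b)%C < r).
    { intros a b Ha Hb. eapply Rle_lt_trans; [apply Cmod_triangle|].
      rewrite Cmod_mult, !Cmod_R, Cmod_Ci, !Rabs_pos_eq by lra. lra. }
    rewrite !CJ. apply HE; now apply CL. }
  apply (real_identity F s B Hs HB). exists (s / 2). split; [lra|]. intros x1 x2 x3 x4 H1 H2 H3 H4.
  set (h := RtoC (/ 2)).
  assert (HH : (h + h)%C = 1) by (unfold h; rewrite <- RtoC_plus; f_equal; lra).
  assert (II : (Ci * Ci)%C = (- RtoC 1)%C) by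
    (apply injective_projections; unfold Cmult, Copp, Ci, RtoC; cbn; ring).
  assert (Mh : Cmod h = / 2) by (unfold h; rewrite Cmod_R, Rabs_pos_eq; lra).
  assert (M : forall (e : C) (a b : R), Cmod e = 1 -> 0 < a < s / 2 -> 0 < b < s / 2 ->
    Cmod (h * (RtoC a + e * RtoC b))%C <= s / 2).
  { intros e a b He Ha Hb. rewrite Cmod_mult, Mh.
    assert (Q := Cmod_triangle (RtoC a) (e * RtoC b)%C).
    rewrite Cmod_mult, He, !Cmod_R, !Rabs_pos_eq in Q by lra. lra. }
  assert (M1 : Cmod (RtoC 1) = 1) by apply Cmod_1.
  assert (M2 : Cmod (- RtoC 1)%C = 1) by now rewrite Cmod_opp.
  (* The linear change is undone: p = (a + b) / 2 and q = (a - b) / (2i) are sent to a and b. They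
     are not both real in general, so [K] must vanish as a series and not merely at real points. *)
  set (p := fun a b : R => (h * (RtoC a + 1 * RtoC b))%C).
  set (q := fun a b : R => (- Ci * (h * (RtoC a + - RtoC 1 * RtoC b)))%C).
  assert (Q1 : forall a b, (p a b + Ci * q a b)%C = RtoC a).
  { intros a b. unfold p, q. transitivity (h * (RtoC a + RtoC b) + - (Ci * Ci) * (h * (RtoC a - RtoC b)))%C;
    [ring|]. rewrite II.
    transitivity ((h + h) * RtoC a)%C; [ring|]. rewrite HH. ring. }
  assert (Q2 : forall a b, (p a b + - Ci * q a b)%C = RtoC b).
  { intros a b. unfold p, q. transitivity (h * (RtoC a + RtoC b) + Ci * Ci * (h * (RtoC a - RtoC b)))%C;
    [ring|]. rewrite II.
    transitivity ((h + h) * RtoC b)%C; [ring|]. rewrite HH. ring. }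
  assert (L : forall a b, 0 < a < s / 2 -> 0 < b < s / 2 -> Cmod (p a b) <= s / 2 /\ Cmod (q a b) <= s / 2).
  { intros a b Ha Hb. split; [now apply M|]. unfold q. rewrite Cmod_mult, MI, Rmult_1_l. now apply M. }
  destruct (L x1 x3 H1 H3) as [L1 L2]. destruct (L x2 x4 H2 H4) as [L3 L4].
  assert (S := EV _ _ _ _ L1 L2 L3 L4). rewrite !Q1, !Q2 in S.
  rewrite <- (sums_to_eval _ _ _ _ _ _ _ S), KZ, <- cst_0.
  apply sums_to_eval with (s := s / 2). now apply sums_to_cst.
Qed.

(** * Hermitian symmetry of real-valued series *)

Definition hermitian (F : coef4) : Prop := forall a b c d, F c d a b = Cconj (F a b c d).

(** The series of the complex conjugate function: conjugation also exchanges (z, zeta) with (zbar,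
    zetabar). *)
Definition star (F : coef4) : coef4 := fun a b c d => Cconj (F c d a b).

Lemma Cconj_0 : Cconj (RtoC 0) = 0.
Proof. apply injective_projections; unfold Cconj, RtoC; cbn; ring. Qed.
Lemma Cconj_R x : Cconj (RtoC x) = RtoC x.
Proof. apply injective_projections; unfold Cconj, RtoC; cbn; ring. Qed.

Lemma Cconj_csum f n : Cconj (csum f n) = csum (fun i => Cconj (f i)) n.
Proof.
  induction n as [|n IH]; cbn [csum].
  - apply Cconj_R.
  - now rewrite Cplus_conj, IH.
Qed.

Lemma Cconj_pow x n : Cconj (Cpow x n) = Cpow (Cconj x) n.
Proof.
  induction n as [|n IH]; cbn [Cpow].
  - apply Cconj_R.
  - now rewrite Cmult_conj, IH.
Qed.

Lemma psum4_star F z zeta z' zeta' N :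
  psum4 (star F) z zeta z' zeta' N = Cconj (psum4 F (Cconj z') (Cconj zeta') (Cconj z) (Cconj zeta) N).
Proof.
  unfold psum4, star.
  rewrite Cconj_csum.
  transitivity (csum (fun c => csum (fun d => csum (fun a => csum (fun b =>
    (Cconj (F c d a b) * (Cpow z a * Cpow zeta b * (Cpow z' c * Cpow zeta' d)))%C) N) N) N) N).
  - transitivity (csum (fun a => csum (fun c => csum (fun d => csum (fun b =>
    (Cconj (F c d a b) * (Cpow z a * Cpow zeta b * (Cpow z' c * Cpow zeta' d)))%C) N) N) N) N).
    + apply csum_ext; intros a _.
      rewrite (csum_swap (fun b c => csum _ N)). apply csum_ext; intros c _. apply csum_swap.
    + rewrite csum_swap. apply csum_ext; intros c _. apply csum_swap.
  - apply csum_ext; intros c _. rewrite Cconj_csum. apply csum_ext; intros d _.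
    rewrite Cconj_csum. apply csum_ext; intros a _. rewrite Cconj_csum. apply csum_ext; intros b _.
    rewrite !Cmult_conj, !Cconj_pow, !Cconj_conj. ring.
Qed.

Lemma rsum_swap f n m : rsum (fun i => rsum (fun j => f i j) m) n = rsum (fun j => rsum (fun i => f i j) n) m.
Proof. apply (gsum_swap Rr). Qed.

Lemma nrm_star s N F : nrm s N (star F) = nrm s N F.
Proof.
  rewrite !nrmE. unfold star.
  transitivity (rsum (fun c => rsum (fun d => rsum (fun a => rsum (fun b =>
    Cmod (F c d a b) * s ^ (c + d + a + b)) N) N) N) N).
  - transitivity (rsum (fun a => rsum (fun c => rsum (fun d => rsum (fun b =>
     Cmod (F c d a b) * s ^ (c + d + a + b)) N) N) N) N).
    + apply rsum_ext; intros a _.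
      rewrite (rsum_swap (fun b c => rsum _ N)). apply rsum_ext; intros c _.
      rewrite rsum_swap. do 2 (apply rsum_ext; intros). rewrite Cmod_conj. do 2 f_equal. lia.
    + rewrite rsum_swap. apply rsum_ext; intros c _. apply rsum_swap.
  - reflexivity.
Qed.

Lemma sums_to_star z zeta s F v : sums_to z zeta (Cconj z) (Cconj zeta) s F v ->
  sums_to z zeta (Cconj z) (Cconj zeta) s (star F) (Cconj v).
Proof.
  intros [[B HB] H]. split; [exists B; intros N; now rewrite nrm_star|].
  eapply Clim_ext; [|exact (Clim_conj _ _ H)]. intros N; cbn -[ev].
  rewrite !evE, psum4_star, !Cconj_conj. reflexivity.
Qed.

(** [F - star F] takes the value 2i Im F, which is zero near the origin, so the identity theorem
    applies to it. *)
Lemma hermitian_of_real F : convergent4 F -> real_valued F -> hermitian F.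
Proof.
  intros HF (r & Hr & HI).
  assert (HC := HF). apply convergent4E in HF. destruct HF as (s & B & Hs & HB).
  assert (HS : convergent4 (star F)).
  { apply convergent4E. exists s, B; split; [exact Hs|]. intros N. now rewrite nrm_star. }
  assert (Z : (F - star F)%s4 = zero4).
  { apply identity_theorem; [now apply cv_sub|].
    exists (Rmin r s). split; [now apply Rmin_pos|]. intros z zeta Hz Hze.
    assert (Q1 := Rmin_l r s). assert (Q2 := Rmin_r r s).
    assert (S1 := evalF_sums s B F z zeta ltac:(lra) ltac:(lra) HB).
    assert (S2 := sums_to_star _ _ _ _ _ S1).
    assert (L1 : Cmod z <= s) by lra. assert (L2 : Cmod zeta <= s) by lra.
    assert (L3 : Cmod (Cconj z) <= s) by now rewrite Cmod_conj.
    assert (L4 : Cmod (Cconj zeta) <= s) by now rewrite Cmod_conj.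
    assert (SD := sums_to_sub _ _ _ _ _ L1 L2 L3 L4 _ _ _ _ S1 S2).
    unfold evalF. rewrite (sums_to_eval _ _ _ _ _ _ _ SD).
    specialize (HI z zeta ltac:(lra) ltac:(lra)).
    destruct (evalF F z zeta) as [x y]. cbn in HI. subst y.
    apply injective_projections; unfold Cconj, RtoC, Cminus, Cplus, Copp; cbn; ring. }
  intros a b c d.
  assert (E : F c d a b = star F c d a b).
  { assert (T := equal_f (equal_f (equal_f (equal_f Z c) d) a) b). rewrite sub4E in T.
    change ((F c d a b - star F c d a b)%C = 0) in T.
    replace (F c d a b) with (F c d a b - star F c d a b + star F c d a b)%C by ring.
    rewrite T. ring. }
  exact E.
Qed.

(** * Holomorphic series and their inverses *)

Lemma cv_X : convergent4 X1 /\ convergent4 X2 /\ convergent4 X3 /\ convergent4 X4.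
Proof.
  assert (N := fun N => nrm_X 1 N ltac:(lra)).
  repeat split; apply convergent4E; exists 1, 1; (split; [lra|]); intros M; apply N.
Qed.

Opaque mul4 comp fsum.

Definition hol (F : coef4) : Prop := forall a b c d, (0 < c + d)%nat -> F a b c d = 0.

Lemma RtoC_INR_S n : RtoC (INR (S n)) <> 0.
Proof. intros H; apply RtoC_inj in H. generalize (S_INR n) (pos_INR n); lra. Qed.

Lemma Cmult_eq_0_l k x : k <> RtoC 0 -> (k * x)%C = 0 -> x = RtoC 0.
Proof.
  intros Hk H. destruct (Ceq_dec x (RtoC 0)) as [Q|Q]; [exact Q|].
  exfalso; now apply (Cmult_neq_0 _ _ Hk Q).
Qed.

(** The Cauchy-Riemann form of [hol], from which stability under composition follows by the chain
    rule. *)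
Lemma hol_der F : hol F <-> d_zb F = zero4 /\ d_zetab F = zero4.
Proof.
  split.
  - intros H; split; apply coef4_ext; intros a b c d; unfold d_zb, d_zetab;
      rewrite H by lia; apply Cmult_0_r.
  - intros [H3 H4] a b c d L. destruct c as [|c].
    + destruct d as [|d]; [lia|].
      apply (Cmult_eq_0_l _ _ (RtoC_INR_S d)). exact (equal_f (equal_f (equal_f (equal_f H4 a) b) 0%nat) d).
    + apply (Cmult_eq_0_l _ _ (RtoC_INR_S c)). exact (equal_f (equal_f (equal_f (equal_f H3 a) b) c) d).
Qed.

Lemma der4_zero D : der4 D -> D zero4 = zero4.
Proof. intros H. rewrite <- cst_0 at 1. apply (der_cst _ H). Qed.

(** For holomorphic [F] the two zeros are harmless placeholders, and they keep the composite
    holomorphic. *)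
Definition hcomp (F y1 y2 : coef4) : coef4 := comp F y1 y2 zero4 zero4.

Lemma hcomp_chain D F y1 y2 : ord 1 y1 -> ord 1 y2 -> der4 D ->
  D (hcomp F y1 y2) = (hcomp (d_z F) y1 y2 * D y1 + hcomp (d_zeta F) y1 y2 * D y2)%s4.
Proof.
  intros H1 H2 HD. unfold hcomp. rewrite comp_chain by (auto using ord_zero).
  rewrite (der4_zero _ HD). ring.
Qed.

Lemma hol_hcomp F y1 y2 : ord 1 y1 -> ord 1 y2 -> hol y1 -> hol y2 -> hol (hcomp F y1 y2).
Proof.
  rewrite !hol_der. intros O1 O2 [A1 B1] [A2 B2].
  split; [rewrite (hcomp_chain _ _ _ _ O1 O2 d_zb_der), A1, A2|
          rewrite (hcomp_chain _ _ _ _ O1 O2 d_zetab_der), B1, B2]; ring.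
Qed.

Lemma hol_sub F G : hol F -> hol G -> hol (F - G)%s4.
Proof. intros H1 H2 a b c d L. rewrite sub4E, H1, H2 by exact L. ring. Qed.
Lemma hol_scal k F : hol F -> hol (cst k * F)%s4.
Proof. intros H a b c d L. rewrite cst_mulE, H by exact L. ring. Qed.

Lemma hol_X1 : hol X1.
Proof. intros a b c d L. rewrite X1E. destruct a as [|[|a]], b, c, d; try reflexivity; lia. Qed.
Lemma hol_X2 : hol X2.
Proof. intros a b c d L. rewrite X2E. destruct a, b as [|[|b]], c, d; try reflexivity; lia. Qed.
Lemma ord_X1 : ord 1 X1.
Proof. intros a b c d L. rewrite X1E. destruct a; [reflexivity|lia]. Qed.
Lemma ord_X2 : ord 1 X2.
Proof. intros a b c d L. rewrite X2E. destruct a, b; try reflexivity; lia. Qed.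

Definition o4 (F : coef4) : C := (F 0 0 0 0)%nat.
Lemma o4_mul F G : o4 (F * G)%s4 = (o4 F * o4 G)%C.
Proof. unfold o4. rewrite mul4E. cbn. ring. Qed.
Lemma o4_add F G : o4 (F + G)%s4 = (o4 F + o4 G)%C.
Proof. reflexivity. Qed.
Lemma o4_hcomp F y1 y2 : o4 (hcomp F y1 y2) = o4 F.
Proof. exact (comp_0000 y1 y2 zero4 zero4 F). Qed.
Lemma ord1_o4 F : ord 1 F <-> o4 F = 0.
Proof.
  split; [intros H; apply H; lia|]. intros H a b c d L.
  destruct a, b, c, d; try lia. exact H.
Qed.
Lemma o4_d_z F : o4 (d_z F) = (F 1 0 0 0)%nat.
Proof. unfold o4, d_z. cbn [INR]. apply Cmult_1_l. Qed.
Lemma o4_d_zeta F : o4 (d_zeta F) = (F 0 1 0 0)%nat.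
Proof. unfold o4, d_zeta. cbn [INR]. apply Cmult_1_l. Qed.

Definition jac (f g : coef4) : C :=
  (o4 (d_z f) * o4 (d_zeta g) - o4 (d_zeta f) * o4 (d_z g))%C.

Lemma jac_hcomp f g y1 y2 : ord 1 y1 -> ord 1 y2 ->
  jac (hcomp f y1 y2) (hcomp g y1 y2) = (jac f g * jac y1 y2)%C.
Proof.
  intros O1 O2. unfold jac.
  rewrite !(hcomp_chain d_z) by (auto using d_z_der).
  rewrite !(hcomp_chain d_zeta) by (auto using d_zeta_der).
  rewrite !o4_add, !o4_mul, !o4_hcomp. ring.
Qed.

Lemma d_z_X1 : d_z X1 = one4.
Proof.
  rewrite <- cst_1. apply coef4_ext; intros a b c d. unfold d_z. rewrite X1E, cstE.
  destruct a, b, c, d; cbn [INR]; ring.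
Qed.
Lemma d_zeta_X1 : d_zeta X1 = zero4.
Proof.
  rewrite <- cst_0. apply coef4_ext; intros a b c d. unfold d_zeta. rewrite X1E, cstE.
  destruct a as [|[|a]], b, c, d; ring.
Qed.
Lemma d_z_X2 : d_z X2 = zero4.
Proof.
  rewrite <- cst_0. apply coef4_ext; intros a b c d. unfold d_z. rewrite X2E, cstE.
  destruct a, b as [|[|b]], c, d; ring.
Qed.
Lemma d_zeta_X2 : d_zeta X2 = one4.
Proof.
  rewrite <- cst_1. apply coef4_ext; intros a b c d. unfold d_zeta. rewrite X2E, cstE.
  destruct a, b, c, d; cbn [INR]; ring.
Qed.

Lemma jac_X : jac X1 X2 = 1.
Proof.
  unfold jac. rewrite d_z_X1, d_zeta_X1, d_z_X2, d_zeta_X2.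
  change ((1 * 1 - 0 * 0)%C = 1). ring.
Qed.

Lemma small_bnd y r : convergent4 y -> ord 1 y -> 0 < r -> exists s, 0 < s /\ bnd s r y.
Proof.
  intros Hy Ho Hr. apply convergent4E in Hy. destruct Hy as (s & B & Hs & HB).
  assert (B0 := bnd_ge0 s B y ltac:(lra) HB).
  set (t := Rmin s (s * r / (B + 1))).
  assert (T1 := Rmin_l s (s * r / (B + 1))). assert (T2 := Rmin_r s (s * r / (B + 1))).
  assert (T0 : 0 < t) by (apply Rmin_pos; [lra|apply Rdiv_lt_0_compat; nra]).
  fold t in T1, T2. exists t; split; [exact T0|]. intros N.
  eapply Rle_trans; [apply (bnd_ord t s 1 B); auto; lra|].
  rewrite pow_1. apply Rmult_le_compat_r with (r := (B + 1) / s) in T2.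
  - replace (s * r / (B + 1) * ((B + 1) / s)) with r in T2 by (field; lra).
    replace (t * ((B + 1) / s)) with (t / s * B + t / s) in T2 by (field; lra).
    assert (0 < t / s) by (apply Rdiv_lt_0_compat; lra). lra.
  - apply Rlt_le, Rdiv_lt_0_compat; lra.
Qed.

Section FixedPoint.
Variables p1 p2 r1 r2 : coef4.
Hypotheses (cp1 : convergent4 p1) (cp2 : convergent4 p2) (cr1 : convergent4 r1) (cr2 : convergent4 r2)
  (hp1 : hol p1) (hp2 : hol p2) (op1 : ord 1 p1) (op2 : ord 1 p2) (or1 : ord 2 r1) (or2 : ord 2 r2).

(** Iteration for y = p - r(y), started at 0. As [r1] and [r2] have order 2, every step adds one
    degree of agreement, so the n-th iterate is correct below degree n + 1. *)
Let step (y : coef4 * coef4) :=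
  ((p1 - hcomp r1 (fst y) (snd y))%s4, (p2 - hcomp r2 (fst y) (snd y))%s4).

Fixpoint iterate (n : nat) : coef4 * coef4 :=
  match n with O => (zero4, zero4) | S m => step (iterate m) end.

Let iterate_S n : iterate (S n) = step (iterate n).
Proof. reflexivity. Qed.

Let iterate_ord n : ord 1 (fst (iterate n)) /\ ord 1 (snd (iterate n)).
Proof.
  induction n as [|n [I1 I2]]; [split; apply ord_zero|]. rewrite iterate_S.
  split; (apply ord_sub; [assumption|]); apply (ord_le 2); try lia; apply comp_ord; auto using ord_zero.
Qed.

Let step_contr k y y' : ord 1 (fst y) /\ ord 1 (snd y) -> ord 1 (fst y') /\ ord 1 (snd y') ->
  eqm (S k) (fst y) (fst y') /\ eqm (S k) (snd y) (snd y') ->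
  eqm (S (S k)) (fst (step y)) (fst (step y')) /\ eqm (S (S k)) (snd (step y)) (snd (step y')).
Proof.
  intros [O1 O2] [O1' O2'] [E1 E2].
  assert (G : forall p r, ord 2 r ->
    eqm (S (S k)) (p - hcomp r (fst y) (snd y))%s4 (p - hcomp r (fst y') (snd y'))%s4).
  { intros p r Hr a b c d L. rewrite !sub4E. f_equal. revert a b c d L.
    change (eqm (S (S k)) (hcomp r (fst y) (snd y)) (hcomp r (fst y') (snd y'))).
    replace (S (S k)) with (k + 2)%nat by lia.
    apply ord_sub_eqm, comp_contr; auto using ord_zero, eqm_refl. }
  split; now apply G.
Qed.

Let iterate_le n m : (n <= m)%nat -> eqm (S n) (fst (iterate n)) (fst (iterate m)) /\
  eqm (S n) (snd (iterate n)) (snd (iterate m)).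
Proof.
  revert m; induction n as [|n IH]; intros m L.
  - destruct (iterate_ord m) as [H1 H2].
    split; intros i j k l Q; [now rewrite H1 by lia|now rewrite H2 by lia].
  - destruct m as [|m]; [lia|]. rewrite !iterate_S.
    apply step_contr; [apply iterate_ord..|apply IH; lia].
Qed.

(** The formal limit: a coefficient of total degree n is already final in the n-th iterate. *)
Let y1 : coef4 := fun i j k l => fst (iterate (i + j + k + l)) i j k l.
Let y2 : coef4 := fun i j k l => snd (iterate (i + j + k + l)) i j k l.

Let y_iterate n : eqm (S n) y1 (fst (iterate n)) /\ eqm (S n) y2 (snd (iterate n)).
Proof.
  split; intros i j k l L; destruct (iterate_le (i + j + k + l) n ltac:(lia)) as [H1 H2];
  [apply H1|apply H2]; lia.
Qed.

Let y_ord : ord 1 y1 /\ ord 1 y2.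
Proof.
  destruct (y_iterate 0) as [E1 E2].
  split; intros i j k l L; [rewrite E1 by lia|rewrite E2 by lia]; reflexivity.
Qed.

Let y_fix : y1 = (p1 - hcomp r1 y1 y2)%s4 /\ y2 = (p2 - hcomp r2 y1 y2)%s4.
Proof.
  assert (Q : forall n, eqm (S (S n)) y1 (p1 - hcomp r1 y1 y2)%s4 /\ eqm (S (S n)) y2 (p2 - hcomp r2 y1
    y2)%s4).
  { intros n. destruct (y_iterate (S n)) as [A1 A2]. destruct (y_iterate n) as [B1 B2].
    rewrite iterate_S in A1, A2.
    destruct (step_contr n (iterate n) (y1, y2) (iterate_ord n) y_ord
      (conj (eqm_sym _ _ _ B1) (eqm_sym _ _ _ B2))) as [C1 C2].
    split; [exact (eqm_trans _ _ _ _ A1 C1)|exact (eqm_trans _ _ _ _ A2 C2)]. }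
  split; apply eqm_eq; intros n; apply (eqm_le (S (S n))); try lia; apply Q.
Qed.

Let iterate_hol n : hol (fst (iterate n)) /\ hol (snd (iterate n)).
Proof.
  induction n as [|n [I1 I2]]; [split; intros i j k l L; reflexivity|].
  destruct (iterate_ord n) as [O1 O2]. rewrite iterate_S.
  split; (apply hol_sub; [assumption|now apply hol_hcomp]).
Qed.

Let y_hol : hol y1 /\ hol y2.
Proof.
  split; intros i j k l L; destruct (iterate_hol (i + j + k + l)) as [A1 A2]; [now apply A1|now apply A2].
Qed.

Let y_cv : convergent4 y1 /\ convergent4 y2.
Proof.
  destruct (convergent4_common _ _ cr1 cr2) as (r & B & Hr & BF & BG).
  assert (HB := bnd_ge0 r B r1 ltac:(lra) BF).
  (* Chosen so that at radius [rho] the remainders, having order 2, have norm at most rho / 2. With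
     [p1] and [p2] bounded by rho / 2 at a small radius [s], all iterates stay in the ball of radius
     [rho]. *)
  set (rho := Rmin r (r * r / (2 * (B + 1)))).
  assert (P1 : 0 < rho) by (apply Rmin_pos; [lra|]; apply Rdiv_lt_0_compat; nra).
  assert (P2 := Rmin_l r (r * r / (2 * (B + 1)))). assert (P3 := Rmin_r r (r * r / (2 * (B + 1)))).
  fold rho in P2, P3.
  assert (He : (rho / r) ^ 2 * B <= rho / 2).
  { replace ((rho / r) ^ 2 * B) with (rho * (rho * B / (r * r))) by (field; lra).
    unfold Rdiv at 2. apply Rmult_le_compat_l; [lra|].
    apply Rmult_le_reg_r with (2 * (r * r)); [nra|].
    replace (rho * B / (r * r) * (2 * (r * r))) with (2 * (rho * B)) by (field; lra).
    apply Rmult_le_compat_r with (r := 2 * (B + 1)) in P3; [|lra].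
    replace (r * r / (2 * (B + 1)) * (2 * (B + 1))) with (r * r) in P3 by (field; lra). nra. }
  destruct (small_bnd p1 (rho / 2) cp1 op1 ltac:(lra)) as (s1 & Hs1 & B1).
  destruct (small_bnd p2 (rho / 2) cp2 op2 ltac:(lra)) as (s2 & Hs2 & B2).
  set (s := Rmin s1 s2). assert (Hs : 0 < s) by now apply Rmin_pos.
  apply (bnd_radius s) in B1; [|lra|split; [lra|apply Rmin_l]].
  apply (bnd_radius s) in B2; [|lra|split; [lra|apply Rmin_r]].
  assert (T := nrm_tnorm s ltac:(lra)).
  assert (Z : forall N, nrm s N zero4 <= rho) by (intros N; change zero4 with (c0 R4); rewrite (tn_0 R4 _ T);
    lra).
  assert (N : forall n, bnd s rho (fst (iterate n)) /\ bnd s rho (snd (iterate n))).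
  { induction n as [|n [I1 I2]]; [split; exact Z|].
    destruct (iterate_ord n) as [O1 O2].
    assert (Q : forall p h, ord 2 h -> bnd r B h -> bnd s (rho / 2) p ->
      bnd s rho (p - hcomp h (fst (iterate n)) (snd (iterate n)))%s4).
    { intros p h Oh Bh Bp N.
      assert (E := comp_nrm _ _ _ _ O1 O2 (ord_zero 1) (ord_zero 1) s rho N h ltac:(lra) (I1 N) (I2 N) (Z N)
        (Z N)).
      assert (E' := bnd_ord rho r 2 B h Hr ltac:(lra) Oh Bh (4 * N)%nat).
      eapply Rle_trans; [apply nrm_sub; lra|]. specialize (Bp N). unfold hcomp. lra. }
    rewrite iterate_S. split; now apply Q. }
  split; apply convergent4E; exists s, rho; (split; [exact Hs|]); intros M.
  - rewrite (nrm_eqm s M _ (fst (iterate (4 * M)))); [apply N|].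
    apply (eqm_le (S (4 * M))); [lia|]. apply y_iterate.
  - rewrite (nrm_eqm s M _ (snd (iterate (4 * M)))); [apply N|].
    apply (eqm_le (S (4 * M))); [lia|]. apply y_iterate.
Qed.

Lemma fixpoint_series : exists y1 y2, convergent4 y1 /\ convergent4 y2 /\ hol y1 /\ hol y2 /\
  ord 1 y1 /\ ord 1 y2 /\ y1 = (p1 - hcomp r1 y1 y2)%s4 /\ y2 = (p2 - hcomp r2 y1 y2)%s4.
Proof.
  exists y1, y2. generalize y_cv, y_hol, y_ord, y_fix. tauto.
Qed.
End FixedPoint.

Lemma ord2_linear_part h : ord 1 h -> hol h ->
  ord 2 (h - (cst (h 1 0 0 0)%nat * X1 + cst (h 0 1 0 0)%nat * X2))%s4.
Proof.
  intros Ho Hh i j k l L. rewrite sub4E, add4E, !cst_mulE, X1E, X2E.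
  destruct i as [|[|i]], j as [|[|j]], k as [|[|k]], l as [|[|l]]; try lia;
  try (rewrite (Ho 0 0 0 0)%nat by lia);
  try (rewrite (Hh 0 0 1 0)%nat by lia);
  try (rewrite (Hh 0 0 0 1)%nat by lia); ring.
Qed.

Lemma linear_solve (a b c d i h k x1 x2 y1 y2 : coef4) : (i * (a * d - b * c) = 1)%s4 ->
  y1 = (i * (d * x1 - b * x2) - i * (d * h - b * k))%s4 ->
  y2 = (i * (a * x2 - c * x1) - i * (a * k - c * h))%s4 ->
  (h + (a * y1 + b * y2) = x1)%s4 /\ (k + (c * y1 + d * y2) = x2)%s4.
Proof.
  intros I -> ->. split.
  - transitivity (h + (i * (a * d - b * c)) * (x1 - h))%s4; [|rewrite I]; ring.
  - transitivity (k + (i * (a * d - b * c)) * (x2 - k))%s4; [|rewrite I]; ring.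
Qed.

Theorem formal_inverse f g : convergent4 f -> convergent4 g -> hol f -> hol g ->
  ord 1 f -> ord 1 g -> jac f g <> 0 -> exists u1 u2 : coef4,
  convergent4 u1 /\ convergent4 u2 /\ hol u1 /\ hol u2 /\ ord 1 u1 /\ ord 1 u2 /\
  hcomp f u1 u2 = X1 /\ hcomp g u1 u2 = X2 /\ jac u1 u2 <> 0.
Proof.
  intros cf cg hf hg of og J.
  set (a := cst (f 1 0 0 0)%nat). set (b := cst (f 0 1 0 0)%nat).
  set (c := cst (g 1 0 0 0)%nat). set (d := cst (g 0 1 0 0)%nat). set (i := cst (Cinv (jac f g))).
  assert (I : (i * (a * d - b * c) = 1)%s4).
  { unfold i, a, b, c, d. rewrite <- !cst_mul.
    transitivity (cst (Cinv (jac f g)) * cst (jac f g))%s4.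
    - f_equal. unfold jac. rewrite !o4_d_z, !o4_d_zeta. unfold Cminus. rewrite cst_add, cst_opp. ring.
    - rewrite <- cst_mul, Cinv_l, cst_1 by exact J. reflexivity. }
  (* With L the linear part of (f, g), the equation (f, g)(y) = x becomes y = L^(-1) x - L^(-1) (ft,
     gt)(y). This is the fixed-point form, because [ft] and [gt] have order 2. *)
  set (ft := (f - (a * X1 + b * X2))%s4). set (gt := (g - (c * X1 + d * X2))%s4).
  assert (C : forall k, convergent4 (cst k)) by exact cv_cst.
  destruct cv_X as (Cx & Cx' & _).
  assert (L : forall k m x y, (ord 1 x -> ord 1 y -> ord 1 (i * (cst k * x - cst m * y))%s4) /\
    (ord 2 x -> ord 2 y -> ord 2 (i * (cst k * x - cst m * y))%s4) /\
    (hol x -> hol y -> hol (i * (cst k * x - cst m * y))%s4) /\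
    (convergent4 x -> convergent4 y -> convergent4 (i * (cst k * x - cst m * y))%s4)).
  { intros k m x y. repeat split; intros.
    - apply (ord_mul 0 1), ord_sub; [apply ord_any|apply (ord_mul 0 1)..]; auto using ord_any.
    - apply (ord_mul 0 2), ord_sub; [apply ord_any|apply (ord_mul 0 2)..]; auto using ord_any.
    - apply hol_scal, hol_sub; now apply hol_scal.
    - apply cv_mul, cv_sub; [apply C|apply cv_mul..]; auto. }
  assert (cft : convergent4 ft) by (apply cv_sub, cv_add; [|apply cv_mul..]; auto; apply C).
  assert (cgt : convergent4 gt) by (apply cv_sub, cv_add; [|apply cv_mul..]; auto; apply C).
  assert (oft : ord 2 ft) by now apply ord2_linear_part.
  assert (ogt : ord 2 gt) by now apply ord2_linear_part.
  destruct (fixpoint_series (i * (d * X1 - b * X2))%s4 (i * (a * X2 - c * X1))%s4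
    (i * (d * ft - b * gt))%s4 (i * (a * gt - c * ft))%s4)
    as (y1 & y2 & K1 & K2 & H1 & H2 & O1 & O2 & F1 & F2);
    try (apply L; auto using hol_X1, hol_X2, ord_X1, ord_X2).
  assert (Z := ord_zero 1).
  assert (S : forall k m x y, hcomp (i * (cst k * x - cst m * y))%s4 y1 y2 =
    (i * (cst k * hcomp x y1 y2 - cst m * hcomp y y1 y2))%s4).
  { intros. unfold hcomp, i. now rewrite !comp_mul, comp_sub, !comp_mul, !comp_cst. }
  unfold a, b, c, d in F1, F2. rewrite S in F1, F2. fold a b c d in F1, F2.
  destruct (linear_solve a b c d i _ _ _ _ _ _ I F1 F2) as [E1 E2].
  assert (M : forall h k m, hcomp (h + (cst k * X1 + cst m * X2))%s4 y1 y2 =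
    (hcomp h y1 y2 + (cst k * y1 + cst m * y2))%s4).
  { intros. unfold hcomp. now rewrite !comp_add, !comp_mul, !comp_cst, comp_X1, comp_X2. }
  unfold a, b, c, d in E1, E2. rewrite <- M in E1, E2. fold a b c d in E1, E2.
  replace (ft + (a * X1 + b * X2))%s4 with f in E1 by (unfold ft; ring).
  replace (gt + (c * X1 + d * X2))%s4 with g in E2 by (unfold gt; ring).
  exists y1, y2. do 8 (split; [assumption|]).
  intros Q. assert (G := jac_hcomp f g y1 y2 O1 O2). rewrite E1, E2, jac_X, Q, Cmult_0_r in G.
  apply RtoC_inj in G. lra.
Qed.

(** * Changes of coordinates *)

Definition near (P : C -> C -> Prop) : Prop :=
  exists eps, 0 < eps /\ forall z zeta, Cmod z < eps -> Cmod zeta < eps -> P z zeta.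

Lemma near_and P Q : near P -> near Q -> near (fun z zeta => P z zeta /\ Q z zeta).
Proof.
  intros (e & He & HP) (e' & He' & HQ). exists (Rmin e e'). split; [now apply Rmin_pos|].
  intros z zeta Hz Hze. generalize (Rmin_l e e') (Rmin_r e e'); intros.
  split; [apply HP|apply HQ]; lra.
Qed.

Lemma near_imp (P Q : C -> C -> Prop) : (forall z zeta, P z zeta -> Q z zeta) -> near P -> near Q.
Proof. intros H (e & He & HP). exists e; split; auto. Qed.

Lemma near_small y r : convergent4 y -> ord 1 y -> 0 < r -> near (fun z zeta => Cmod (evalF y z zeta) < r).
Proof.
  intros Hy Ho Hr. destruct (small_bnd y (r / 2) Hy Ho ltac:(lra)) as (s & Hs & HB).
  exists s; split; [exact Hs|]. intros z zeta Hz Hze.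
  apply Rle_lt_trans with (r / 2); [|lra].
  assert (S1 := evalF_sums s _ y z zeta ltac:(lra) ltac:(lra) HB).
  eapply (sums_to_bound z zeta (Cconj z) (Cconj zeta) s); try eassumption; rewrite ?Cmod_conj; lra.
Qed.

Lemma near_comp P y1 y2 : convergent4 y1 -> convergent4 y2 -> ord 1 y1 -> ord 1 y2 -> near P ->
  near (fun z zeta => P (evalF y1 z zeta) (evalF y2 z zeta)).
Proof.
  intros H1 H2 O1 O2 (e & He & HP).
  apply (near_imp (fun z zeta => Cmod (evalF y1 z zeta) < e /\ Cmod (evalF y2 z zeta) < e)).
  - intros z zeta [A B]; now apply HP.
  - apply near_and; now apply near_small.
Qed.

Lemma near_evalF F : convergent4 F -> exists s, 0 < s /\
  forall z zeta, Cmod z <= s -> Cmod zeta <= s ->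
   sums_to z zeta (Cconj z) (Cconj zeta) s F (evalF F z zeta).
Proof.
  intros HF. apply convergent4E in HF. destruct HF as (s & B & Hs & HB).
  exists s; split; [exact Hs|]. intros. now apply evalF_sums with B.
Qed.

Lemma sums_to_radius z zeta s s' F v : 0 < s' <= s ->
  sums_to z zeta (Cconj z) (Cconj zeta) s F v ->
  sums_to z zeta (Cconj z) (Cconj zeta) s' F v.
Proof.
  intros H [[B HB] HL]; split; [|exact HL]. exists B. apply (bnd_radius _ s); auto; lra.
Qed.

(** Links a series to the germ of the function it sums to, so that identities between values can be
    derived without tracking radii. *)
Definition rep (F : coef4) (phi : C -> C -> C) : Prop :=
  convergent4 F /\ near (fun z zeta => evalF F z zeta = phi z zeta).

Lemma rep_self F : convergent4 F -> rep F (evalF F).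
Proof. intros H; split; [exact H|]. exists 1; split; [lra|reflexivity]. Qed.

Lemma rep_op (op : coef4 -> coef4 -> coef4) (cop : C -> C -> C) F G phi psi :
  (forall F G, convergent4 F -> convergent4 G -> convergent4 (op F G)) ->
  (forall x1 x2 x3 x4 s, Cmod x1 <= s -> Cmod x2 <= s -> Cmod x3 <= s -> Cmod x4 <= s ->
    forall F G u v, sums_to x1 x2 x3 x4 s F u -> sums_to x1 x2 x3 x4 s G v ->
      sums_to x1 x2 x3 x4 s (op F G) (cop u v)) ->
  rep F phi -> rep G psi -> rep (op F G) (fun z zeta => cop (phi z zeta) (psi z zeta)).
Proof.
  intros Hcv Hop [HF NF] [HG NG]. split; [now apply Hcv|].
  destruct (near_evalF F HF) as (s & Hs & SF). destruct (near_evalF G HG) as (s' & Hs' & SG).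
  assert (Q1 := Rmin_l s s'). assert (Q2 := Rmin_r s s').
  assert (N : near (fun z zeta => evalF (op F G) z zeta = cop (evalF F z zeta) (evalF G z zeta))).
  { exists (Rmin s s'). split; [now apply Rmin_pos|]. intros z zeta Hz Hze.
    apply sums_to_eval with (s := Rmin s s'). apply Hop; rewrite ?Cmod_conj; try lra.
    - apply sums_to_radius with s; [split; [now apply Rmin_pos|lra]|]. apply SF; lra.
    - apply sums_to_radius with s'; [split; [now apply Rmin_pos|lra]|]. apply SG; lra. }
  refine (near_imp _ _ _ (near_and _ _ N (near_and _ _ NF NG))).
  intros z zeta (-> & -> & ->). reflexivity.
Qed.

Lemma rep_add F G phi psi : rep F phi -> rep G psi ->
  rep (F + G)%s4 (fun z zeta => (phi z zeta + psi z zeta)%C).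
Proof. apply (rep_op add4 Cplus); [apply cv_add|]. intros; now apply sums_to_add. Qed.
Lemma rep_sub F G phi psi : rep F phi -> rep G psi ->
  rep (F - G)%s4 (fun z zeta => (phi z zeta - psi z zeta)%C).
Proof. apply (rep_op sub4 Cminus); [apply cv_sub|]. intros; now apply sums_to_sub. Qed.
Lemma rep_mul F G phi psi : rep F phi -> rep G psi ->
  rep (F * G)%s4 (fun z zeta => (phi z zeta * psi z zeta)%C).
Proof. apply (rep_op mul4 Cmult); [apply cv_mul|]. intros; now apply sums_to_mul. Qed.

Lemma evalF_cst c z zeta : evalF (cst c) z zeta = c.
Proof.
  unfold evalF. set (s := Rmax (Cmod z) (Cmod zeta)).
  assert (Q1 := Rmax_l (Cmod z) (Cmod zeta)). assert (Q2 := Rmax_r (Cmod z) (Cmod zeta)).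
  apply sums_to_eval with (s := s). apply sums_to_cst; rewrite ?Cmod_conj; assumption.
Qed.

Lemma evalF_X z zeta : evalF X1 z zeta = z /\ evalF X2 z zeta = zeta /\
  evalF X3 z zeta = Cconj z /\ evalF X4 z zeta = Cconj zeta.
Proof.
  set (s := Rmax (Cmod z) (Cmod zeta)).
  assert (L := Rmax_l (Cmod z) (Cmod zeta)). assert (L' := Rmax_r (Cmod z) (Cmod zeta)). fold s in L, L'.
  destruct (sums_to_X z zeta (Cconj z) (Cconj zeta) s) as (S1 & S2 & S3 & S4); rewrite ?Cmod_conj; auto.
  unfold evalF. repeat split; eapply sums_to_eval; eassumption.
Qed.

Lemma rep_cst c : rep (cst c) (fun _ _ => c).
Proof. split; [apply cv_cst|]. exists 1; split; [lra|]. intros; apply evalF_cst. Qed.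

Lemma evalF_star F : convergent4 F -> near (fun z zeta => evalF (star F) z zeta = Cconj (evalF F z zeta)).
Proof.
  intros HF. destruct (near_evalF F HF) as (s & Hs & SF). exists s; split; [exact Hs|].
  intros z zeta Hz Hze. apply sums_to_eval with (s := s). apply sums_to_star, SF; lra.
Qed.

Lemma real_of_hermitian F : convergent4 F -> hermitian F -> real_valued F.
Proof.
  intros HF H. destruct (evalF_star F HF) as (s & Hs & E). exists s; split; [exact Hs|].
  intros z zeta Hz Hze. specialize (E z zeta Hz Hze).
  replace (star F) with F in E.
  - destruct (evalF F z zeta) as [x y]. unfold Cconj in E. cbn in E |- *. injection E. lra.
  - apply coef4_ext; intros. symmetry. unfold star. rewrite <- H. reflexivity.
Qed.

Lemma eval4_hol f x1 x2 x3 x4 x3' x4' : hol f -> eval4 f x1 x2 x3 x4 = eval4 f x1 x2 x3' x4'.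
Proof.
  intros H. assert (E : forall N, psum4 f x1 x2 x3 x4 N = psum4 f x1 x2 x3' x4' N).
  { intros N. unfold psum4. do 4 (apply csum_ext; intros).
    destruct (Nat.eq_dec (i1 + i2) 0) as [Q|Q].
    - replace i1 with 0%nat by lia. replace i2 with 0%nat by lia. reflexivity.
    - rewrite H by lia. ring. }
  unfold eval4. f_equal; f_equal; apply Lim_seq_ext; intros; now rewrite E.
Qed.

Lemma star_ord k y : ord k y -> ord k (star y).
Proof.
  intros H a b c d L. unfold star. rewrite H by lia.
  apply injective_projections; unfold Cconj, RtoC; cbn; ring.
Qed.
Lemma star_bnd s B y : bnd s B y -> bnd s B (star y).
Proof. intros H N. rewrite nrm_star. apply H. Qed.
Lemma star_cv y : convergent4 y -> convergent4 (star y).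
Proof. rewrite !convergent4E. intros (s & B & Hs & H). exists s, B; split; [exact Hs|now apply star_bnd]. Qed.

(** The pull-back of a defining function: zbar and zetabar are replaced by the conjugates of what
    replaces z and zeta. *)
Definition pcomp (F y1 y2 : coef4) : coef4 := comp F y1 y2 (star y1) (star y2).

Lemma comp_common F y1 y2 : convergent4 F -> convergent4 y1 -> convergent4 y2 -> ord 1 y1 -> ord 1 y2 ->
  exists r s B, 0 < r /\ 0 < s /\ bnd r B F /\ bnd s r y1 /\ bnd s r y2.
Proof.
  intros HF H1 H2 O1 O2. apply convergent4E in HF. destruct HF as (r & B & Hr & HB).
  destruct (small_bnd y1 r H1 O1 Hr) as (s & Hs & B1). destruct (small_bnd y2 r H2 O2 Hr) as (s' & Hs' & B2).
  exists r, (Rmin s s'), B. generalize (Rmin_l s s') (Rmin_r s s'); intros.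
  assert (P : 0 < Rmin s s') by now apply Rmin_pos.
  do 3 (split; [assumption|]). split; [apply (bnd_radius _ s)|apply (bnd_radius _ s')]; auto; lra.
Qed.

Lemma cv_hcomp F y1 y2 : convergent4 F -> convergent4 y1 -> convergent4 y2 -> ord 1 y1 -> ord 1 y2 ->
  convergent4 (hcomp F y1 y2).
Proof.
  intros HF H1 H2 O1 O2. destruct (comp_common F y1 y2 HF H1 H2 O1 O2) as (r & s & B & Hr & Hs & HB & B1 &
    B2).
  apply convergent4E. exists s, B; split; [exact Hs|]. intros N.
  assert (Z : nrm s N zero4 <= r).
  { change zero4 with (c0 R4). rewrite (tn_0 R4 _ (nrm_tnorm s ltac:(lra))). lra. }
  eapply Rle_trans; [exact (comp_nrm y1 y2 zero4 zero4
          O1 O2 (ord_zero 1) (ord_zero 1) s r N F ltac:(lra) (B1 N) (B2 N) Z Z)|]. apply HB.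
Qed.

Lemma cv_pcomp F y1 y2 : convergent4 F -> convergent4 y1 -> convergent4 y2 -> ord 1 y1 -> ord 1 y2 ->
  convergent4 (pcomp F y1 y2).
Proof.
  intros HF H1 H2 O1 O2. destruct (comp_common F y1 y2 HF H1 H2 O1 O2) as (r & s & B & Hr & Hs & HB & B1 &
    B2).
  apply convergent4E. exists s, B; split; [exact Hs|]. intros N.
  eapply Rle_trans; [exact (comp_nrm y1 y2 (star y1) (star y2)
          O1 O2 (star_ord _ _ O1) (star_ord _ _ O2) s r N F ltac:(lra) (B1 N) (B2 N)
          (star_bnd _ _ _ B1 N) (star_bnd _ _ _ B2 N))|]. apply HB.
Qed.

Lemma evalF_hcomp F y1 y2 : convergent4 F -> convergent4 y1 -> convergent4 y2 -> ord 1 y1 -> ord 1 y2 ->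
  hol F -> near (fun z zeta => evalF (hcomp F y1 y2) z zeta = evalF F (evalF y1 z zeta) (evalF y2 z zeta)).
Proof.
  intros HF H1 H2 O1 O2 Hh. destruct (comp_common F y1 y2 HF H1 H2 O1 O2) as (r & s & B & Hr & Hs & HB & B1 &
    B2).
  exists s; split; [exact Hs|]. intros z zeta Hz Hze.
  assert (Z : bnd s r zero4).
  { intros N. change zero4 with (c0 R4). rewrite (tn_0 R4 _ (nrm_tnorm s ltac:(lra))). lra. }
  assert (C1 : Cmod (Cconj z) <= s) by (rewrite Cmod_conj; lra).
  assert (C2 : Cmod (Cconj zeta) <= s) by (rewrite Cmod_conj; lra).
  assert (S1 := eval4_comp z zeta (Cconj z) (Cconj zeta) s ltac:(lra) ltac:(lra) C1 C2 r B F
    y1 y2 zero4 zero4 O1 O2 (ord_zero 1) (ord_zero 1) HB B1 B2 Z Z).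
  unfold evalF at 1, hcomp. rewrite (sums_to_eval _ _ _ _ _ _ _ S1).
  unfold evalF at 1. now apply eval4_hol.
Qed.

Lemma evalF_pcomp F y1 y2 : convergent4 F -> convergent4 y1 -> convergent4 y2 -> ord 1 y1 -> ord 1 y2 ->
  near (fun z zeta => evalF (pcomp F y1 y2) z zeta = evalF F (evalF y1 z zeta) (evalF y2 z zeta)).
Proof.
  intros HF H1 H2 O1 O2.
  apply (near_imp (fun z zeta => (evalF (star y1) z zeta = Cconj (evalF y1 z zeta) /\
     evalF (star y2) z zeta = Cconj (evalF y2 z zeta)) /\
     evalF (pcomp F y1 y2) z zeta = eval4 F (evalF y1 z zeta) (evalF y2 z zeta)
       (evalF (star y1) z zeta) (evalF (star y2) z zeta))).
  { intros z zeta [[E1 E2] ->]. now rewrite E1, E2. }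
  apply near_and; [apply near_and; now apply evalF_star|].
  destruct (comp_common F y1 y2 HF H1 H2 O1 O2) as (r & s & B & Hr & Hs & HB & B1 & B2).
  exists s; split; [exact Hs|]. intros z zeta Hz Hze.
  assert (C1 : Cmod (Cconj z) <= s) by (rewrite Cmod_conj; lra).
  assert (C2 : Cmod (Cconj zeta) <= s) by (rewrite Cmod_conj; lra).
  assert (S1 := eval4_comp z zeta (Cconj z) (Cconj zeta) s ltac:(lra) ltac:(lra) C1 C2 r B F
    y1 y2 (star y1) (star y2) O1 O2 (star_ord _ _ O1) (star_ord _ _ O2) HB B1 B2
    (star_bnd _ _ _ B1) (star_bnd _ _ _ B2)).
  exact (sums_to_eval _ _ _ _ _ _ _ S1).
Qed.

Record biholo (f g : coef4) : Prop := {
  bh_cv1 : convergent4 f; bh_cv2 : convergent4 g; bh_hol1 : hol f; bh_hol2 : hol g;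
  bh_ord1 : ord 1 f; bh_ord2 : ord 1 g; bh_jac : jac f g <> 0 }.

Lemma biholo_inverse f g : biholo f g -> exists u1 u2, biholo u1 u2 /\
  hcomp f u1 u2 = X1 /\ hcomp g u1 u2 = X2.
Proof.
  intros [C1 C2 H1 H2 O1 O2 J].
  destruct (formal_inverse f g C1 C2 H1 H2 O1 O2 J) as (u1 & u2 & A1 & A2 & A3 & A4 & A5 & A6 & A7 & A8 & A9).
  exists u1, u2. split; [|now split]. now constructor.
Qed.

(** A right inverse u of (f, g) is also a left inverse. If v is a right inverse of u, then near the
    origin (f, g) = (f, g)(u(v)) = v, and therefore u(f, g) = u(v) is the identity. *)
Lemma local_inverse f g u1 u2 : biholo f g -> biholo u1 u2 ->
  hcomp f u1 u2 = X1 -> hcomp g u1 u2 = X2 ->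
  near (fun z zeta => evalF u1 (evalF f z zeta) (evalF g z zeta) = z /\
                      evalF u2 (evalF f z zeta) (evalF g z zeta) = zeta).
Proof.
  intros [Cf Cg Hf Hg Of Og Jf] BU E1 E2.
  destruct (biholo_inverse u1 u2 BU) as (v1 & v2 & BV & E3 & E4).
  destruct BU as [Cu1 Cu2 Hu1 Hu2 Ou1 Ou2 Ju]. destruct BV as [Cv1 Cv2 Hv1 Hv2 Ov1 Ov2 Jv].
  assert (N1 := evalF_hcomp f u1 u2 Cf Cu1 Cu2 Ou1 Ou2 Hf).
  assert (N2 := evalF_hcomp g u1 u2 Cg Cu1 Cu2 Ou1 Ou2 Hg).
  assert (N3 := evalF_hcomp u1 v1 v2 Cu1 Cv1 Cv2 Ov1 Ov2 Hu1).
  assert (N4 := evalF_hcomp u2 v1 v2 Cu2 Cv1 Cv2 Ov1 Ov2 Hu2).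
  rewrite E1 in N1. rewrite E2 in N2. rewrite E3 in N3. rewrite E4 in N4.
  assert (N5 := near_comp _ v1 v2 Cv1 Cv2 Ov1 Ov2 N1).
  assert (N6 := near_comp _ v1 v2 Cv1 Cv2 Ov1 Ov2 N2). cbv beta in N5, N6.
  refine (near_imp _ _ _ (near_and _ _ (near_and _ _ N3 N4) (near_and _ _ N5 N6))).
  intros z zeta [[A1 A2] [A3 A4]].
  assert (EX1 : forall z zeta, evalF X1 z zeta = z) by apply evalF_X.
  assert (EX2 : forall z zeta, evalF X2 z zeta = zeta) by apply evalF_X.
  rewrite EX1 in A1, A3. rewrite EX2 in A2, A4.
  rewrite <- A1, <- A2 in A3, A4. rewrite <- A3, <- A4. split; symmetry; assumption.
Qed.

(** Only the (z, zeta) part of a rigid map appears here; the scaling by rho and the shift by h are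
    made once, in [reduced]. *)
Definition equiv_by (f g F F' : coef4) : Prop :=
  biholo f g /\ near (fun z zeta => evalF F z zeta = evalF F' (evalF f z zeta) (evalF g z zeta)).

Lemma biholo_comp f g f' g' : biholo f g -> biholo f' g' -> biholo (hcomp f' f g) (hcomp g' f g).
Proof.
  intros [A1 A2 A3 A4 A5 A6 A7] [B1 B2 B3 B4 B5 B6 B7].
  constructor.
  - now apply cv_hcomp.
  - now apply cv_hcomp.
  - now apply hol_hcomp.
  - now apply hol_hcomp.
  - apply comp_ord; auto using ord_zero.
  - apply comp_ord; auto using ord_zero.
  - rewrite jac_hcomp by assumption. now apply Cmult_neq_0.
Qed.

Lemma equiv_trans f g f' g' F F' F'' : equiv_by f g F F' -> equiv_by f' g' F' F'' ->
  equiv_by (hcomp f' f g) (hcomp g' f g) F F''.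
Proof.
  intros [B N] [B' N']. split; [now apply biholo_comp|].
  destruct B as [A1 A2 A3 A4 A5 A6 A7]. destruct B' as [B1 B2 B3 B4 B5 B6 B7].
  assert (M1 := evalF_hcomp f' f g B1 A1 A2 A5 A6 B3).
  assert (M2 := evalF_hcomp g' f g B2 A1 A2 A5 A6 B4).
  assert (M3 := near_comp _ f g A1 A2 A5 A6 N'). cbv beta in M3.
  refine (near_imp _ _ _ (near_and _ _ (near_and _ _ N M3) (near_and _ _ M1 M2))).
  intros z zeta [[-> ->] [-> ->]]. reflexivity.
Qed.

Lemma equiv_pcomp f g u1 u2 F : convergent4 F -> biholo f g -> biholo u1 u2 ->
  hcomp f u1 u2 = X1 -> hcomp g u1 u2 = X2 -> equiv_by f g F (pcomp F u1 u2).
Proof.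
  intros CF B BU E1 E2. split; [exact B|].
  assert (N := local_inverse f g u1 u2 B BU E1 E2).
  destruct B as [A1 A2 A3 A4 A5 A6 A7]. destruct BU as [B1 B2 B3 B4 B5 B6 B7].
  assert (M := near_comp _ f g A1 A2 A5 A6 (evalF_pcomp F u1 u2 CF B1 B2 B5 B6)). cbv beta in M.
  refine (near_imp _ _ _ (near_and _ _ N M)).
  intros z zeta [[Q1 Q2] ->]. now rewrite Q1, Q2.
Qed.

(** * Jets along an antiholomorphic curve *)

Definition levi_det (F : coef4) : coef4 :=
  (d_z (d_zb F) * d_zeta (d_zetab F) - d_z (d_zetab F) * d_zeta (d_zb F))%s4.

(** The hypotheses that survive every change of coordinates. 2-nondegeneracy enters separately, as a
    nonzero number at the origin, in [phase_linear]. *)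
Record adm (F : coef4) : Prop := {
  adm_cv : convergent4 F; adm_herm : hermitian F; adm_det : levi_det F = zero4 }.

Lemma antihol_star y : hol y -> d_z (star y) = zero4 /\ d_zeta (star y) = zero4.
Proof.
  intros H; split; apply coef4_ext; intros a b c d; unfold d_z, d_zeta, star;
    rewrite H by lia; rewrite Cconj_0; apply Cmult_0_r.
Qed.

Lemma d_z_zb F : d_z (d_zb F) = d_zb (d_z F).
Proof. apply coef4_ext; intros; unfold d_z, d_zb; ring. Qed.
Lemma d_z_zetab F : d_z (d_zetab F) = d_zetab (d_z F).
Proof. apply coef4_ext; intros; unfold d_z, d_zetab; ring. Qed.
Lemma d_zeta_zb F : d_zeta (d_zb F) = d_zb (d_zeta F).
Proof. apply coef4_ext; intros; unfold d_zeta, d_zb; ring. Qed.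
Lemma d_zeta_zetab F : d_zeta (d_zetab F) = d_zetab (d_zeta F).
Proof. apply coef4_ext; intros; unfold d_zeta, d_zetab; ring. Qed.
Lemma d_zb_zetab F : d_zb (d_zetab F) = d_zetab (d_zb F).
Proof. apply coef4_ext; intros; unfold d_zb, d_zetab; ring. Qed.
Lemma d_zeta_z F : d_zeta (d_z F) = d_z (d_zeta F).
Proof. apply coef4_ext; intros; unfold d_z, d_zeta; ring. Qed.

Section Pcomp.
Variables u1 u2 : coef4.
Hypotheses (h1 : hol u1) (h2 : hol u2) (o1 : ord 1 u1) (o2 : ord 1 u2).
Let s1 := star_ord 1 u1 o1.
Let s2 := star_ord 1 u2 o2.
Local Open Scope s4_scope.

Lemma pcomp_add F G : pcomp (F + G) u1 u2 = pcomp F u1 u2 + pcomp G u1 u2.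
Proof. unfold pcomp. now rewrite comp_add. Qed.
Lemma pcomp_mul F G : pcomp (F * G) u1 u2 = pcomp F u1 u2 * pcomp G u1 u2.
Proof. unfold pcomp. now rewrite comp_mul. Qed.
Lemma pcomp_cst c : pcomp (cst c) u1 u2 = cst c.
Proof. unfold pcomp. now rewrite comp_cst. Qed.
Lemma pcomp_zero : pcomp 0 u1 u2 = 0.
Proof. unfold pcomp. now rewrite comp_zero. Qed.

Lemma pcomp_d_z F : d_z (pcomp F u1 u2) = pcomp (d_z F) u1 u2 * d_z u1 + pcomp (d_zeta F) u1 u2 * d_z u2.
Proof.
  unfold pcomp. rewrite comp_chain by (auto using d_z_der).
  destruct (antihol_star u1 h1) as [-> _]. destruct (antihol_star u2 h2) as [-> _]. ring.
Qed.
Lemma pcomp_d_zeta F : d_zeta (pcomp F u1 u2) =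
  pcomp (d_z F) u1 u2 * d_zeta u1 + pcomp (d_zeta F) u1 u2 * d_zeta u2.
Proof.
  unfold pcomp. rewrite comp_chain by (auto using d_zeta_der).
  destruct (antihol_star u1 h1) as [_ ->]. destruct (antihol_star u2 h2) as [_ ->]. ring.
Qed.
Lemma pcomp_d_zb F : d_zb (pcomp F u1 u2) =
  pcomp (d_zb F) u1 u2 * d_zb (star u1) + pcomp (d_zetab F) u1 u2 * d_zb (star u2).
Proof.
  unfold pcomp. rewrite comp_chain by (auto using d_zb_der).
  destruct (proj1 (hol_der u1) h1) as [-> _]. destruct (proj1 (hol_der u2) h2) as [-> _]. ring.
Qed.
Lemma pcomp_d_zetab F : d_zetab (pcomp F u1 u2) =
  pcomp (d_zb F) u1 u2 * d_zetab (star u1) + pcomp (d_zetab F) u1 u2 * d_zetab (star u2).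
Proof.
  unfold pcomp. rewrite comp_chain by (auto using d_zetab_der).
  destruct (proj1 (hol_der u1) h1) as [_ ->]. destruct (proj1 (hol_der u2) h2) as [_ ->]. ring.
Qed.

(** The mixed Hessian is multiplied by the Jacobian matrix on one side and by its conjugate on the
    other. No second derivative of the map occurs, since [star u1] and [star u2] do not depend on z
    and zeta. *)
Lemma levi_det_pcomp F : levi_det F = 0 -> levi_det (pcomp F u1 u2) = 0.
Proof.
  intros H.
  assert (HC : pcomp (levi_det F) u1 u2 = 0) by (rewrite H; apply pcomp_zero).
  unfold levi_det in *.
  replace (_ - _) with (d_z (d_zb F) * d_zeta (d_zetab F)
    + cst (- RtoC 1)%C * (d_z (d_zetab F) * d_zeta (d_zb F)))
    in HC by (rewrite cst_opp, cst_1; ring).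
  rewrite pcomp_add, !pcomp_mul, pcomp_cst, cst_opp, cst_1 in HC.
  destruct (antihol_star u1 h1) as [A1 B1]. destruct (antihol_star u2 h2) as [A2 B2].
  rewrite pcomp_d_zb, pcomp_d_zetab.
  rewrite !(der_add _ d_z_der), !(der_add _ d_zeta_der), !(der_mul _ d_z_der), !(der_mul _ d_zeta_der).
  rewrite !d_z_zb, !d_zeta_zb, !d_z_zetab, !d_zeta_zetab, A1, B1, A2, B2.
  rewrite !(der4_zero _ d_zb_der), !(der4_zero _ d_zetab_der).
  rewrite !pcomp_d_z, !pcomp_d_zeta.
  match type of HC with ?L = _ => transitivity
   (L * ((d_z u1 * d_zeta u2 - d_zeta u1 * d_z u2) *
    (d_zb (star u1) * d_zetab (star u2) - d_zetab (star u1) * d_zb (star u2)))) end.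
  - ring.
  - rewrite HC. ring.
Qed.
End Pcomp.

(** Symmetry is transported through values: a composite of a real-valued function is real-valued,
    and this gives the coefficient symmetry back. *)
Lemma adm_pcomp F u1 u2 : adm F -> biholo u1 u2 -> adm (pcomp F u1 u2).
Proof.
  intros [CF HF DF] [A1 A2 A3 A4 A5 A6 A7].
  assert (CP := cv_pcomp F u1 u2 CF A1 A2 A5 A6).
  constructor; [exact CP| |now apply levi_det_pcomp].
  apply hermitian_of_real; [exact CP|].
  assert (RF : near (fun z zeta => Im (evalF F z zeta) = 0)) by now apply real_of_hermitian.
  assert (N := near_comp _ u1 u2 A1 A2 A5 A6 RF). cbv beta in N.
  refine (near_imp _ _ _ (near_and _ _ N (evalF_pcomp F u1 u2 CF A1 A2 A5 A6))).
  intros z zeta [E1 ->]. exact E1.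
Qed.

Definition hlift (s : nat -> nat -> C) : coef4 :=
  fun a b c d => match c, d with O, O => s a b | _, _ => RtoC 0 end.

Lemma slice_hlift s : slice (hlift s) = s.
Proof. reflexivity. Qed.
Lemma hol_hlift s : hol (hlift s).
Proof. intros a b [|c] [|d] L; try reflexivity; lia. Qed.
Lemma cv_hlift F : convergent4 F -> convergent4 (hlift (slice F)).
Proof.
  intros H. apply (cv_dom _ F 1); [|lra|exact H].
  intros a b c d. unfold hlift, slice. destruct c, d; rewrite ?Cmod_0; try lra;
  match goal with |- 0 <= 1 * Cmod ?x => generalize (Cmod_ge_0 x); lra end.
Qed.

Lemma slice_add F G : slice (F + G)%s4 = cadd R2 (slice F) (slice G).
Proof. apply (homadd _ _ _ slice_rhom). Qed.
Lemma slice_mul F G : slice (F * G)%s4 = cmul R2 (slice F) (slice G).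
Proof. exact (hommul _ _ _ slice_rhom F G). Qed.

Lemma slice_star u : hol u -> ord 1 u -> slice (star u) = c0 R2.
Proof.
  intros H O. extensionality a; extensionality b. unfold slice, star.
  change (Cconj (u 0%nat 0%nat a b) = 0).
  destruct (Nat.eq_dec (a + b) 0) as [E|E].
  - rewrite O by lia. apply Cconj_0.
  - rewrite H by lia. apply Cconj_0.
Qed.

Lemma slice_pcomp F G u1 u2 : biholo u1 u2 -> slice F = slice G ->
  slice (pcomp F u1 u2) = slice (hcomp G u1 u2).
Proof.
  intros [A1 A2 A3 A4 A5 A6 A7] H.
  apply slice_comp; try assumption; try (now apply slice_star); reflexivity.
Qed.

Lemma slice_antihol (v : coef4) : (forall a b c d, (0 < a + b)%nat -> v a b c d = 0) ->
  slice v = slice (cst (o4 v)).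
Proof.
  intros H. extensionality a; extensionality b. unfold slice. rewrite cstE.
  destruct a, b; try (apply H; lia). reflexivity.
Qed.

Lemma star_antihol u : hol u -> forall a b c d, (0 < a + b)%nat -> star u a b c d = 0.
Proof. intros H a b c d L. unfold star. rewrite H by lia. apply Cconj_0. Qed.

(** [star u] depends on zbar and zetabar alone, so its derivatives are constant on the slice. *)
Lemma slice_d_zb_star u : hol u ->
  slice (d_zb (star u)) = slice (cst (Cconj (o4 (d_z u)))) /\
  slice (d_zb (d_zb (star u))) = slice (cst (Cconj (o4 (d_z (d_z u))))).
Proof.
  intros H. assert (S := star_antihol u H).
  split.
  - rewrite slice_antihol.
    + do 2 f_equal. unfold o4, d_zb, d_z, star. now rewrite Cmult_conj, Cconj_R.
    + intros; unfold d_zb. rewrite S by lia. ring.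
  - rewrite slice_antihol.
    + do 2 f_equal. unfold o4, d_zb, d_z, star. now rewrite !Cmult_conj, !Cconj_R.
    + intros; unfold d_zb. rewrite S by lia. ring.
Qed.

Ltac cv_tac := repeat match goal with
  | |- convergent4 (add4 _ _) => apply cv_add
  | |- convergent4 (sub4 _ _) => apply cv_sub
  | |- convergent4 (mul4 _ _) => apply cv_mul
  | |- convergent4 (cst _) => apply cv_cst
  | |- convergent4 (d_zb _) => apply cv_d_zb
  | |- convergent4 (d_zetab _) => apply cv_d_zetab
  end.

Section Step.
Variables (F : coef4) (be al2 be2 : C).
Hypotheses (AF : adm F) (SF : slice F = slice zero4).
Local Open Scope s4_scope.

Definition first_jet : coef4 := d_zb F + cst be * d_zetab F.
Definition second_jet : coef4 :=
  d_zb (d_zb F) + cst (RtoC 2 * be)%C * d_zetab (d_zb F) + cst (be * be)%C * d_zetab (d_zetab F)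
  + cst (RtoC 2 * al2)%C * d_zb F + cst (RtoC 2 * be2)%C * d_zetab F.
(** The third derivative along the curve, with [m1] and [m2] for the third derivatives of the curve
    itself. They stay unspecified: the coefficients of this jet read off later multiply them by
    zero. *)
Definition third_jet (m1 m2 : C) : coef4 :=
  d_zb (d_zb (d_zb F)) + cst (RtoC 3 * be)%C * d_zetab (d_zb (d_zb F))
  + cst (RtoC 3 * (be * be))%C * d_zetab (d_zetab (d_zb F))
  + cst (be * (be * be))%C * d_zetab (d_zetab (d_zetab F))
  + cst (RtoC 6 * al2)%C * d_zb (d_zb F)
  + cst (RtoC 6 * (be2 + al2 * be))%C * d_zetab (d_zb F)
  + cst (RtoC 6 * (be * be2))%C * d_zetab (d_zetab F)
  + cst m1 * d_zb F + cst m2 * d_zetab F.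

Let f := hlift (slice first_jet).
Let g := hlift (slice second_jet).

Lemma F_00 a b c d : (a + b = 0 \/ c + d = 0)%nat -> F a b c d = RtoC 0.
Proof.
  assert (Z : forall a b, F a b 0%nat 0%nat = RtoC 0) by (intros i j; exact (equal_f (equal_f SF i) j)).
  intros [H|H].
  - replace a with 0%nat by lia. replace b with 0%nat by lia.
    rewrite (adm_herm F AF c d 0%nat 0%nat), Z. apply Cconj_0.
  - replace c with 0%nat by lia. replace d with 0%nat by lia. apply Z.
Qed.

Lemma jets_ord : ord 1 f /\ ord 1 g.
Proof.
  split; apply ord1_o4; unfold o4, f, g, hlift, slice, first_jet, second_jet;
    rewrite ?add4E, ?cst_mulE; unfold d_zb, d_zetab; rewrite !F_00 by lia; ring.
Qed.

Lemma jets_cv : convergent4 f /\ convergent4 g.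
Proof.
  assert (CF := adm_cv F AF).
  split; apply cv_hlift; unfold first_jet, second_jet;
  cv_tac; exact CF.
Qed.

Hypothesis J : jac f g <> RtoC 0.

Lemma jets_biholo : biholo f g.
Proof.
  destruct jets_ord, jets_cv. constructor; auto; apply hol_hlift.
Qed.

Let f' a b := first_jet a b 0%nat 0%nat.
Let g' a b := second_jet a b 0%nat 0%nat.
(* [f] and [g], evaluated along the curve [t -> (t + conj al2 t^2, conj be t + conj be2 t^2)],
   are [t + O(t^3)] and [O(t^3)]. *)
Definition curve_condition (k : nat -> nat -> C) (v : C) : Prop :=
  ((k 1 0)%nat + (k 0 1)%nat * Cconj be)%C = v /\
  ((k 1 0)%nat * Cconj al2 + (k 0 1)%nat * Cconj be2 + ((k 2 0)%nat + ((k 1 1)%nat * Cconj be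
    + (k 0 2)%nat * (Cconj be * Cconj be))))%C
   = RtoC 0.
Hypotheses (Kf : curve_condition f' (RtoC 1)) (Kg : curve_condition g' (RtoC 0)).

Lemma linear_unique (a b c d x y x' y' p q : C) :
  (a * d - b * c)%C <> RtoC 0 ->
  (a * x + b * y)%C = p -> (c * x + d * y)%C = q ->
  (a * x' + b * y')%C = p -> (c * x' + d * y')%C = q ->
  x = x' /\ y = y'.
Proof.
  intros D E1 E2 E3 E4.
  assert (Z : forall w, ((a * d - b * c) * w)%C = RtoC 0 -> w = RtoC 0)
    by (intros w; now apply Cmult_eq_0_l).
  assert (X : (x - x')%C = RtoC 0).
  { apply Z. transitivity (d * (a * x + b * y - (a * x' + b * y')) - b * (c * x + d * y - (c * x'
    + d * y')))%C; [ring|].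
    rewrite E1, E2, E3, E4. ring. }
  assert (Y : (y - y')%C = RtoC 0).
  { apply Z. transitivity (a * (c * x + d * y - (c * x' + d * y')) - c * (a * x + b * y - (a * x'
    + b * y')))%C; [ring|].
    rewrite E1, E2, E3, E4. ring. }
  split.
  - replace x with (x - x' + x')%C by ring. rewrite X. ring.
  - replace y with (y - y' + y')%C by ring. rewrite Y. ring.
Qed.

Section Inv.
Variables u1 u2 : coef4.
Hypotheses (BU : biholo u1 u2) (E1 : hcomp f u1 u2 = X1) (E2 : hcomp g u1 u2 = X2).

Let chain1 D (h : coef4) : der4 D -> o4 (D (hcomp h u1 u2)) =
  (o4 (d_z h) * o4 (D u1) + o4 (d_zeta h) * o4 (D u2))%C.
Proof.
  intros HD. rewrite hcomp_chain by (try apply BU; exact HD).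
  now rewrite o4_add, !o4_mul, !o4_hcomp.
Qed.

Lemma chain2 D D' (h : coef4) : der4 D -> der4 D' -> o4 (D' (D (hcomp h u1 u2))) =
  (o4 (d_z h) * o4 (D' (D u1)) + o4 (d_zeta h) * o4 (D' (D u2))
    + (o4 (d_z (d_z h)) * (o4 (D u1) * o4 (D' u1)) + (o4 (d_z (d_zeta h)) * (o4 (D u1) * o4 (D' u2)
      + o4 (D u2) * o4 (D' u1)) + o4 (d_zeta (d_zeta h)) * (o4 (D u2) * o4 (D' u2)))))%C.
Proof.
  intros HD HD'. rewrite hcomp_chain by (try apply BU; exact HD).
  rewrite (der_add _ HD'), !(der_mul _ HD'), !o4_add, !o4_mul, !o4_hcomp.
  rewrite !chain1 by exact HD'. rewrite d_zeta_z. ring.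
Qed.

Lemma o4_dzz (h : coef4) : o4 (d_z (d_z h)) = (RtoC 2 * (h 2 0 0 0)%nat)%C.
Proof. unfold o4, d_z. cbn [INR]. replace (RtoC (1 + 1)) with (RtoC 2) by (f_equal; ring). ring. Qed.
Lemma o4_dzeta2 (h : coef4) : o4 (d_zeta (d_zeta h)) = (RtoC 2 * (h 0 2 0 0)%nat)%C.
Proof. unfold o4, d_zeta. cbn [INR]. replace (RtoC (1 + 1)) with (RtoC 2) by (f_equal; ring). ring. Qed.
Lemma o4_dzzeta (h : coef4) : o4 (d_z (d_zeta h)) = (h 1 1 0 0)%nat.
Proof. unfold o4, d_zeta, d_z. cbn [INR]. ring. Qed.

Let J' : ((f' 1 0)%nat * (g' 0 1)%nat - (f' 0 1)%nat * (g' 1 0)%nat)%C <> RtoC 0.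
Proof. unfold jac in J. rewrite !o4_d_z, !o4_d_zeta in J. exact J. Qed.

(** Differentiating f(u) = z and g(u) = zeta in z gives an invertible linear system at 0, and
    [curve_condition] says that (1, conj be) solves it. *)
Lemma inverse_jet1 : o4 (d_z u1) = RtoC 1 /\ o4 (d_z u2) = Cconj be.
Proof.
  apply (linear_unique _ _ _ _ _ _ _ _ (RtoC 1) (RtoC 0) J').
  - transitivity (o4 (d_z (hcomp f u1 u2))).
    + rewrite (chain1 _ _ d_z_der), !o4_d_z, !o4_d_zeta. reflexivity.
    + rewrite E1, d_z_X1. reflexivity.
  - transitivity (o4 (d_z (hcomp g u1 u2))).
    + rewrite (chain1 _ _ d_z_der), !o4_d_z, !o4_d_zeta. reflexivity.
    + rewrite E2, d_z_X2. reflexivity.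
  - rewrite Cmult_1_r. apply Kf.
  - rewrite Cmult_1_r. apply Kg.
Qed.

(** The second derivatives of u solve the same linear system, with the quadratic terms in the first
    derivatives moved to the right; the second half of [curve_condition] is this system. *)
Lemma inverse_jet2 : o4 (d_z (d_z u1)) = (RtoC 2 * Cconj al2)%C /\
  o4 (d_z (d_z u2)) = (RtoC 2 * Cconj be2)%C.
Proof.
  destruct inverse_jet1 as [I1 I2].
  set (q (k : nat -> nat -> C) := (- (RtoC 2 * ((k 2 0)%nat + ((k 1 1)%nat * Cconj be
    + (k 0 2)%nat * (Cconj be * Cconj be)))))%C).
  assert (G : forall h s, h = hlift s -> o4 (d_z (d_z (hcomp h u1 u2))) = RtoC 0 ->
    ((s 1 0)%nat * o4 (d_z (d_z u1)) + (s 0 1)%nat * o4 (d_z (d_z u2)))%C = q s).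
  { intros h s -> Z. rewrite (chain2 _ _ _ d_z_der d_z_der), I1, I2, (o4_dzz (hlift s)), (o4_dzeta2 (hlift
    s)), (o4_dzzeta (hlift s)), (o4_d_z (hlift s)), (o4_d_zeta (hlift s)) in Z.
    unfold hlift in Z. unfold q.
    match type of Z with (?A + ?B)%C = _ => transitivity (A + B - B)%C; [ring|rewrite Z; ring] end. }
  assert (K : forall k v, curve_condition k v ->
    ((k 1 0)%nat * (RtoC 2 * Cconj al2) + (k 0 1)%nat * (RtoC 2 * Cconj be2))%C = q k).
  { intros k v [_ Z]. unfold q.
    match type of Z with (?A + ?B)%C = _ => transitivity (RtoC 2 * (A + B - B))%C; [ring|rewrite Z;
      ring] end. }
  apply (linear_unique _ _ _ _ _ _ _ _ (q f') (q g') J').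
  - apply (G f); [reflexivity|]. rewrite E1, d_z_X1, <- cst_1, (der_cst _ d_z_der). reflexivity.
  - apply (G g); [reflexivity|]. rewrite E2, d_z_X2, (der4_zero _ d_z_der). reflexivity.
  - exact (K _ _ Kf).
  - exact (K _ _ Kg).
Qed.

(** On the slice, powers of [d_zb] differentiate [F] along the conjugate of z -> u(z, 0). By the two
    preceding lemmas its 2-jet is that of the curve from which [f] and [g] were built, so the first
    two derivatives are f(u) = z and g(u) = zeta. *)
Lemma target_slices : slice (pcomp F u1 u2) = slice zero4 /\
  slice (d_zb (pcomp F u1 u2)) = slice X1 /\
  slice (d_zb (d_zb (pcomp F u1 u2))) = slice X2 /\
  exists m1 m2, slice (d_zb (d_zb (d_zb (pcomp F u1 u2)))) = slice (hcomp (hlift (slice (third_jet m1 m2)))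
    u1 u2).
Proof.
  destruct BU as [A1 A2 A3 A4 A5 A6 A7].
  destruct inverse_jet1 as [I1 I2]. destruct inverse_jet2 as [I3 I4].
  destruct (slice_d_zb_star u1 A3) as [U1 U1']. destruct (slice_d_zb_star u2 A4) as [U2 U2'].
  rewrite I1 in U1. rewrite I2, Cconj_conj in U2.
  rewrite I3, Cmult_conj, Cconj_conj, Cconj_R in U1'. rewrite I4, Cmult_conj, Cconj_conj, Cconj_R in U2'.
  rewrite Cconj_R in U1. rewrite cst_1 in U1.
  assert (PC := fun G => pcomp_d_zb u1 u2 A3 A4 A5 A6 G).
  split; [|split; [|split]].
  - rewrite (slice_pcomp _ zero4 _ _ BU SF). unfold hcomp.
    rewrite (comp_zero u1 u2 zero4 zero4 A5 A6 (ord_zero 1) (ord_zero 1)). reflexivity.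
  - rewrite <- E1. transitivity (slice (pcomp first_jet u1 u2)).
    + unfold first_jet. rewrite pcomp_add, pcomp_mul, pcomp_cst, PC by assumption.
      rewrite !slice_add, !slice_mul, U1, U2, <- !slice_mul, <- !slice_add. f_equal. ring.
    + apply slice_pcomp; [exact BU|reflexivity].
  - rewrite <- E2. transitivity (slice (pcomp second_jet u1 u2)).
    + unfold second_jet. rewrite !pcomp_add, !pcomp_mul, !pcomp_cst by assumption.
      rewrite PC, (der_add _ d_zb_der), !(der_mul _ d_zb_der), !PC, d_zb_zetab.
      rewrite !slice_add, !slice_mul, !slice_add, !slice_mul, U1, U2, U1', U2', <- !slice_mul, <- !slice_add,
        <- !slice_mul, <- !slice_add.
      f_equal. rewrite !cst_mul. replace (RtoC 2) with (RtoC 1 + RtoC 1)%C by (rewrite <- RtoC_plus; f_equal;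
        ring).
      rewrite cst_add, cst_1. ring.
    + apply slice_pcomp; [exact BU|reflexivity].
  - assert (T : forall u, hol u -> exists m, slice (d_zb (d_zb (d_zb (star u)))) = slice (cst m)).
    { intros u Hu. eexists. apply slice_antihol. intros; unfold d_zb. rewrite (star_antihol u Hu) by lia.
      ring. }
    destruct (T u1 A3) as [m1 U1'']. destruct (T u2 A4) as [m2 U2''].
    exists m1, m2. transitivity (slice (pcomp (third_jet m1 m2) u1 u2)).
    + unfold third_jet. rewrite !pcomp_add, !pcomp_mul, !pcomp_cst by assumption.
      repeat (rewrite ?(der_add _ d_zb_der), ?(der_mul _ d_zb_der), ?PC, ?d_zb_zetab).
      repeat (rewrite ?slice_add, ?slice_mul). rewrite U1, U2, U1', U2', U1'', U2''.
      repeat (rewrite <- ?slice_mul, <- ?slice_add).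
      f_equal. rewrite !cst_mul, !cst_add, !cst_mul.
      replace (RtoC 6) with (RtoC 3 + RtoC 3)%C by (rewrite <- RtoC_plus; f_equal; ring).
      replace (RtoC 3) with (RtoC 1 + RtoC 2)%C by (rewrite <- RtoC_plus; f_equal; ring).
      replace (RtoC 2) with (RtoC 1 + RtoC 1)%C by (rewrite <- RtoC_plus; f_equal; ring).
      rewrite !cst_add, !cst_1. ring.
    + apply slice_pcomp; [exact BU|reflexivity].
Qed.
End Inv.
End Step.

(** * Levi rank one forces the model *)

Transparent mul4.
Lemma X1_mulE F a b c d : mul4 X1 F a b c d = match a with O => RtoC 0 | S a => F a b c d end.
Proof.
  destruct a.
  - exact (equal_f (equal_f (equal_f (pX_mul_0 R3 F) b) c) d).
  - exact (equal_f (equal_f (equal_f (pX_mul_S R3 F a) b) c) d).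
Qed.
Lemma X2_mulE F a b c d : mul4 X2 F a b c d = match b with O => RtoC 0 | S b => F a b c d end.
Proof.
  change (cmul (psr R3) (pinj R3 (pX R2)) F a b c d = match b with O => RtoC 0 | S b => F a b c d end).
  rewrite pinj_mul. destruct b.
  - exact (equal_f (equal_f (pX_mul_0 R2 (F a)) c) d).
  - exact (equal_f (equal_f (pX_mul_S R2 (F a) b) c) d).
Qed.
Lemma X3_mulE F a b c d : mul4 X3 F a b c d = match c with O => RtoC 0 | S c => F a b c d end.
Proof.
  change (cmul (psr R3) (pinj R3 (pinj R2 (pX R1))) F a b c d = match c with O => RtoC 0 | S c => F a b c d
    end).
  rewrite pinj_mul. unfold R3 at 1. rewrite pinj_mul. destruct c.
  - exact (equal_f (pX_mul_0 R1 (F a b)) d).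
  - exact (equal_f (pX_mul_S R1 (F a b) c) d).
Qed.
Lemma X4_mulE F a b c d : mul4 X4 F a b c d = match d with O => RtoC 0 | S d => F a b c d end.
Proof.
  change (cmul (psr R3) (pinj R3 (pinj R2 (pinj R1 (pX Cr)))) F a b c d = match d with O => RtoC 0 | S d => F
    a b c d end).
  rewrite pinj_mul. unfold R3 at 1. rewrite pinj_mul. unfold R2 at 1. rewrite pinj_mul. destruct d.
  - exact (pX_mul_0 Cr (F a b c)).
  - exact (pX_mul_S Cr (F a b c) d).
Qed.
Opaque mul4.

Lemma sum4E f n a b c d : sum4 f n a b c d = gsum Cr (fun i => f i a b c d) n.
Proof.
  unfold sum4, R4. rewrite gsum_pointwise. unfold R3. rewrite gsum_pointwise.
  unfold R2. rewrite gsum_pointwise. unfold R1. rewrite gsum_pointwise. reflexivity.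
Qed.

(* The coefficient of [z^a zbar^c], a series in [zeta] and [zetabar] only. *)
Definition fiber (a c : nat) (F : coef4) : coef4 :=
  fun i b k d => match i, k with O, O => F a b c d | _, _ => RtoC 0 end.

Lemma fiber_mul F G a c : fiber a c (mul4 F G) =
  sum4 (fun i => sum4 (fun k => mul4 (fiber i k F) (fiber (a - i) (c - k) G)) (S c)) (S a).
Proof.
  assert (V : forall F i k p b q d, (0 < p + q)%nat -> fiber i k F p b q d = RtoC 0)
    by (intros F' i k [|p] b [|q] d L; try reflexivity; lia).
  apply coef4_ext; intros p b q d. rewrite sum4E.
  destruct (Nat.eq_dec (p + q) 0) as [E|E].
  - replace p with 0%nat by lia. replace q with 0%nat by lia. cbn [fiber]. rewrite mul4E.
    apply (gsum_ext Cr); intros i _. rewrite sum4E, (gsum_swap Cr).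
    apply (gsum_ext Cr); intros k _. rewrite mul4E, (gsum_1 Cr).
    apply (gsum_ext Cr); intros j _. now rewrite (gsum_1 Cr).
  - rewrite V by lia. symmetry. apply (gsum_zero Cr); intros i _. rewrite sum4E.
    apply (gsum_zero Cr); intros k _. rewrite mul4E.
    do 4 (apply (gsum_zero Cr); intros).
    destruct (Nat.eq_dec (i0 + i2) 0).
    + rewrite (V G) by lia. apply Cmult_0_r.
    + rewrite (V F) by lia. apply Cmult_0_l.
Qed.

Local Open Scope s4_scope.

Lemma ord_mull n f g : ord n g -> ord n (f * g).
Proof. intros H. apply (ord_mul 0 n); [apply ord_any|exact H]. Qed.
Lemma ord_d_zeta n f : ord (S n) f -> ord n (d_zeta f).
Proof. intros H a b c d L. unfold d_zeta. rewrite H by lia. ring. Qed.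
Lemma ord_d_zetab n f : ord (S n) f -> ord n (d_zetab f).
Proof. intros H a b c d L. unfold d_zetab. rewrite H by lia. ring. Qed.

(** In f = u f - (u - 1) f the last term has one order more than [f], so the order climbs to n step
    by step. *)
Lemma ord_unit n u f : o4 u = RtoC 1 -> ord n (u * f) -> ord n f.
Proof.
  intros Hu H.
  assert (G : forall m, (m <= n)%nat -> ord m f); [|now apply G].
  induction m as [|m IH]; intros L; [apply ord_any|].
  assert (E : ord (S m) (u * f - (u - 1) * f)).
  { apply ord_sub; [apply (ord_le n); auto|]. apply (ord_mul 1 m); [|apply IH; lia].
    apply ord1_o4. change ((o4 u - RtoC 1)%C = RtoC 0). rewrite Hu. ring. }
  replace (u * f - (u - 1) * f) with f in E by ring. exact E.
Qed.

(** Series in zeta and zetabar alone that vanish when either variable does. On them [d_zeta] after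
    [d_zetab] is injective, as in a Goursat problem with zero data; [ord_laplace] is the
    quantitative form. *)
Definition no_pure (f : coef4) : Prop :=
  forall i b k d, (0 < i + k \/ b = 0 \/ d = 0)%nat -> f i b k d = RtoC 0.

Lemma no_pure_ord f : no_pure f -> ord 1 f.
Proof. intros H a b c d L; apply H; lia. Qed.

Lemma ord_laplace n f : no_pure f -> ord n (d_zeta (d_zetab f)) -> ord (S (S n)) f.
Proof.
  intros N H [|i] [|b] [|k] [|d] L; try (apply N; lia).
  apply (Cmult_eq_0_l _ _ (RtoC_INR_S d)). apply (Cmult_eq_0_l _ _ (RtoC_INR_S b)).
  apply (H 0 b 0 d)%nat. lia.
Qed.

Lemma ord_all f : (forall n, ord (S n) f) -> f = 0.
Proof. intros H. apply coef4_ext; intros a b c d. apply (H (a + b + c + d)%nat). lia. Qed.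

(** The series of 1 / (1 - zeta zetabar), which is the coefficient of z zbar in the model; [del0]
    and [eps0] are those of z^2 and zbar^2. *)
Definition gam0 : coef4 :=
  fun i b k d => match i, k with O, O => if (b =? d)%nat then RtoC 1 else RtoC 0 | _, _ => RtoC 0 end.
Definition half4 : coef4 := cst (RtoC (/ 2)).
Definition del0 : coef4 := half4 * (X4 * gam0).
Definition eps0 : coef4 := half4 * (X2 * gam0).

Lemma half4_two : half4 + half4 = 1.
Proof. unfold half4. rewrite <- cst_add, <- cst_1, <- RtoC_plus. do 2 f_equal. lra. Qed.

Lemma gam0_geom : gam0 = 1 + X2 * (X4 * gam0).
Proof.
  rewrite <- cst_1. apply coef4_ext; intros a b c d. rewrite add4E, X2_mulE, cstE.
  destruct b as [|b]; [|rewrite X4_mulE];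
    destruct a as [|a], c as [|c], d as [|d]; cbn [gam0 Nat.eqb]; ring.
Qed.

Lemma eps0_star : eps0 = star del0.
Proof.
  apply coef4_ext; intros a b c d. unfold star, eps0, del0, half4.
  rewrite !cst_mulE, X2_mulE, X4_mulE, Cmult_conj, Cconj_R. f_equal.
  destruct b as [|b]; [now rewrite Cconj_0|]. unfold gam0. rewrite (Nat.eqb_sym d b).
  destruct a, c, (b =? d)%nat; now rewrite Cconj_R.
Qed.

(** Obtained by differentiating (1 - zeta zetabar) gam0 = 1 and multiplying by [gam0], without any
    look at coefficients. *)
Lemma der_geom D p q : der4 D -> D (X2 * X4) = p -> p * gam0 = q -> D gam0 = q * gam0.
Proof.
  intros HD <- <-. assert (G := gam0_geom).
  assert (U : (1 - X2 * X4) * gam0 = 1).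
  { transitivity (gam0 - X2 * (X4 * gam0)); [ring|]. rewrite G at 1. ring. }
  assert (E : D gam0 = D (X2 * X4) * gam0 + X2 * X4 * D gam0).
  { rewrite G at 1. rewrite (der_add _ HD), <- cst_1, (der_cst _ HD).
    replace (X2 * (X4 * gam0)) with (X2 * X4 * gam0) by ring. rewrite (der_mul _ HD (X2 * X4)). ring. }
  transitivity ((1 - X2 * X4) * gam0 * D gam0); [rewrite U; ring|].
  transitivity (gam0 * (D gam0 - X2 * X4 * D gam0)); [ring|]. rewrite E at 1. ring.
Qed.

Lemma d_zeta_X4 : d_zeta X4 = 0.
Proof. apply coef4_ext; intros [|a] b [|c] d; apply Cmult_0_r. Qed.
Lemma d_zetab_X2 : d_zetab X2 = 0.
Proof. apply coef4_ext; intros [|a] [|[|b]] [|c] d; apply Cmult_0_r. Qed.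
Lemma d_zetab_X4 : d_zetab X4 = 1.
Proof.
  rewrite <- cst_1. apply coef4_ext; intros a b c d. unfold d_zetab. rewrite cstE.
  destruct a as [|a], b as [|b], c as [|c], d as [|d]; try apply Cmult_0_r. apply Cmult_1_l.
Qed.

(** These are the coefficients of z zbar and of z^2 in the vanishing of the Levi determinant of the
    model. The factors 2 come from differentiating z^2 and zbar^2. *)
Lemma model_equations :
  gam0 * d_zeta (d_zetab gam0) = (1 + 1) * (1 + 1) * (d_zetab del0 * d_zeta eps0)
    + d_zetab gam0 * d_zeta gam0 /\
  gam0 * d_zeta (d_zetab del0) = (1 + 1) * (d_zetab del0 * d_zeta gam0).
Proof.
  assert (G := gam0_geom).
  assert (K1 : d_zeta half4 = 0) by apply (der_cst _ d_zeta_der).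
  assert (K2 : d_zetab half4 = 0) by apply (der_cst _ d_zetab_der).
  assert (D1 : d_zeta gam0 = X4 * gam0 * gam0).
  { apply (der_geom _ X4); [apply d_zeta_der| |reflexivity].
    rewrite (der_mul _ d_zeta_der), d_zeta_X2, d_zeta_X4. ring. }
  assert (D2 : d_zetab gam0 = X2 * gam0 * gam0).
  { apply (der_geom _ X2); [apply d_zetab_der| |reflexivity].
    rewrite (der_mul _ d_zetab_der), d_zetab_X2, d_zetab_X4. ring. }
  assert (D3 : d_zetab del0 = half4 * (gam0 * gam0)).
  { unfold del0. rewrite !(der_mul _ d_zetab_der), K2, d_zetab_X4, D2.
    transitivity (half4 * (gam0 * (1 + X2 * (X4 * gam0)))); [ring|]. now rewrite <- G. }
  assert (D4 : d_zeta eps0 = half4 * (gam0 * gam0)).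
  { unfold eps0. rewrite !(der_mul _ d_zeta_der), K1, d_zeta_X2, D1.
    transitivity (half4 * (gam0 * (1 + X2 * (X4 * gam0)))); [ring|]. now rewrite <- G. }
  rewrite D3, D4, D2, !(der_mul _ d_zeta_der), K1, d_zeta_X2, D1.
  split; [|ring].
  transitivity (gam0 * gam0 * gam0 * (1 + X2 * (X4 * gam0)) + X2 * X4 * (gam0 * gam0 * gam0 * gam0)); [ring|].
  rewrite <- G.
  transitivity ((half4 + half4) * (half4 + half4) * (gam0 * gam0 * gam0 * gam0)
    + X2 * X4 * (gam0 * gam0 * gam0 * gam0)); [rewrite half4_two|]; ring.
Qed.

Section Rank.
Variable H : coef4.
Hypotheses (AH : adm H) (S0 : slice H = slice zero4) (S1 : slice (d_zb H) = slice X1)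
  (S2 : slice (d_zb (d_zb H)) = slice X2).

Lemma H_ab00 a b : H a b 0%nat 0%nat = RtoC 0.
Proof. exact (equal_f (equal_f S0 a) b). Qed.
Lemma H_ab10 a b : H a b 1%nat 0%nat = match a, b with 1, 0 => RtoC 1 | _, _ => RtoC 0 end%nat.
Proof.
  assert (E : d_zb H a b 0%nat 0%nat = X1 a b 0%nat 0%nat) by exact (equal_f (equal_f S1 a) b).
  rewrite X1E in E. unfold d_zb in E. change (RtoC (INR 1)) with (RtoC 1) in E.
  rewrite Cmult_1_l in E. rewrite E. destruct a as [|[|a]], b; reflexivity.
Qed.
Lemma H_ab20 a b : H a b 2%nat 0%nat = match a, b with 0, 1 => RtoC (/ 2) | _, _ => RtoC 0 end%nat.
Proof.
  assert (E : d_zb (d_zb H) a b 0%nat 0%nat = X2 a b 0%nat 0%nat) by exact (equal_f (equal_f S2 a) b).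
  rewrite X2E in E. unfold d_zb in E. change (RtoC (INR 1)) with (RtoC 1) in E.
  rewrite Cmult_1_l in E. cbn [INR] in E.
  assert (T : (RtoC (/ 2) * RtoC (1 + 1))%C = RtoC 1) by (rewrite <- RtoC_mult; f_equal; lra).
  transitivity (RtoC (/ 2) * RtoC (1 + 1) * H a b 2%nat 0%nat)%C; [rewrite T; ring|].
  rewrite <- Cmult_assoc, E. destruct a, b as [|[|b]]; ring.
Qed.
Lemma H_sym a b c d : H a b c d = Cconj (H c d a b).
Proof. apply (adm_herm H AH). Qed.

Lemma fiber_star a c : fiber a c H = star (fiber c a H).
Proof.
  apply coef4_ext; intros i b k d. unfold star, fiber.
  destruct i, k; rewrite ?Cconj_0; try reflexivity. apply H_sym.
Qed.

Let al := fiber 0 0 H.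
Let P := fiber 1 0 H.
Let gam := fiber 1 1 H.
Let del := fiber 2 0 H.

Lemma det_fiber a c :
  fiber a c (mul4 (d_z (d_zb H)) (d_zeta (d_zetab H))) = fiber a c (mul4 (d_z (d_zetab H)) (d_zeta (d_zb H))).
Proof.
  f_equal. assert (D := adm_det H AH). unfold levi_det in D.
  match type of D with sub4 ?A ?B = _ => transitivity (add4 (sub4 A B) B); [ring|rewrite D; ring] end.
Qed.

Lemma cst_INR : cst (RtoC (INR 1)) = 1 /\ cst (RtoC (INR 2)) = 1 + 1.
Proof. cbn [INR]. now rewrite RtoC_plus, cst_add, cst_1. Qed.

Ltac fiber_cases := apply coef4_ext; intros i b k d;
  rewrite ?cst_mulE; unfold fiber, d_z, d_zb, d_zeta, d_zetab; destruct i, k; ring.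
Lemma fiber_13 a c F : fiber a c (d_z (d_zb F)) =
  cst (RtoC (INR (S a))) * (cst (RtoC (INR (S c))) * fiber (S a) (S c) F).
Proof. fiber_cases. Qed.
Lemma fiber_14 a c F : fiber a c (d_z (d_zetab F)) = cst (RtoC (INR (S a))) * d_zetab (fiber (S a) c F).
Proof. fiber_cases. Qed.
Lemma fiber_23 a c F : fiber a c (d_zeta (d_zb F)) = cst (RtoC (INR (S c))) * d_zeta (fiber a (S c) F).
Proof. fiber_cases. Qed.
Lemma fiber_24 a c F : fiber a c (d_zeta (d_zetab F)) = d_zeta (d_zetab (fiber a c F)).
Proof. fiber_cases. Qed.

(** Expands the coefficient of z^a zbar^c in the Levi equation into products of fibers, and writes
    the fibers of zbar and zbar^2 as conjugates of [P] and [del]. *)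
Ltac levi_equation E a c :=
  pose proof (det_fiber a c) as E; rewrite !fiber_mul in E; unfold sum4 in E;
  cbn [gsum Nat.sub] in E; rewrite !fiber_13, !fiber_14, !fiber_23, !fiber_24 in E;
  rewrite ?(proj1 cst_INR), ?(proj2 cst_INR) in E;
  change (cadd R4) with add4 in E; change (c0 R4) with zero4 in E;
  change (@eq (car R4)) with (@eq coef4) in E;
  rewrite ?(fiber_star 0 1), ?(fiber_star 0 2) in E; fold al P gam del in E.

Lemma gam_00 : o4 gam = RtoC 1.
Proof. exact (H_ab10 1 0). Qed.

(** The normalised slices prescribe the pure powers of zeta in a fiber, and Hermitian symmetry those
    of zetabar: these are the boundary data of the Goursat problem. *)
Lemma no_pure_fiber a c M : (forall i b k d, (0 < i + k)%nat -> M i b k d = RtoC 0) ->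
  (forall b, H a b c 0 = M 0 b 0 0)%nat -> (forall d, Cconj (H c d a 0) = M 0 0 0 d)%nat ->
  no_pure (fiber a c H - M).
Proof.
  intros H1 H2 H3 i b k d L. rewrite sub4E.
  destruct (Nat.eq_dec (i + k) 0) as [E|E].
  - replace i with 0%nat by lia. replace k with 0%nat by lia.
    destruct L as [L|[->| ->]]; [lia| |]; cbn [fiber]; [rewrite H_sym, H3|rewrite H2]; ring.
  - rewrite H1 by lia. unfold fiber. destruct i, k; try lia; ring.
Qed.

Lemma no_pure_al : no_pure al.
Proof.
  replace al with (al - 0) by ring.
  apply no_pure_fiber; intros; [reflexivity|apply H_ab00|rewrite H_ab00; apply Cconj_0].
Qed.
Lemma no_pure_P : no_pure P.
Proof.
  replace P with (P - 0) by ring.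
  apply no_pure_fiber; intros; [reflexivity|apply H_ab00|rewrite H_ab10; apply Cconj_0].
Qed.
Lemma no_pure_gam : no_pure (gam - gam0).
Proof.
  apply no_pure_fiber; [intros [|i] b [|k] d L; try reflexivity; lia| |]; intros [|n];
    rewrite H_ab10; apply Cconj_R || reflexivity.
Qed.
Lemma no_pure_del : no_pure (del - del0).
Proof.
  assert (E : forall i b k d, del0 i b k d = Cmult (RtoC (/ 2)) (match d with O => RtoC 0 | S d => gam0 i b k
    d end))
    by (intros; unfold del0, half4; now rewrite cst_mulE, X4_mulE).
  apply no_pure_fiber; intros; rewrite E.
  - destruct i, k, d; try lia; apply Cmult_0_r.
  - rewrite H_ab00; ring.
  - rewrite H_ab20. destruct d as [|[|d]]; cbn; rewrite Cconj_R; ring.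
Qed.

(** The Levi equations at 1 and at z express the mixed derivatives of [al] and [P] by terms that
    each contain a derivative of [al], of [P] or of its conjugate. Such a homogeneous system has
    only the zero solution: the order lost to a first derivative is more than regained by
    [ord_laplace]. *)
Lemma low_orders n : ord (S n) al /\ ord (S n) P.
Proof.
  induction n as [|n (I1 & I2)].
  - split; apply no_pure_ord; [apply no_pure_al|apply no_pure_P].
  - assert (I3 : ord n (d_zeta (star P))) by (apply ord_d_zeta, star_ord, I2).
    assert (A : ord n (d_zeta (d_zetab al))).
    { apply (ord_unit n gam); [apply gam_00|]. levi_equation E 0%nat 0%nat.
      replace (gam * d_zeta (d_zetab al)) with (d_zetab P * d_zeta (star P)).
      - now apply ord_mull.
      - match type of E with ?L = ?R => transitivity R; [ring|rewrite <- E; ring] end. }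
    split; apply ord_laplace; [apply no_pure_al|exact A|apply no_pure_P|].
    apply (ord_unit n gam); [apply gam_00|]. levi_equation E 1%nat 0%nat.
    replace (gam * d_zeta (d_zetab P)) with
      ((1 + 1) * d_zetab del * d_zeta (star P) + d_zeta gam * d_zetab P
        - (1 + 1) * fiber 2 1 H * d_zeta (d_zetab al)).
    + apply ord_sub; [apply ord_add|]; apply ord_mull; auto using ord_d_zetab.
    + match type of E with ?L = ?R =>
        transitivity (R - (1 + 1) * fiber 2 1 H * d_zeta (d_zetab al)); [ring|rewrite <- E; ring] end.
Qed.

Lemma low_zero : al = 0 /\ P = 0.
Proof. split; apply ord_all; intros n; apply low_orders. Qed.

Lemma star_zero : star 0 = 0.
Proof. apply coef4_ext; intros. apply Cconj_0. Qed.

Lemma rank_equations :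
  gam * d_zeta (d_zetab gam) = (1 + 1) * (1 + 1) * (d_zetab del * d_zeta (star del))
    + d_zetab gam * d_zeta gam /\
  gam * d_zeta (d_zetab del) = (1 + 1) * (d_zetab del * d_zeta gam).
Proof.
  destruct low_zero as (Z1 & Z2).
  assert (D0 := der4_zero _ d_zeta_der). assert (D0' := der4_zero _ d_zetab_der).
  split; [levi_equation E 1%nat 1%nat|levi_equation E 2%nat 0%nat];
    rewrite Z1, Z2, star_zero, !D0', !D0 in E;
    match type of E with ?L = ?R => transitivity L; [ring|rewrite E; ring] end.
Qed.

(** Subtracting [model_equations] from [rank_equations] leaves a system in which every term contains
    a difference from the model or a first derivative of one. As in [low_orders], each round gains
    an order. *)
Lemma quad_orders n : ord (S n) (gam - gam0) /\ ord (S n) (del - del0).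
Proof.
  induction n as [|n (I1 & I2)].
  - split; apply no_pure_ord; [apply no_pure_gam|apply no_pure_del].
  - destruct rank_equations as (R1' & R2'). destruct model_equations as (M1 & M2).
    assert (I3 : ord (S n) (star del - eps0)).
    { rewrite eps0_star. intros a b c d L. specialize (I2 c d a b ltac:(lia)). rewrite sub4E in *.
      unfold star. rewrite <- Cconj_0, <- I2. unfold Cminus. now rewrite Cplus_conj, Copp_conj. }
    assert (A1 := ord_d_zeta _ _ I1). assert (B1 := ord_d_zetab _ _ I1).
    assert (B2 := ord_d_zetab _ _ I2). assert (A3 := ord_d_zeta _ _ I3).
    assert (I1' := ord_le (S n) n _ (le_S _ _ (le_n n)) I1).
    assert (Sz := fun F G => derivation_sub R4 d_zeta F G (der4_derivation _ d_zeta_der)).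
    assert (Szb := fun F G => derivation_sub R4 d_zetab F G (der4_derivation _ d_zetab_der)).
    change (csub R4) with sub4 in Sz, Szb.
    rewrite Sz in A1, A3. rewrite Szb in B1, B2.
    split; (apply ord_laplace; [first [apply no_pure_gam|apply no_pure_del]|]);
      (apply (ord_unit n gam); [apply gam_00|]); rewrite Szb, Sz.
    + replace (gam * (d_zeta (d_zetab gam) - d_zeta (d_zetab gam0))) with
        (((1 + 1) * (1 + 1) * d_zeta (star del) * (d_zetab del - d_zetab del0)
          + (1 + 1) * (1 + 1) * d_zetab del0 * (d_zeta (star del) - d_zeta eps0))
        + (d_zeta gam * (d_zetab gam - d_zetab gam0) + d_zetab gam0 * (d_zeta gam - d_zeta gam0))
        - d_zeta (d_zetab gam0) * (gam - gam0)).
      * apply ord_sub; [apply ord_add; apply ord_add|]; apply ord_mull; assumption.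
      * transitivity (gam * d_zeta (d_zetab gam) - gam0 * d_zeta (d_zetab gam0) - d_zeta (d_zetab gam0) *
        (gam - gam0));
          [rewrite R1', M1|]; ring.
    + replace (gam * (d_zeta (d_zetab del) - d_zeta (d_zetab del0))) with
        ((1 + 1) * d_zeta gam * (d_zetab del - d_zetab del0) + (1
          + 1) * d_zetab del0 * (d_zeta gam - d_zeta gam0)
        - d_zeta (d_zetab del0) * (gam - gam0)).
      * apply ord_sub; [apply ord_add|]; apply ord_mull; assumption.
      * transitivity (gam * d_zeta (d_zetab del) - gam0 * d_zeta (d_zetab del0) - d_zeta (d_zetab del0) *
        (gam - gam0));
          [rewrite R2', M2|]; ring.
Qed.

Definition model_coef (a b c d : nat) : C :=
  match a, c with
  | 1, 1 => if (b =? d) then RtoC 1 else RtoC 0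
  | 2, 0 => if (S b =? d) then RtoC (/ 2) else RtoC 0
  | 0, 2 => if (b =? S d) then RtoC (/ 2) else RtoC 0
  | _, _ => RtoC 0
  end%nat.

Theorem rank_one_model a b c d : (a + c < 3)%nat -> H a b c d = model_coef a b c d.
Proof.
  destruct low_zero as (Z1 & Z2).
  assert (W : forall f g : coef4, (forall n, ord (S n) (f - g)) -> (forall b d, f 0 b 0 d = g 0 b 0 d)%nat).
  { intros f g E i j. apply ord_all in E. replace f with (f - g + g) by ring. rewrite E, add4E.
    apply Cplus_0_l. }
  assert (Y1 := W gam gam0 (fun n => proj1 (quad_orders n))).
  assert (Y2 := W del del0 (fun n => proj2 (quad_orders n))).
  assert (Y3 : forall b d, (H 2 b 0 d = model_coef 2 b 0 d)%nat).
  { intros i j. change (del 0 i 0 j = model_coef 2 i 0 j)%nat. rewrite Y2. unfold del0, half4.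
    rewrite cst_mulE, X4_mulE. unfold model_coef, gam0. destruct j as [|j]; [apply Cmult_0_r|].
    cbn [Nat.eqb]. destruct (i =? j)%nat; ring. }
  assert (Y4 : forall b d, H 1%nat b 0%nat d = RtoC 0) by
    (intros i j; exact (equal_f (equal_f (equal_f (equal_f Z2 0) i) 0) j)%nat).
  intros L. destruct a as [|[|[|a]]], c as [|[|[|c]]]; try lia.
  - exact (equal_f (equal_f (equal_f (equal_f Z1 0) b) 0) d)%nat.
  - rewrite H_sym, Y4. apply Cconj_0.
  - rewrite H_sym, Y3. unfold model_coef. rewrite (Nat.eqb_sym b). destruct (S d =? b)%nat; apply Cconj_R.
  - apply Y4.
  - exact (Y1 b d).
  - apply Y3.
Qed.
End Rank.
Close Scope s4_scope.

(** * Choice of the curve *)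

Ltac ringC := match goal with |- @eq _ ?a ?b => change (@eq C a b); ring end.

(** Everything short of condition (3): the slices encode condition (2), and [rank_one_model] derives
    agreement with the model for a + c < 3. *)
Record prenormal (H : coef4) : Prop := {
  pn_adm : adm H;
  pn_0 : slice H = slice zero4;
  pn_1 : slice (d_zb H) = slice X1;
  pn_2 : slice (d_zb (d_zb H)) = slice X2 }.

Lemma jac_slices f g : jac f g = ((slice f 1 0)%nat * (slice g 0 1)%nat - (slice f 0 1)%nat * (slice g 1
  0)%nat)%C.
Proof. unfold jac. now rewrite !o4_d_z, !o4_d_zeta. Qed.

Lemma RtoC2 : RtoC 2 = (1 + 1)%C.
Proof. rewrite <- RtoC_plus; f_equal; ring. Qed.
Lemma RtoC3 : RtoC 3 = (1 + 2)%C.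
Proof. rewrite <- RtoC_plus; f_equal; ring. Qed.
Lemma RtoC6 : RtoC 6 = (3 + 3)%C.
Proof. rewrite <- RtoC_plus; f_equal; ring. Qed.
Lemma RtoC_half : (RtoC (/ 2) + RtoC (/ 2))%C = 1.
Proof. rewrite <- RtoC_plus; f_equal; lra. Qed.
Lemma RtoC6_neq : RtoC 6 <> 0.
Proof. intros H; apply RtoC_inj in H; lra. Qed.

Lemma first_jetE F be a b : first_jet F be a b 0%nat 0%nat =
  ((F a b 1 0)%nat + be * (F a b 0 1)%nat)%C.
Proof. unfold first_jet. rewrite add4E, cst_mulE. unfold d_zb, d_zetab. cbn [INR]. ringC. Qed.

Lemma second_jetE F be al2 be2 a b : second_jet F be al2 be2 a b 0%nat 0%nat =
  (2 * ((F a b 2 0)%nat + be * (F a b 1 1)%nat + be * be * (F a b 0 2)%nat + (al2 * (F a b 1 0)%nat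
    + be2 * (F a b 0 1)%nat)))%C.
Proof.
  unfold second_jet. rewrite !add4E, !cst_mulE. unfold d_zb, d_zetab. cbn [INR].
  change (RtoC (1 + 1)) with (RtoC 2). ringC.
Qed.

Lemma third_jetE F be al2 be2 m1 m2 a b : third_jet F be al2 be2 m1 m2 a b 0%nat 0%nat =
  (6 * ((F a b 3 0)%nat + be * (F a b 2 1)%nat + (be * be * (F a b 1 2)%nat
    + be * (be * be) * (F a b 0 3)%nat) + (2 * (al2 * (F a b 2 0)%nat) + ((be2 + al2 * be) * (F a b 1 1)%nat
      + 2 * (be * be2 * (F a b 0 2)%nat)))) + (m1 * (F a b 1 0)%nat + m2 * (F a b 0 1)%nat))%C.
Proof.
  unfold third_jet. rewrite !add4E, !cst_mulE. unfold d_zb, d_zetab. cbn [INR].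
  replace (RtoC (1 + 1 + 1)) with (RtoC 3) by (f_equal; ring).
  replace (RtoC (1 + 1)) with (RtoC 2) by (f_equal; ring).
  rewrite RtoC6, RtoC3, RtoC2. ringC.
Qed.

Lemma normalize_step F be al2 be2 : adm F -> slice F = slice zero4 ->
  let f := hlift (slice (first_jet F be)) in
  let g := hlift (slice (second_jet F be al2 be2)) in
  jac f g <> 0 ->
  curve_condition be al2 be2 (slice (first_jet F be)) (RtoC 1) ->
  curve_condition be al2 be2 (slice (second_jet F be al2 be2)) (RtoC 0) ->
  exists u1 u2, biholo u1 u2 /\ hcomp f u1 u2 = X1 /\ hcomp g u1 u2 = X2 /\
    equiv_by f g F (pcomp F u1 u2) /\ prenormal (pcomp F u1 u2) /\
    exists m1 m2, slice (d_zb (d_zb (d_zb (pcomp F u1 u2)))) =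
      slice (hcomp (hlift (slice (third_jet F be al2 be2 m1 m2))) u1 u2).
Proof.
  intros AF SF f g J Kf Kg.
  assert (BF : biholo f g) by now apply jets_biholo.
  destruct (biholo_inverse f g BF) as (u1 & u2 & BU & E1 & E2).
  destruct (target_slices F be al2 be2 SF J Kf Kg u1 u2 BU E1 E2) as (T0 & T1 & T2 & T3).
  exists u1, u2. do 3 (split; [assumption|]). split; [|split; [|exact T3]].
  - apply equiv_pcomp; auto. apply AF.
  - constructor; auto. now apply adm_pcomp.
Qed.

Lemma slice_eq_coef F G a b : slice F = slice G -> F a b 0%nat 0%nat = G a b 0%nat 0%nat.
Proof. intros H. exact (equal_f (equal_f H a) b). Qed.

(** The first change uses a curve with be = 0, which is tangent to the zbar-axis. This suits the
    first condition on [f] because the coefficient of z zbar is 1. *)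
Lemma phase_linear F : adm F -> slice F = slice zero4 -> (F 1 0 1 0)%nat = 1 ->
  ((F 0 1 2 0)%nat - (F 0 1 1 0)%nat * (F 1 0 2 0)%nat)%C <> 0 ->
  exists f g F', equiv_by f g F F' /\ prenormal F'.
Proof.
  intros AF SF F1 ND.
  set (mu := (F 0 1 1 0)%nat) in *.
  (* [tau] turns out to be the Jacobian of (f, g) at the origin, nonzero by 2-nondegeneracy. *)
  set (tau := (2 * ((F 0 1 2 0)%nat - mu * (F 1 0 2 0)%nat))%C).
  set (kap := ((F 2 0 2 0)%nat - (F 1 0 2 0)%nat * (F 2 0 1 0)%nat)%C).
  assert (Ht : tau <> RtoC 0).
  { apply Cmult_neq_0; [|exact ND]. intros Q; apply RtoC_inj in Q; lra. }
  assert (Hs := adm_herm F AF).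
  assert (M : (F 1 0 0 1)%nat = Cconj mu) by apply Hs.
  assert (F01 : (F 0 1 0 1)%nat = (Cconj mu * mu)%C).
  { assert (D : o4 (levi_det F) = 0) by now rewrite (adm_det F AF).
    unfold levi_det in D. change ((o4 (mul4 (d_z (d_zb F)) (d_zeta (d_zetab F))) - o4 (mul4 (d_z (d_zetab F))
      (d_zeta (d_zb F))))%C = 0) in D.
    rewrite !o4_mul in D. unfold o4, d_z, d_zb, d_zeta, d_zetab in D. cbn [INR] in D.
    rewrite F1, M in D. fold mu in D.
    match type of D with (?A - ?B)%C = _ => transitivity (A - B + B)%C; [ringC|rewrite D; ringC] end. }
  assert (Ct : Cconj tau = (2 * ((F 2 0 0 1)%nat - Cconj mu * (F 2 0 1 0)%nat))%C).
  { unfold tau, Cminus. rewrite Cmult_conj, Cplus_conj, Copp_conj, Cmult_conj, Cconj_R.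
    rewrite <- (Hs 0 1 2 0)%nat, <- (Hs 1 0 2 0)%nat. reflexivity. }
  assert (Ck : Cconj kap = kap).
  { unfold kap, Cminus. rewrite Cplus_conj, Copp_conj, Cmult_conj.
    rewrite <- (Hs 2 0 2 0)%nat, <- (Hs 1 0 2 0)%nat, <- (Hs 2 0 1 0)%nat. ringC. }
  assert (Ht' : Cconj tau <> 0).
  { intros Q. apply Ht. rewrite <- (Cconj_conj tau), Q. apply Cconj_0. }
  (* The second condition on [g] reads be2 conj(tau) + conj(be2) tau = - 2 kap. As [kap] is real,
     making each of the two conjugate terms equal to - kap solves it. *)
  set (be2 := (- (kap / Cconj tau))%C).
  assert (B1 : (be2 * Cconj tau)%C = (- kap)%C) by (unfold be2; field; exact Ht').
  assert (B2 : (Cconj be2 * tau)%C = (- kap)%C).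
  { rewrite <- (Cconj_conj tau), <- Cmult_conj, B1, Copp_conj, Ck. reflexivity. }
  (* This cancels the z-coefficient of the second jet, the first condition on [g]. By Hermitian
     symmetry the same value meets the second condition on [f]. *)
  set (al2 := (- ((F 1 0 2 0)%nat + be2 * Cconj mu))%C).
  assert (A2 : Cconj al2 = (- ((F 2 0 1 0)%nat + Cconj be2 * mu))%C).
  { unfold al2. rewrite Copp_conj, Cplus_conj, Cmult_conj, Cconj_conj, <- (Hs 1 0 2 0)%nat. reflexivity. }
  assert (G10 : slice (second_jet F (RtoC 0) al2 be2) 1%nat 0%nat = RtoC 0).
  { unfold slice. rewrite second_jetE, F1, M. unfold al2. ringC. }
  assert (G01 : slice (second_jet F (RtoC 0) al2 be2) 0%nat 1%nat = tau).
  { unfold slice. rewrite second_jetE, F01. fold mu. unfold al2, tau. ringC. }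
  assert (E10 : slice (first_jet F (RtoC 0)) 1%nat 0%nat = RtoC 1).
  { unfold slice. rewrite first_jetE, F1. ringC. }
  assert (E01 : slice (first_jet F (RtoC 0)) 0%nat 1%nat = mu).
  { unfold slice. rewrite first_jetE. fold mu. ringC. }
  destruct (normalize_step F (RtoC 0) al2 be2 AF SF) as (u1 & u2 & BU & E1 & E2 & EQ & PN & _).
  - rewrite jac_slices, !slice_hlift, G10, G01, E10. replace (_ - _)%C with tau by ringC. exact Ht.
  - split.
    + rewrite E10, Cconj_0. ringC.
    + rewrite E10, E01, Cconj_0, A2. unfold slice. rewrite (first_jetE _ _ 2 0). ringC.
  - split.
    + rewrite G10, Cconj_0. ringC.
    + rewrite G10, G01, Cconj_0.
      assert (G20 : slice (second_jet F (RtoC 0) al2 be2) 2%nat 0%nat = (2 * kap + be2 * Cconj tau)%C).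
      { unfold slice. rewrite second_jetE, Ct. unfold al2, kap. ringC. }
      rewrite G20, B1.
      transitivity (Cconj be2 * tau + (2 * kap - kap))%C; [ringC|].
      rewrite B2, RtoC2. ringC.
  - eauto 6.
Qed.

Section Phases.
Variable H : coef4.
Hypothesis PN : prenormal H.
Let AH := pn_adm H PN.
Let S0 := pn_0 H PN.
Let S1 := pn_1 H PN.
Let S2 := pn_2 H PN.

Lemma pn_model a b c d : (a + c < 3)%nat -> H a b c d = model_coef a b c d.
Proof. now apply rank_one_model. Qed.
Lemma pn_ab20 a b : H a b 2%nat 0%nat = match a, b with 0, 1 => RtoC (/ 2) | _, _ => RtoC 0 end%nat.
Proof. now apply H_ab20. Qed.
Lemma pn_ab10 a b : H a b 1%nat 0%nat = match a, b with 1, 0 => RtoC 1 | _, _ => RtoC 0 end%nat.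
Proof. now apply H_ab10. Qed.
Lemma pn_2011 : (H 2 0 1 1)%nat = 0.
Proof. rewrite (H_sym H AH), pn_ab20. apply Cconj_0. Qed.

Ltac pn_low :=
  repeat match goal with |- context [H ?a ?b ?c ?d] => rewrite (pn_model a b c d) by lia end;
  unfold model_coef; cbn [Nat.eqb].
Ltac pn_values :=
  rewrite ?pn_ab20, ?pn_ab10, ?pn_2011;
  pn_low.

Lemma coef_d_zb3 (K : coef4) a b : slice (d_zb (d_zb (d_zb K))) a b = (6 * (K a b 3 0)%nat)%C.
Proof.
  unfold slice, d_zb. cbn [INR]. replace (RtoC (1 + 1 + 1)) with (RtoC 3) by (f_equal; ring).
  replace (RtoC (1 + 1)) with (RtoC 2) by (f_equal; ring). rewrite RtoC6, RtoC3, RtoC2. ringC.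
Qed.

(** On a prenormal series the curve conditions reduce to conj(be) = - 2 al2 and one real equation on
    [be2]; [h] parametrises the solutions of the former. The effect on [H 1 1 3 0] is recorded for h
    = 0, where the 2-jet of the inverse map is simple. *)
Lemma phase_prenormal h be2 : (be2 + Cconj be2)%C = (- (RtoC 10 * (h * Cconj h)))%C ->
  exists f g F', equiv_by f g H F' /\ prenormal F' /\
    (F' 0 1 3 0)%nat = ((H 0 1 3 0)%nat - h)%C /\
    (h = RtoC 0 -> (F' 1 1 3 0)%nat = ((H 1 1 3 0)%nat + be2)%C).
Proof.
  intros Hb2. set (be := (2 * Cconj h)%C). set (al2 := (- h)%C).
  assert (Cb : Cconj be = (2 * h)%C) by (unfold be; now rewrite Cmult_conj, Cconj_conj, Cconj_R).
  assert (Ca : Cconj al2 = (- Cconj h)%C) by (unfold al2; now rewrite Copp_conj).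
  assert (HF := RtoC_half).
  assert (f2 : forall x, (RtoC 2 * (x * RtoC (/ 2)))%C = x)
    by (intros x; transitivity (x * (RtoC (/ 2) + RtoC (/ 2)))%C; [rewrite RtoC2|rewrite HF]; ringC).
  set (f := slice (first_jet H be)). set (g := slice (second_jet H be al2 be2)).
  assert (f10 : f 1%nat 0%nat = RtoC 1) by (unfold f, slice; rewrite first_jetE; pn_values; ringC).
  assert (f01 : f 0%nat 1%nat = RtoC 0) by (unfold f, slice; rewrite first_jetE; pn_values; ringC).
  assert (f20 : f 2%nat 0%nat = (be * RtoC (/ 2))%C) by (unfold f, slice; rewrite first_jetE; pn_values;
    ringC).
  assert (f11 : f 1%nat 1%nat = RtoC 0) by (unfold f, slice; rewrite first_jetE; pn_values; ringC).
  assert (f02 : f 0%nat 2%nat = RtoC 0) by (unfold f, slice; rewrite first_jetE; pn_values; ringC).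
  assert (g10 : g 1%nat 0%nat = (2 * al2)%C) by (unfold g, slice; rewrite second_jetE; pn_values; ringC).
  assert (g01 : g 0%nat 1%nat = RtoC 1) by (unfold g, slice; rewrite second_jetE; pn_values;
    etransitivity; [|apply f2]; ringC).
  assert (g20 : g 2%nat 0%nat = be2) by (unfold g, slice; rewrite second_jetE; pn_values;
    etransitivity; [|apply f2]; ringC).
  assert (g11 : g 1%nat 1%nat = (2 * be)%C) by (unfold g, slice; rewrite second_jetE; pn_values; ringC).
  assert (g02 : g 0%nat 2%nat = RtoC 0) by (unfold g, slice; rewrite second_jetE; pn_values; ringC).
  assert (J : jac (hlift f) (hlift g) <> 0).
  { rewrite jac_slices, !slice_hlift, f10, f01, g01. replace (_ - _)%C with (RtoC 1) by ringC.
    intros Q; apply RtoC_inj in Q; lra. }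
  assert (Kf : curve_condition be al2 be2 f (RtoC 1)).
  { split; rewrite f10, f01; [ringC|]. rewrite f20, f11, f02, Ca. unfold be.
    transitivity (RtoC 2 * (Cconj h * RtoC (/ 2)) - Cconj h)%C; [|rewrite f2]; ringC. }
  assert (Kg : curve_condition be al2 be2 g (RtoC 0)).
  (* The constant 10 is 2 + 8: the term [g10] times conj(al2) contributes 2 h conj(h), and [g11]
     times conj(be) contributes 8 h conj(h). *)
  { split; rewrite g10, g01, Cb; [unfold al2; ringC|]. rewrite g20, g11, g02, Ca. unfold al2, be.
    transitivity (be2 + Cconj be2 + RtoC 10 * (h * Cconj h))%C; [|rewrite Hb2; ringC].
    replace (RtoC 10) with (2 * (1 + 2 * 2))%C
      by (rewrite <- RtoC_mult, <- RtoC_plus, <- RtoC_mult; f_equal; ring). ringC. }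
  destruct (normalize_step H be al2 be2 AH S0 J Kf Kg) as (u1 & u2 & BU & E1 & E2 & EQ & PN' & m1 & m2 & T3).
  exists (hlift f), (hlift g), (pcomp H u1 u2). do 2 (split; [assumption|]).
  assert (O1 := bh_ord1 _ _ BU). assert (O2 := bh_ord2 _ _ BU).
  set (T := slice (third_jet H be al2 be2 m1 m2)) in T3.
  assert (V : forall k, o4 (d_zeta (hcomp (hlift k) u1 u2)) =
    ((k 1 0)%nat * o4 (d_zeta u1) + (k 0 1)%nat * o4 (d_zeta u2))%C).
  { intros k. rewrite (hcomp_chain _ _ _ _ O1 O2 d_zeta_der), o4_add, !o4_mul, !o4_hcomp.
    now rewrite (o4_d_z (hlift k)), (o4_d_zeta (hlift k)). }
  (* The zeta-derivatives of f(u) = z and g(u) = zeta give u_zeta = (0, 1) at the origin, so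
     composing with u keeps the zeta-coefficient of [T]. *)
  assert (V1 := V f). fold f in E1. rewrite E1, d_zeta_X1, f10, f01 in V1.
  assert (V2 := V g). fold g in E2. rewrite E2, d_zeta_X2, g10, g01 in V2.
  assert (W1 : o4 (d_zeta u1) = 0) by (transitivity (o4 zero4); [rewrite V1; ringC|reflexivity]).
  assert (W2 : o4 (d_zeta u2) = 1) by (transitivity (o4 one4); [rewrite V2, W1; ringC|reflexivity]).
  assert (Z : forall x y, (6 * x)%C = (6 * y)%C -> x = y).
  { intros x y E. replace x with (x - y + y)%C by ringC.
    rewrite (Cmult_eq_0_l _ (x - y)%C RtoC6_neq); [ringC|].
    transitivity (6 * x - 6 * y)%C; [|rewrite E]; ringC. }
  (* The shift by - h is 2 al2 times [H 0 1 2 0], which is 1/2 in the model; the other terms,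
     including those with [m1] and [m2], meet zero coefficients. *)
  assert (T01 : T 0%nat 1%nat = (6 * ((H 0 1 3 0)%nat - h))%C).
  { unfold T, slice. rewrite third_jetE, pn_ab20. pn_low. unfold al2.
    transitivity (RtoC 6 * ((H 0 1 3 0)%nat - RtoC 2 * (h * RtoC (/ 2))))%C; [|rewrite f2]; ringC. }
  split.
  - apply Z. rewrite <- coef_d_zb3, T3, <- T01.
    transitivity (o4 (d_zeta (hcomp (hlift T) u1 u2))); [now rewrite o4_d_zeta|]. rewrite V, W1, W2. ringC.
  - intros h0.
    destruct (inverse_jet1 H be al2 be2 J Kf Kg u1 u2 BU E1 E2) as [W3 W4].
    rewrite Cb, h0, Cmult_0_r in W4.
    assert (C2 : forall k, o4 (d_z (d_zeta (hcomp (hlift k) u1 u2))) =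
      ((k 1 0)%nat * o4 (d_z (d_zeta u1)) + (k 0 1)%nat * o4 (d_z (d_zeta u2)) + (k 1 1)%nat)%C).
    { intros k. rewrite (chain2 u1 u2 BU _ _ _ d_zeta_der d_z_der), W1, W2, W3, W4.
      rewrite (o4_d_z (hlift k)), (o4_d_zeta (hlift k)), (o4_dzzeta (hlift k)). unfold hlift. ringC. }
    assert (b0 : be = RtoC 0) by (unfold be; rewrite h0, Cconj_0; ringC).
    assert (a0 : al2 = RtoC 0) by (unfold al2; rewrite h0; ringC).
    assert (C3 := C2 f). rewrite E1, d_zeta_X1, f10, f01, f11 in C3.
    assert (C4 := C2 g). rewrite E2, d_zeta_X2, g10, g01, g11, a0, b0 in C4.
    (* For h = 0 the mixed second derivatives of u vanish at the origin, so the z zeta coefficient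
       of [T] is also unchanged by composition with u. *)
    assert (W5 : o4 (d_z (d_zeta u1)) = 0).
    { transitivity (o4 (d_z zero4)); [rewrite C3; ringC|]. now rewrite (der4_zero _ d_z_der). }
    assert (W6 : o4 (d_z (d_zeta u2)) = 0).
    { transitivity (o4 (d_z one4)); [rewrite C4; ringC|]. rewrite <- cst_1, (der_cst _ d_z_der).
      reflexivity. }
    (* Here [be2] multiplies [H 1 1 1 1], which equals 1 in the model. *)
    assert (T11 : T 1%nat 1%nat = (6 * ((H 1 1 3 0)%nat + be2))%C).
    { unfold T, slice. rewrite third_jetE, b0, a0, pn_ab20. pn_low. ringC. }
    apply Z. rewrite <- coef_d_zb3, T3, <- T11.
    transitivity (o4 (d_z (d_zeta (hcomp (hlift T) u1 u2)))); [now rewrite o4_dzzeta|].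
    rewrite C2, W5, W6. ringC.
Qed.
End Phases.

(** * The model as a convergent power series, and evaluation of holomorphic series *)

Lemma cv_gam0 : convergent4 gam0.
Proof.
  apply convergent4E. exists (/ 2), 2. split; [lra|]. intros N.
  assert (T := nrm_tnorm (/ 2) ltac:(lra)).
  (* Norms taken at radius 1/2 in gam0 = 1 + zeta zetabar gam0. A truncated norm is a finite number,
     so the quarter can be moved to the left, leaving a bound independent of [N]. *)
  assert (G : nrm (/ 2) N gam0 <= 1 + / 2 * (/ 2 * nrm (/ 2) N gam0)).
  { rewrite gam0_geom at 1. eapply Rle_trans; [apply (tn_add R4 _ T)|].
    apply Rplus_le_compat; [apply (tn_1 R4 _ T)|].
    assert (P := tn_ge0 R4 _ T N gam0).
    eapply Rle_trans; [apply (tn_mul R4 _ T)|].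
    apply Rmult_le_compat; try apply (tn_ge0 R4 _ T); [apply nrm_X; lra|].
    eapply Rle_trans; [apply (tn_mul R4 _ T)|].
    apply Rmult_le_compat_r; [exact P|]. apply nrm_X; lra. }
  lra.
Qed.

Definition model_poly : coef4 :=
  (X1 * X3 + (half4 * ((X1 * X1) * X4) + half4 * ((X3 * X3) * X2)))%s4.
Definition model4 : coef4 := fun a b c d => model_coef a b c d.

Lemma model4E : model4 = mul4 model_poly gam0.
Proof.
  transitivity (X1 * (X3 * gam0) + (half4 * (X1 * (X1 * (X4 * gam0)))
    + half4 * (X3 * (X3 * (X2 * gam0)))))%s4;
    [|unfold model_poly; ring].
  apply coef4_ext; intros a b c d. rewrite !add4E. unfold half4. rewrite !cst_mulE.
  unfold model4, model_coef.
  destruct a as [|[|[|a]]], c as [|[|[|c]]], b as [|b], d as [|d];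
  do 4 (rewrite ?X1_mulE, ?X3_mulE, ?X4_mulE, ?X2_mulE; cbv beta iota);
  unfold gam0; cbn [Nat.eqb];
  repeat match goal with |- context [if ?e then _ else _] => destruct e end; ring.
Qed.

Lemma rep_X : rep X1 (fun z _ => z) /\ rep X2 (fun _ zeta => zeta) /\
  rep X3 (fun z _ => Cconj z) /\ rep X4 (fun _ zeta => Cconj zeta).
Proof.
  assert (R : forall F phi, convergent4 F -> (forall z zeta, evalF F z zeta = phi z zeta) -> rep F phi)
    by (intros F phi HF H; split; [exact HF|exists 1; split; [lra|auto]]).
  destruct cv_X as (C1 & C2 & C3 & C4).
  split; [|split; [|split]]; (apply R; [|apply evalF_X]).
  - exact C1.
  - exact C2.
  - exact C3.
  - exact C4.
Qed.

Lemma rep_star F phi : rep F phi -> rep (star F) (fun z zeta => Cconj (phi z zeta)).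
Proof.
  intros [HF NF]. split; [now apply star_cv|].
  refine (near_imp _ _ _ (near_and _ _ (evalF_star F HF) NF)). intros z zeta [-> ->]. reflexivity.
Qed.

Lemma rep_model4 : rep model4 model.
Proof.
  destruct rep_X as (rep_X1 & rep_X2 & rep_X3 & rep_X4).
  assert (RG := rep_self gam0 cv_gam0). assert (RH := rep_cst (RtoC (/ 2))).
  assert (A := proj2 (rep_add _ _ _ _ (rep_cst (RtoC 1)) (rep_mul _ _ _ _ rep_X2 (rep_mul _ _ _ _ rep_X4
    RG)))).
  rewrite cst_1, <- gam0_geom in A.
  assert (D := rep_mul _ _ _ _ (rep_add _ _ _ _ (rep_mul _ _ _ _ rep_X1 rep_X3) (rep_add _ _ _ _
    (rep_mul _ _ _ _ RH (rep_mul _ _ _ _ (rep_mul _ _ _ _ rep_X1 rep_X1) rep_X4))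
    (rep_mul _ _ _ _ RH (rep_mul _ _ _ _ (rep_mul _ _ _ _ rep_X3 rep_X3) rep_X2)))) RG).
  fold half4 model_poly in D. rewrite <- model4E in D.
  split; [apply D|]. refine (near_imp _ _ _ (near_and _ _ A (proj2 D))). clear.
  intros z zeta [A ->]. cbv beta in A.
  set (G := evalF gam0 z zeta) in *.
  (* This identity shows both that the denominator of the model is nonzero and that [G] is its
     inverse. *)
  assert (U : ((1 - zeta * Cconj zeta) * G)%C = 1).
  { transitivity (G - zeta * (Cconj zeta * G))%C; [ring|]. rewrite A at 1. ring. }
  assert (NZ : (1 - zeta * Cconj zeta)%C <> 0).
  { intros Q. rewrite Q, Cmult_0_l in U. apply RtoC_inj in U. lra. }
  unfold model, Cdiv.
  replace (RtoC (1 / 2)) with (RtoC (/ 2)) by (f_equal; field).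
  replace (Cinv (1 - zeta * Cconj zeta)%C) with G; [reflexivity|].
  transitivity (/ (1 - zeta * Cconj zeta) * (1 - zeta * Cconj zeta) * G)%C.
  - rewrite Cinv_l by exact NZ. ring.
  - rewrite <- Cmult_assoc, U. ring.
Qed.

Lemma psum2_slice F z zeta N : hol F ->
  psum2 (slice F) z zeta N = psum4 F z zeta (Cconj z) (Cconj zeta) N.
Proof.
  intros H. unfold psum2, psum4. apply csum_ext; intros a _. apply csum_ext; intros b Hb.
  assert (L : (1 <= N)%nat) by lia.
  symmetry. rewrite (csum_gsum _ N), (gsum_trunc Cr _ 1 N L).
  - cbn [gsum]. rewrite (csum_gsum _ N), (gsum_trunc Cr _ 1 N L).
    + change ((0 + (0 + F a b 0%nat 0%nat * (Cpow z a * Cpow zeta b * (1 * 1))))%C = (F a b 0%nat 0%nat *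
      (Cpow z a * Cpow zeta b))%C).
      ring.
    + intros d Hd. rewrite H by lia. apply Cmult_0_l.
  - intros c Hc. apply (gsum_zero Cr); intros d Hd. rewrite H by lia. apply Cmult_0_l.
Qed.

Lemma eval2_slice F z zeta : hol F -> eval2 (slice F) z zeta = evalF F z zeta.
Proof.
  intros H. unfold eval2, evalF, eval4.
    f_equal; f_equal; apply Lim_seq_ext; intros N; now rewrite psum2_slice.
Qed.

Lemma cv2_slice F : convergent4 F -> convergent2 (slice F).
Proof.
  intros (r & B & Hr & HB). exists r, B; split; [exact Hr|]. intros N. eapply Rle_trans; [|apply (HB N)].
  assert (P : forall a b c d, 0 <= Cmod (F a b c d) * r ^ (a + b + c + d))
    by (intros; apply Rmult_le_pos; [apply Cmod_ge_0|apply pow_le; lra]).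
  apply rsum_le; intros a _. apply rsum_le; intros b Hb.
  apply Rle_trans with (rsum (fun c => rsum (fun d => Cmod (F a b c d) * r ^ (a + b + c + d)) N) 1).
  - cbn [rsum]. rewrite Rplus_0_l.
    apply Rle_trans with (rsum (fun d => Cmod (F a b 0%nat d) * r ^ (a + b + 0 + d)) 1).
    + cbn [rsum]. rewrite Rplus_0_l, !Nat.add_0_r. unfold slice. lra.
    + apply rsum_mono; [auto|lia].
  - apply rsum_mono; [|lia]. intros; now apply rsum_ge0.
Qed.

(** The difference with the constant term has order 1, so its values near the origin, and in
    particular at it, are below any positive bound. *)
Lemma evalF_00 F : convergent4 F -> evalF F (RtoC 0) (RtoC 0) = o4 F.
Proof.
  intros CF.
  assert (O : ord 1 (F - cst (o4 F))%s4).
  { apply ord1_o4. change ((o4 F - o4 (cst (o4 F)))%C = 0). unfold o4 at 2. rewrite cstE. ring. }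
  assert (CD : convergent4 (F - cst (o4 F))%s4) by (apply cv_sub; [exact CF|apply cv_cst]).
  assert (Z : evalF (F - cst (o4 F))%s4 (RtoC 0) (RtoC 0) = 0).
  { apply Cmod_eq_0. apply Rle_antisym; [|apply Cmod_ge_0]. apply le_epsilon; intros eps He.
    destruct (near_small _ eps CD O He) as (e & He' & HN). rewrite Rplus_0_l. left.
    apply HN; rewrite Cmod_0; exact He'. }
  destruct (rep_sub _ _ _ _ (rep_self F CF) (rep_cst (o4 F))) as (_ & e & He & HN).
  rewrite HN in Z by (rewrite Cmod_0; exact He).
  transitivity (evalF F (RtoC 0) (RtoC 0) - o4 F + o4 F)%C; [ring|]. rewrite Z. ring.
Qed.

(** The hypothesis speaks of values on a neighbourhood; the identity theorem turns it into an
    identity of series, which can then be read coefficient by coefficient. *)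
Lemma levi_det_zero F : convergent4 F -> levi_rank1_2nondeg F -> levi_det F = zero4.
Proof.
  intros CF ND. assert (C13 := cv_d_z _ (cv_d_zb _ CF)). assert (C14 := cv_d_z _ (cv_d_zetab _ CF)).
  assert (C23 := cv_d_zeta _ (cv_d_zb _ CF)). assert (C24 := cv_d_zeta _ (cv_d_zetab _ CF)).
  apply identity_theorem; [exact (cv_sub _ _ (cv_mul _ _ C13 C24) (cv_mul _ _ C14 C23))|].
  assert (N := proj2 (rep_sub _ _ _ _ (rep_mul _ _ _ _ (rep_self _ C13) (rep_self _ C24))
    (rep_mul _ _ _ _ (rep_self _ C14) (rep_self _ C23)))).
  refine (near_imp _ _ _ (near_and _ _ N ND)). cbv zeta.
  intros z zeta (E3 & _ & E4 & _). unfold levi_det. rewrite E3. exact E4.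
Qed.

(** * Removal of the pluriharmonic terms and scaling *)

Section Reduction.
Variable F : coef4.
Hypotheses (CF : convergent4 F) (HF : hermitian F) (F0 : (F 0 0 0 0)%nat = 0)
  (DF : levi_det F = zero4).
Variable rho : R.

Definition pluri : coef4 := hlift (slice F).
Definition reduced : coef4 := (cst (RtoC rho) * (F - (pluri + star pluri)))%s4.

Lemma reducedE a b c d : reduced a b c d =
  Cmult (RtoC rho) (if orb (a + b =? 0)%nat (c + d =? 0)%nat then RtoC 0 else F a b c d).
Proof.
  unfold reduced. rewrite cst_mulE, sub4E, add4E. f_equal. unfold star, pluri, hlift, slice.
  destruct a as [|a], b as [|b], c as [|c], d as [|d]; cbn [Nat.add Nat.eqb orb];
  rewrite ?F0, ?Cconj_0, <- ?(HF _ _ 0 0)%nat; try ring;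
  match goal with |- context [Cconj (F ?i ?j 0%nat 0%nat)] => rewrite <- (HF i j 0%nat 0%nat); ring end.
Qed.

Lemma reduced_adm : adm reduced.
Proof.
  constructor.
  - unfold reduced. apply cv_mul; [apply cv_cst|]. apply cv_sub; [exact CF|].
    assert (CP := cv_hlift F CF). apply cv_add; [exact CP|now apply star_cv].
  - intros a b c d. rewrite !reducedE, Cmult_conj, Cconj_R, Bool.orb_comm. f_equal.
    destruct (orb (a + b =? 0)%nat (c + d =? 0)%nat); [now rewrite Cconj_0|apply HF].
  (* Mixed second derivatives do not see pluriharmonic terms, so the Levi determinant is only scaled
     by rho^2. *)
  - assert (E : levi_det reduced = (cst (RtoC rho) * cst (RtoC rho) * levi_det F)%s4).
    { unfold levi_det.
      assert (Q1 : d_z (d_zb reduced) = (cst (RtoC rho) * d_z (d_zb F))%s4).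
      { apply coef4_ext; intros a b c d. rewrite cst_mulE. unfold d_z, d_zb. rewrite reducedE.
        cbn [Nat.add Nat.eqb orb]. ring. }
      assert (Q2 : d_z (d_zetab reduced) = (cst (RtoC rho) * d_z (d_zetab F))%s4).
      { apply coef4_ext; intros a b c d. rewrite cst_mulE. unfold d_z, d_zetab.
        rewrite reducedE, Nat.add_succ_r. cbn [Nat.add Nat.eqb orb]. ring. }
      assert (Q3 : d_zeta (d_zb reduced) = (cst (RtoC rho) * d_zeta (d_zb F))%s4).
      { apply coef4_ext; intros a b c d. rewrite cst_mulE. unfold d_zeta, d_zb.
        rewrite reducedE, Nat.add_succ_r. cbn [Nat.add Nat.eqb orb]. ring. }
      assert (Q4 : d_zeta (d_zetab reduced) = (cst (RtoC rho) * d_zeta (d_zetab F))%s4).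
      { apply coef4_ext; intros a b c d. rewrite cst_mulE. unfold d_zeta, d_zetab.
        rewrite reducedE, !Nat.add_succ_r. cbn [Nat.add Nat.eqb orb]. ring. }
      rewrite Q1, Q2, Q3, Q4. ring. }
    rewrite E, DF. ring.
Qed.

Lemma reduced_slice : slice reduced = slice zero4.
Proof.
  extensionality a; extensionality b. unfold slice. rewrite reducedE.
  replace (orb (a + b =? 0)%nat (0 + 0 =? 0)%nat) with true by now rewrite Bool.orb_true_r. apply Cmult_0_r.
Qed.

Lemma near_reduced : near (fun z zeta => evalF reduced z zeta =
  Cmult (RtoC rho) (Cminus (evalF F z zeta) (RtoC (2 * Re (evalF pluri z zeta))))).
Proof.
  assert (RP := rep_self pluri (cv_hlift F CF)).
  refine (near_imp _ _ _ (proj2 (rep_mul _ _ _ _ (rep_cst (RtoC rho))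
    (rep_sub _ _ _ _ (rep_self F CF) (rep_add _ _ _ _ RP (rep_star _ _ RP)))))).
  intros z zeta E. unfold reduced. rewrite E.
  do 2 f_equal. destruct (evalF pluri z zeta) as [x y].
  apply injective_projections; unfold Cplus, Cconj, RtoC, Re; cbn; ring.
Qed.
End Reduction.

Theorem theorem7p10 (F : coef4)
  (Fconv : convergent4 F)
  (Freal : real_valued F)
  (F0 : F 0%nat 0%nat 0%nat 0%nat = RtoC 0)
  (Fnd : levi_rank1_2nondeg F) :
  exists (f g h : coef2) (rho : R) (G : coef4),
    (* the local rigid biholomorphism (z,zeta,w) |-> (f, g, rho w + h) *)
    convergent2 f /\ convergent2 g /\ convergent2 h /\
    f 0%nat 0%nat = RtoC 0 /\ g 0%nat 0%nat = RtoC 0 /\ h 0%nat 0%nat = RtoC 0 /\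
    Cminus (Cmult (f 1%nat 0%nat) (g 0%nat 1%nat))
           (Cmult (f 0%nat 1%nat) (g 1%nat 0%nat)) <> RtoC 0 /\
    rho <> 0 /\
    (* the target rigid hypersurface  u = model + G *)
    convergent4 G /\ real_valued G /\
    (* (1) *)
    (forall a b c d : nat, (a + c < 3)%nat -> G a b c d = RtoC 0) /\
    (* (2) *)
    (forall a b : nat, G a b 0%nat 0%nat = RtoC 0 /\ G a b 1%nat 0%nat = RtoC 0 /\
                       G a b 2%nat 0%nat = RtoC 0) /\
    (forall c d : nat, G 0%nat 0%nat c d = RtoC 0 /\ G 1%nat 0%nat c d = RtoC 0 /\
                       G 2%nat 0%nat c d = RtoC 0) /\
    (* (3) *)
    G 3%nat 0%nat 0%nat 1%nat = RtoC 0 /\ G 0%nat 1%nat 3%nat 0%nat = RtoC 0 /\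
    Im (G 3%nat 0%nat 1%nat 1%nat) = 0 /\ Im (G 1%nat 1%nat 3%nat 0%nat) = 0 /\
    (* the map sends M to M' near the origin (and its complement to the complement) *)
    exists eps : R, 0 < eps /\
      forall z zeta w : C, Cmod z < eps -> Cmod zeta < eps -> Cmod w < eps ->
        (RtoC (Re w) = evalF F z zeta <->
         let z' := eval2 f z zeta in
         let zeta' := eval2 g z zeta in
         let w' := Cplus (Cmult (RtoC rho) w) (eval2 h z zeta) in
         RtoC (Re w') = Cplus (model z' zeta') (evalF G z' zeta')).
Proof.
  assert (HF := hermitian_of_real F Fconv Freal).
  assert (DF := levi_det_zero F Fconv Fnd).
  (* Both nonvanishing conditions read at the origin on coefficients; the factor 2 that is dropped
     comes from the double z-derivative. *)
  assert (PT : (F 1 0 1 0)%nat <> 0 /\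
    ((F 1 0 1 0)%nat * (F 2 0 0 1)%nat - (F 1 0 0 1)%nat * (F 2 0 1 0)%nat)%C <> 0).
  { destruct Fnd as (r & Hr & HN). specialize (HN (RtoC 0) (RtoC 0)). rewrite Cmod_0 in HN.
    destruct (HN Hr Hr) as (N1 & _ & N2).
    assert (C3 := cv_d_zb _ Fconv). assert (C4 := cv_d_zetab _ Fconv).
    rewrite (evalF_00 _ (cv_d_z _ C3)) in N1, N2.
    rewrite (evalF_00 _ (cv_d_z _ C4)), (evalF_00 _ (cv_d_z _ (cv_d_z _ C3))),
      (evalF_00 _ (cv_d_z _ (cv_d_z _ C4))) in N2.
    unfold o4, d_z, d_zb, d_zetab in N1, N2. cbn [INR] in N1, N2.
    replace (RtoC (1 + 1)) with (RtoC 2) in N2 by (f_equal; ring).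
    split; intros Q; [apply N1|apply N2].
    - rewrite Q. ring.
    - match type of Q with ?L = _ => transitivity (2 * L)%C; [ring|rewrite Q; ring] end. }
  destruct PT as [P1 P2].
  set (lam := Re (F 1 0 1 0)%nat).
  assert (L1 : (F 1 0 1 0)%nat = RtoC lam).
  { assert (E := (HF 1 0 1 0)%nat). unfold lam. destruct (F 1 0 1 0)%nat as [x y].
    unfold Cconj in E; cbn in E.
    injection E as E. apply injective_projections; unfold RtoC; cbn; lra. }
  assert (L0 : lam <> 0) by (intros Q; apply P1; now rewrite L1, Q).
  set (rho := / lam).
  assert (R0 : rho <> 0) by now apply Rinv_neq_0_compat.
  set (K := reduced F rho).
  assert (AK : adm K) by now apply reduced_adm.
  assert (SK : slice K = slice zero4) by now apply reduced_slice.
  assert (KE := reducedE F HF F0 rho). fold K in KE.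
  assert (K1 : (K 1 0 1 0)%nat = 1).
  { rewrite KE. cbn [Nat.add Nat.eqb orb]. rewrite L1, <- RtoC_mult. f_equal. unfold rho. field. exact L0. }
  destruct (phase_linear K AK SK K1) as (f1 & g1 & K' & Q1 & PN1).
  (* After multiplication by lam^2, the quantity required by [phase_linear] is the conjugate of the
     determinant in [P2]. *)
  { rewrite !KE. cbn [Nat.add Nat.eqb orb]. intros Q. apply P2.
    assert (Q' : Cconj ((F 1 0 1 0)%nat * (F 2 0 0 1)%nat - (F 1 0 0 1)%nat * (F 2 0 1 0)%nat)%C = 0).
    { unfold Cminus. rewrite Cplus_conj, Copp_conj, !Cmult_conj, <- !HF.
      assert (M : (RtoC lam * RtoC rho)%C = 1)
        by (rewrite <- RtoC_mult; f_equal; unfold rho; field; exact L0).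
      match type of Q with ?L = _ => transitivity (RtoC lam * RtoC lam * L)%C end.
      - rewrite L1. transitivity (RtoC lam * RtoC rho * RtoC lam * (F 0 1 2 0)%nat - RtoC lam * RtoC rho *
        (RtoC lam * RtoC rho) * ((F 0 1 1 0)%nat * (F 1 0 2 0)%nat))%C;
          [rewrite M; ring|ring].
      - rewrite Q. ring. }
    apply (f_equal Cconj) in Q'. rewrite Cconj_conj, Cconj_0 in Q'. exact Q'. }
  set (k := (K' 0 1 3 0)%nat).
  (* With h = k the coefficient [0 1 3 0] disappears. The constraint fixes only the real part of
     [be2]; the real choice suffices, as the next change corrects [1 1 3 0]. *)
  destruct (phase_prenormal K' PN1 k (- (5 * (k * Cconj k)))%C) as (f2 & g2 & K2 & Q2 & PN2 & Z2' & _).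
  { rewrite Copp_conj, !Cmult_conj, Cconj_conj, Cconj_R.
    replace (RtoC 10) with (5 + 5)%C by (rewrite <- RtoC_plus; f_equal; ring). ring. }
  (* For h = 0 the constraint asks for a purely imaginary value. This one cancels the imaginary part
     of [K2 1 1 3 0] and, since h = 0, leaves the coefficient [0 1 3 0] at zero. *)
  set (be := (- RtoC (Im (K2 1 1 3 0)%nat) * Ci)%C).
  destruct (phase_prenormal K2 PN2 (RtoC 0) be) as (f3 & g3 & H & Q3 & PN & Z3 & I3).
  { unfold be. apply injective_projections; unfold Cconj, RtoC, Cmult, Cplus, Copp, Ci; cbn; ring. }
  rewrite Z2' in Z3. specialize (I3 eq_refl).
  assert (QQ := equiv_trans _ _ _ _ _ _ _ (equiv_trans _ _ _ _ _ _ _ Q1 Q2) Q3).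
  set (f := hcomp f3 _ _) in QQ. set (g := hcomp g3 _ _) in QQ.
  destruct QQ as [[Cf Cg hf hg Of Og J] NE].
  assert (AH := pn_adm H PN). assert (HH := adm_herm H AH). assert (CH := adm_cv H AH).
  (* With this shift Re w' = rho (Re w - 2 Re pluri), to be compared with K = rho (F - 2 Re pluri).
     The two equations are then equivalent because [rho] is nonzero. *)
  set (h := (cst (RtoC (-2 * rho)) * pluri F)%s4).
  assert (CPl : convergent4 (pluri F)) by now apply cv_hlift.
  assert (hh : hol h) by apply hol_scal, hol_hlift.
  set (G := (H - model4)%s4).
  assert (GE : forall a b c d, G a b c d = (H a b c d - model_coef a b c d)%C) by reflexivity.
  assert (MS : forall a b c d, model_coef c d a b = Cconj (model_coef a b c d)).
  { intros a b c d. unfold model_coef.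
    destruct a as [|[|[|a]]], c as [|[|[|c]]]; rewrite ?Cconj_R; try reflexivity.
    - rewrite (Nat.eqb_sym (S d) b). destruct (b =? S d)%nat; now rewrite Cconj_R.
    - rewrite (Nat.eqb_sym d b). destruct (b =? d)%nat; now rewrite Cconj_R.
    - rewrite (Nat.eqb_sym d (S b)). destruct (S b =? d)%nat; now rewrite Cconj_R. }
  assert (HG : hermitian G).
  { intros a b c d. rewrite !GE, HH, MS. unfold Cminus. now rewrite Cplus_conj, Copp_conj. }
  assert (CG : convergent4 G) by (apply cv_sub; [exact CH|apply rep_model4]).
  assert (G2 : forall a b, G a b 0%nat 0%nat = 0 /\ G a b 1%nat 0%nat = 0 /\ G a b 2%nat 0%nat = 0).
  { intros a b. rewrite !GE, (pn_ab20 H PN), (pn_ab10 H PN).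
    assert (E : H a b 0%nat 0%nat = 0) by exact (slice_eq_coef _ _ a b (pn_0 H PN)). rewrite E.
    unfold model_coef.
    split; [|split]; destruct a as [|[|[|a]]], b as [|[|b]]; cbn [Nat.eqb]; ring. }
  assert (G3 : (G 0 1 3 0)%nat = 0) by (rewrite GE, Z3; unfold k; cbn; ring).
  assert (G4 : Im (G 1 1 3 0)%nat = 0).
  { rewrite GE. change (model_coef 1 1 3 0) with (RtoC 0). rewrite I3. unfold be.
    destruct (K2 1 1 3 0)%nat as [x y]. unfold Cminus, Cplus, Cmult, Copp, RtoC, Ci, Im. cbn. ring. }
  exists (slice f), (slice g), (slice h), rho, G.
  split; [now apply cv2_slice|]. split; [now apply cv2_slice|].
  split; [apply cv2_slice, cv_mul; [apply cv_cst|exact CPl]|].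
  split; [exact (proj1 (ord1_o4 _) Of)|]. split; [exact (proj1 (ord1_o4 _) Og)|].
  split; [unfold slice, h; rewrite cst_mulE; unfold pluri, hlift, slice; rewrite F0; ring|].
  split; [rewrite <- jac_slices; exact J|]. split; [exact R0|]. split; [exact CG|].
  split; [now apply real_of_hermitian|].
  split; [intros a b c d L; rewrite GE, (pn_model H PN) by exact L; ring|].
  split; [exact G2|].
  split.
  { intros c d. destruct (G2 c d) as (A & B & D).
    rewrite (HG c d 0 0)%nat, (HG c d 1 0)%nat, (HG c d 2 0)%nat, A, B, D, Cconj_0. auto. }
  split; [rewrite (HG 0 1 3 0)%nat, G3; apply Cconj_0|]. split; [exact G3|].
  split; [rewrite (HG 1 1 3 0)%nat; unfold Cconj; cbn -[G]; unfold Im in G4; rewrite G4; ring|].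
  split; [exact G4|].
  assert (N1 := near_reduced F Fconv rho). fold K in N1.
  assert (N2 := proj2 (rep_mul _ _ _ _ (rep_cst (RtoC (-2 * rho))) (rep_self _ CPl))). fold h in N2.
  assert (N3 := near_comp _ f g Cf Cg Of Og (proj2 (rep_add _ _ _ _ (rep_self G CG) rep_model4))).
    cbv beta in N3.
  destruct (near_and _ _ (near_and _ _ NE N1) (near_and _ _ N2 N3)) as (eps & He & HN).
  exists eps; split; [exact He|]. intros z zeta w Hz Hze _. cbv zeta.
  destruct (HN z zeta Hz Hze) as [[E1 E2] [E3 E4]].
  rewrite !eval2_slice by assumption.
  replace (G + model4)%s4 with H in E4 by (unfold G; ring).
  rewrite (Cplus_comm (model _ _)), <- E4, <- E1, E2, E3.
  replace (Re (Cplus (RtoC rho * w)%C (RtoC (-2 * rho) * evalF (pluri F) z zeta)%C)) with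
    (rho * (Re w - 2 * Re (evalF (pluri F) z zeta))) by (unfold Re, Cplus, Cmult, RtoC; cbn; ring).
  split; intros Q.
  - rewrite <- Q, <- RtoC_minus, <- RtoC_mult. reflexivity.
  - rewrite RtoC_mult, RtoC_minus in Q.
    assert (NZ : RtoC rho <> 0) by (intros T; apply RtoC_inj in T; contradiction).
    assert (T : (RtoC (Re w) - evalF F z zeta)%C = 0).
    { apply (Cmult_eq_0_l _ _ NZ).
      match type of Q with ?A = ?B => transitivity (A - B)%C; [ring|rewrite Q; ring] end. }
    transitivity (RtoC (Re w) - evalF F z zeta + evalF F z zeta)%C; [ring|rewrite T; ring].
Qed.
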